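(* Assume that $p/n_j \to y_j \in (0,\infty)$ for $j=1,2$, that $y := y_1y_2/(y_1+y_2)<1$, and that $\Delta=\sqrt{(\mu_1-\mu_2)^{T}\Sigma^{-1}(\mu_1-\mu_2)}$ is a constant. Then the misclassification rate of linear discriminant analysis, $$R_{\mathrm{LDA}}=\frac{1}{2}\sum_{j=1}^2 \Phi\left(\frac{(-1)^j\left(\mu_j-\frac{\bar{X}_1+\bar{X}_2}{2}\right)^{T} S_n^{-1}(\bar{X}_1-\bar{X}_2)}{\sqrt{(\bar{X}_1-\bar{X}_2)^{T} S_n^{-1} \Sigma S_n^{-1}(\bar{X}_1-\bar{X}_2)}}\right),$$ satisfies $$R_{\mathrm{LDA}}\xrightarrow{\;p\;} \frac{1}{2}\sum_{j=1}^2 \Phi\left(- \frac{\Delta^2+(-1)^j(y_1-y_2)}{2\sqrt{\Delta^2+y_1+y_2}} \sqrt{1-y}\right).$$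
   Context: Setting (asymptotic along a sequence of problems with $p,n_1,n_2\to\infty$): $\mu_1\neq\mu_2$ are vectors in $\mathbb{R}^p$ and $\Sigma$ is a $p\times p$ (invertible) covariance matrix, all allowed to depend on $p$. $\{X_{1,j}\}_{j=1}^{n_1}$ and $\{X_{2,j}\}_{j=1}^{n_2}$ are independent i.i.d. samples from $N_p(\mu_1,\Sigma)$ and $N_p(\mu_2,\Sigma)$ respectively, $n=n_1+n_2$, $\bar X_k=\frac{1}{n_k}\sum_{j=1}^{n_k}X_{k,j}$, and $$S_n=\frac{1}{n-2}\sum_{k=1}^2\sum_{j=1}^{n_k}(X_{k,j}-\bar X_k)(X_{k,j}-\bar X_k)^{T}.$$ $\Phi$ is the standard normal distribution function and $\xrightarrow{p}$ denotes convergence in probability. The quantity $\Delta$ is assumed to be a constant (not depending on $p,n_1,n_2$). $R_{\mathrm{LDA}}$ is the misclassification rate, conditional on the samples and with equal weights $1/2$ on the two types of error, of the LDA classifier that assigns a new independent observation $X$ to class 1 if and only if $\left(X-\frac{\bar X_1+\bar X_2}{2}\right)^{T}S_n^{-1}(\bar X_1-\bar X_2)>0$, where $X$ belongs to class $k$ if $X\sim N(\mu_k,\Sigma)$. *)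

(* Defs.v *)
From mathcomp Require Import all_boot all_order all_algebra.
From mathcomp Require Import all_classical all_reals all_analysis.

Set Implicit Arguments.
Unset Strict Implicit.
Unset Printing Implicit Defensive.

Import Order.TTheory GRing.Theory Num.Theory.
Import numFieldNormedType.Exports.

Local Open Scope classical_set_scope.
Local Open Scope ring_scope.

Definition dot (R : realType) (p : nat) (u v : 'cV[R]_p) : R :=
  (u^T *m v) 0 0.

Definition covariance_matrix (R : realType) (p : nat) (A : 'M[R]_p) : Prop :=
  A^T = A /\ forall u : 'cV[R]_p, 0 <= dot u (A *m u).

(* R^p with its Borel sigma-algebra *)
Notation borel_cV R p := (g_sigma_algebraType (@open 'cV[R]_p)).

(* N(m, v) on the real line, parametrized by the variance v; the case v = 0 is
   separate because normal_prob m 0 is not the point mass at m. *)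
Definition normal_law (R : realType) (m v : R) (A : set R) : \bar R :=
  if v == 0 then \d_m A else normal_prob m (Num.sqrt v) A.

(* Standard normal distribution function *)
Definition Phi (R : realType) (x : R) : R :=
  fine (normal_prob (0 : R) 1 `]-oo, x]).

(* X ~ N_p(mu, Sigma): every linear combination t^T X of the coordinates has
   the law N(t^T mu, t^T Sigma t). *)
Definition multivariate_normal d (T : measurableType d) (R : realType)
    (P : probability T R) (p : nat) (mu : 'cV[R]_p) (Sigma : 'M[R]_p)
    (X : {RV P >-> borel_cV R p}) : Prop :=
  forall (t : 'cV[R]_p) (A : set R), measurable A ->
    P [set w | A (dot t (X w))]
    = normal_law (dot t mu) (dot t (Sigma *m t)) A.

(* Taking some of the B i to be setT gives the product rule for subfamilies. *)
Definition mutually_independent d d' (T : measurableType d)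
    (T' : measurableType d') (R : realType) (P : probability T R)
    (I : finType) (X : I -> {RV P >-> T'}) : Prop :=
  forall B : I -> set T', (forall i, measurable (B i)) ->
    P (\bigcap_(i in [set: I]) (X i @^-1` B i))
    = (\prod_(i : I) P (X i @^-1` B i))%E.

(* Convergence in probability of Z m to the constant c, where each Z m may
   live on its own probability space. *)
Definition cvg_in_probability (R : realType) (d : nat -> measure_display)
    (T : forall m, measurableType (d m)) (P : forall m, probability (T m) R)
    (Z : forall m, T m -> R) (c : R) : Prop :=
  forall eps : R, 0 < eps ->
    (fun m => P m [set w | eps < `|Z m w - c|]) @ \oo --> 0%E.

(* Classes are indexed by 'I_2 = {0, 1}, so class number j = 1, 2 has index
   k = j - 1 and the sign (-1)^j reads (-1) ^+ k.+1. *)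
Definition class1 : 'I_2 := ord0.
Definition class2 : 'I_2 := ord_max.

Section LDA.
Variables (R : realType) (p : nat) (n : 'I_2 -> nat).
Variable x : forall k : 'I_2, 'I_(n k) -> 'cV[R]_p.
Arguments x : clear implicits.

Definition sample_mean (k : 'I_2) : 'cV[R]_p :=
  (n k)%:R^-1 *: \sum_(j < n k) x k j.

Definition mean_diff : 'cV[R]_p := sample_mean class1 - sample_mean class2.

Definition midpoint : 'cV[R]_p :=
  2^-1 *: (sample_mean class1 + sample_mean class2).

(* S_n; the factor 1/(n - 2) uses subtraction in R, not in nat. *)
Definition pooled_cov : 'M[R]_p :=
  ((n class1 + n class2)%:R - 2)^-1 *:
    \sum_(k < 2) \sum_(j < n k)
      (x k j - sample_mean k) *m (x k j - sample_mean k)^T.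

Definition lda_classify (z : 'cV[R]_p) : 'I_2 :=
  if 0 < dot (z - midpoint) (invmx pooled_cov *m mean_diff)
  then class1 else class2.

(* Misclassification rate of the rule built from the fixed training data x,
   where Z k is the new observation given that it belongs to class k. *)
Definition lda_rate d (T : measurableType d) (Q : probability T R)
    (Z : 'I_2 -> {RV Q >-> borel_cV R p}) : R :=
  2^-1 * \sum_(k < 2) fine (Q [set w | lda_classify (Z k w) != k]).

Definition lda_rate_formula (mu : 'I_2 -> 'cV[R]_p) (Sigma : 'M[R]_p) : R :=
  2^-1 * \sum_(k < 2)
    Phi ((-1) ^+ k.+1 * dot (mu k - midpoint) (invmx pooled_cov *m mean_diff)
         / Num.sqrt (dot mean_diff (invmx pooled_cov *m Sigma
                                      *m invmx pooled_cov *m mean_diff))).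

End LDA.

(* Main.v *)
(** Whitening by a factor [Sigma = L L^T] turns the sample into a matrix [z] with independent standard
normal entries.  The class means are [L h_k] up to the true means, where [h_k = z^T e_k / sqrt n_k], and the
pooled covariance is [L W L^T / N] with [W = z^T M z], where [M] is the projection orthogonal to the class
vectors [e_k] and [N = tr M].  The rate is a continuous function of [N h_k^T W^-1 d], [N d^T W^-1 d] and
[N^2 d^T W^-2 d], where [d] is the whitened mean difference.  Since [W] only depends on [M z] it is
independent of the [h_k], so one may resample it and fix [d] and [h_k]; polarization then reduces everything
to [N u^T W^-1 u -> (1 - y)^-1] and [N^2 u^T W^-2 u -> (1 - y)^-3] in probability, uniformly over unit
vectors [u], and to the laws of large numbers [|h_k|^2 -> y_k], [h_1 . h_2 -> 0], [delta . h_k -> 0].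

For the inverse moments, regress the column [x = z u] on the other columns: [u^T W^-1 u = 1 / s], where [s]
is the squared norm of the residual, and [u^T W^-2 u = (1 + |b|^2) / s^2], where [b] is the vector of
regression coefficients.  Given the other columns, [s] is the squared length of a projected Gaussian vector,
so Chebyshev's inequality applies.  The coefficients are [b = B x] with [x] Gaussian and independent of [B];
by Gaussian duality [E exp (- |B x|^2 / 2) = E exp (- |B^T g|^2 / 2)], and [|B^T g|^2] is a quadratic form of
the same inverse type in [g], which is already known to concentrate. *)

From HB Require Import structures.
Require Import Defs.
From mathcomp Require Import all_boot all_order all_algebra.
From mathcomp Require Import all_classical all_reals all_analysis.
From mathcomp Require Import measurable_realfun ring lra.

Set Implicit Arguments.
Unset Strict Implicit.
Unset Printing Implicit Defensive.

Import Order.TTheory GRing.Theory Num.Theory.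
Import numFieldNormedType.Exports.

Local Open Scope classical_set_scope.
Local Open Scope ring_scope.

(** No conditional law and no Wishart density appears. Being Gaussian is a statement about
    characteristic functions, so gluing two independent copies of [z] along complementary
    projections gives a matrix with the law of [z]. Fixing the first copy on the product space is
    what conditioning amounts to. Each problem of the sequence lives on its own probability space
    and the fixed vectors are arbitrary, so the concentration lemmas choose their constants before
    the space, the sample and the direction.

    The exponent 3 arises as follows: [s / N] tends to [1 - y] and [|b|^2] to [y / (1 - y)], so
    [N^2 (1 + |b|^2) / s^2] tends to [(1 + y / (1 - y)) / (1 - y)^2 = (1 - y)^-3]. The norm of [b]
    is the obstacle: [B^T B] is no projection, so the second moment bound that controls [s] does not
    apply to [|B x|^2]. Duality transfers Laplace transforms, not tails. Two arguments of the
    transform suffice because the limit [c] is a constant: they determine the mean square distance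
    of [exp (- |B x|^2 / 2)] to [exp (- c / 2)]. *)

Lemma bounded_integrable d (T : measurableType d) (R : realType) (P : probability T R) (h : T -> R) C :
  measurable_fun setT h -> (forall x, `|h x| <= C) -> P.-integrable setT (EFin \o h).
Proof.
move=> mh hC; apply: measurable_bounded_integrable => //.
  by rewrite [X in (X < _)%E]probability_setT ltry.
by exists C; split => [|M CM x _]; [rewrite num_real|rewrite /= (le_trans (hC x))// ltW].
Qed.

(** * Integrals against image measures *)

Section density_image.
Context d1 d2 (T : measurableType d1) (S : measurableType d2) (R : realType).
Variables (m : {measure set T -> \bar R}) (nu : {measure set S -> \bar R}) (phi : T -> S) (g : T -> R).
Hypotheses (mphi : measurable_fun setT phi) (g0 : forall x, 0 <= g x) (mg : measurable_fun setT g).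
Hypothesis nuE : forall A, measurable A -> nu A = (\int[m]_(x in phi @^-1` A) (g x)%:E)%E.
Local Open Scope ereal_scope.
Import HBNNSimple.

(** Density and image are treated together because both occur: the normal law has a density with
    [phi] the identity, while [Rintegral_decorrelated] pushes a reweighted probability forward along
    a random variable. *)
Lemma ge0_integral_density (f : S -> \bar R) : measurable_fun setT f -> (forall x, 0 <= f x) ->
  \int[nu]_x f x = \int[m]_x (f (phi x) * (g x)%:E).
Proof.
move=> mf f0.
have mge : measurable_fun setT (EFin \o g) by apply/measurable_EFinP.
have mpre A : measurable A -> measurable (phi @^-1` A).
  by move=> mA; rewrite -[X in measurable X]setTI; exact: mphi.
have mcomp (h : S -> R) : measurable_fun setT h -> measurable_fun setT (fun x => (h (phi x))%:E).
  by move=> mh; apply/measurable_EFinP; exact: measurableT_comp.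
have ind E : measurable E -> \int[nu]_x (\1_E x)%:E = \int[m]_x ((\1_E (phi x))%:E * (g x)%:E).
  move=> mE; rewrite integral_indic// setIT nuE// integral_mkcond.
  apply: eq_integral => x _; rewrite patchE indicE.
  have -> : (phi x \in E) = (x \in phi @^-1` E) by apply/idP/idP; rewrite !inE.
  by case: ifPn => _; rewrite ?mul1e ?mul0e.
pose f_ := nnsfun_approx measurableT mf.
have sf (h : {nnsfun S >-> R}) : \int[nu]_x (h x)%:E = \int[m]_x ((h (phi x))%:E * (g x)%:E).
  under eq_integral do rewrite fimfunE -fsumEFin//.
  under [RHS]eq_integral => x _.
    rewrite fimfunE -fsumEFin// ge0_mule_fsuml; last by move=> r; rewrite EFinM nnfun_muleindic_ge0.
    over.
  rewrite ge0_integral_fsum//; last 2 first.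
  - by move=> r; apply/measurable_EFinP; exact: measurableT_comp.
  - by move=> n x _; rewrite EFinM nnfun_muleindic_ge0.
  rewrite ge0_integral_fsum//; last 2 first.
  - move=> r; apply: emeasurable_funM => //.
    by apply: (mcomp (fun y => r * \1_(h @^-1` [set r]) y)%R); exact: measurableT_comp.
  - by move=> n x _; rewrite mule_ge0 ?lee_fin// -lee_fin EFinM nnfun_muleindic_ge0.
  apply: eq_fsbigr => r _.
  have [r0|r0] := leP 0%R r.
    under eq_integral do rewrite EFinM.
    rewrite ge0_integralZl//; last by apply/measurable_EFinP.
    rewrite ind//.
    under [RHS]eq_integral do rewrite EFinM -muleA.
    rewrite ge0_integralZl//.
      by apply: emeasurable_funM => //; apply: mcomp.
    by move=> x _; rewrite mule_ge0 ?lee_fin.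
  rewrite preimage_nnfun0//.
  by rewrite !integral0_eq// => x _; rewrite indic0 mulr0// mul0e.
transitivity (limn (fun n => \int[nu]_x (f_ n x)%:E)).
  rewrite -monotone_convergence//; last 3 first.
  - by move=> n; exact/measurable_EFinP.
  - by move=> n x _; rewrite lee_fin.
  - by move=> x _ a b ab; rewrite lee_fin; exact/lefP/nd_nnsfun_approx.
  by apply: eq_integral => x _; apply/esym/cvg_lim => //; exact: cvg_nnsfun_approx.
transitivity (limn (fun n => \int[m]_x ((f_ n (phi x))%:E * (g x)%:E))).
  by congr (limn _); apply/funext => n; exact: sf.
rewrite -monotone_convergence//; last 3 first.
- by move=> n; apply: emeasurable_funM => //; exact: mcomp.
- by move=> n x _; rewrite mule_ge0 ?lee_fin.
- move=> x _ a b ab; apply: lee_wpmul2r; first by rewrite lee_fin.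
  by rewrite lee_fin; exact/lefP/nd_nnsfun_approx.
apply: eq_integral => x _; apply/cvg_lim => //.
apply: cvgeZr => //; exact: cvg_nnsfun_approx.
Qed.
End density_image.

Section image_law.
Context d1 d2 (X : measurableType d1) (Y : measurableType d2) (R : realType).
Variables (m : {measure set X -> \bar R}) (nu : {measure set Y -> \bar R}) (phi : X -> Y).
Hypotheses (mphi : measurable_fun setT phi)
  (nuE : forall A, measurable A -> nu A = m (phi @^-1` A)).

Lemma ge0_integral_image (D : set Y) (f : Y -> \bar R) : measurable D -> measurable_fun D f ->
  (forall y, D y -> 0 <= f y)%E ->
  (\int[nu]_(y in D) f y = \int[m]_(x in phi @^-1` D) f (phi x))%E.
Proof.
move=> mD mf f0; rewrite -(ge0_integral_pushforward mphi)//; last by move=> y /[!inE]; exact: f0.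
by apply: eq_measure_integral => A mA _; exact: nuE.
Qed.

Lemma integral_image (f : Y -> \bar R) : nu.-integrable setT f ->
  (\int[nu]_y f y = \int[m]_x f (phi x))%E.
Proof.
move=> /integrableP[mf intf].
have mfp : measurable_fun setT (f \o phi) by exact: measurableT_comp.
have intfp : m.-integrable setT (f \o phi).
  apply/integrableP; split => //; move: intf; rewrite ge0_integral_image//.
  exact: measurableT_comp.
transitivity (\int[pushforward m phi]_y f y)%E.
  by apply: eq_measure_integral => A mA _; exact: nuE.
by rewrite (integral_pushforward mphi).
Qed.
End image_law.

(** * The standard normal law on the line *)

Section normal_line.
Variable R : realType.
Notation mu := (@lebesgue_measure R).
Notation g := (normal_pdf (0 : R) 1).
Implicit Types f F h : R -> R.

Lemma integral_line_derive0 f F : continuous f ->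
  mu.-integrable setT (EFin \o f) -> (forall x : R, is_derive x (1 : R) F (f x)) ->
  F n%:R @[n --> \oo] --> (0 : R) -> F (- (n%:R)) @[n --> \oo] --> (0 : R) ->
  \int[mu]_x f x = 0.
Proof.
move=> cf intf dF F0 F0'.
(* The endpoints use [n.+1] so that the interval never degenerates to a point, as the fundamental
   theorem requires. *)
pose I n : set R := `[(- (n.+1%:R))%R, n.+1%:R]%classic.
have mI n : measurable (I n) by exact: measurable_itv.
have FTC n : (\int[mu]_(x in I n) (f x)%:E = (F n.+1%:R - F (- (n.+1%:R)))%:E)%E.
  rewrite EFinB; apply: continuous_FTC2.
  - by rewrite (@lt_trans _ _ 0)// ?oppr_lt0.
  - exact: continuous_subspaceT.
  - have cF : continuous F by move=> x; apply: differentiable_continuous; apply/derivable1_diffP; have [] := dF x.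
    split => [x _|  |].
    + by have [] := dF x.
    + apply: cvg_at_right_filter; exact: cF.
    + apply: cvg_at_left_filter; exact: cF.
  - by move=> x _; rewrite derive1E; exact: derive_val.
have [] := @dominated_convergence _ _ _ mu setT measurableT
  (fun n => (EFin \o f) \_ (I n)) (EFin \o f) (EFin \o (Num.norm \o f)).
- move=> n; apply: (iffLR (measurable_restrictT _ (mI n))).
  by apply: measurable_funTS; exact: measurable_int intf.
- exact: measurable_int intf.
- apply: aeW => x _; apply: cvg_near_cst; near=> n.
  rewrite patchE mem_set// /I/= in_itv/= -ler_norml.
  have : `|x| <= n%:R by near: n; exact: nbhs_infty_ger.
  by move=> /le_trans; apply; rewrite ler_nat.
- by apply: integrable_norm.
- apply: aeW => x n _; rewrite patchE; case: ifPn => //= _.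
  by rewrite lee_fin normr0.
move=> _ _ cvgI.
have -> : \int[mu]_x f x = lim (fine (\int[mu]_x ((EFin \o f) \_ (I n)) x)%E @[n --> \oo]).
  apply/esym/cvg_lim => //; rewrite /Rintegral.
  apply: fine_cvg; rewrite fineK//; exact: integrable_fin_num.
under eq_fun do rewrite -integral_mkcond FTC/=.
apply/cvg_lim => //; rewrite -[X in _ --> X](subr0 0).
by apply: cvgB; [rewrite (cvg_shiftS (fun n => F n%:R))|rewrite (cvg_shiftS (fun n => F (- (n%:R))))].
Unshelve. all: by end_near. Qed.

Let c := normal_peak (1 : R).

Lemma npdfE x : g x = c * expR (- x ^+ 2 / 2).
Proof.
by rewrite normal_pdfE ?oner_neq0// /normal_fun subr0 expr1n.
Qed.

Lemma is_derive_npdf (x : R) : is_derive x (1 : R) g (- x * g x).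
Proof.
have -> : g = (fun x => c * expR (- x ^+ 2 / 2)) by apply/funext => y; exact: npdfE.
apply: is_derive_eq; rewrite /GRing.scale/=.
by field.
Qed.

Lemma npdf_ge0 x : 0 <= g x. Proof. exact: normal_pdf_ge0. Qed.

Let C0 := 33 * c.
(** Half of the Gaussian exponent absorbs the polynomial: the second order term of the exponential
    at [x ^+ 2 / 4] is [x ^+ 4 / 32], which accounts for the constant 33 in [C0]. *)
Lemma npdf_poly4_le x : (1 + x ^+ 4) * g x <= C0 * expR (- x ^+ 2 / 4).
Proof.
rewrite npdfE /C0 mulrCA -mulrA (mulrCA 33) ler_wpM2l ?normal_peak_ge0//.
have -> : - x ^+ 2 / 2 = - x ^+ 2 / 4 + - x ^+ 2 / 4 by lra.
rewrite expRD mulrA ler_wpM2r ?expR_ge0//.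
rewrite mulNr expRN ler_pdivrMr ?expR_gt0//.
have h0 : 0 <= x ^+ 2 / 4 by rewrite divr_ge0// sqr_ge0.
have := expR_ge1Dxn 1 h0.
have -> : (x ^+ 2 / 4) ^+ 2 / (2`!)%:R = x ^+ 4 / 32 by rewrite !factE/=; field.
have : 0 <= x ^+ 4 by rewrite exprn_even_ge0.
by lra.
Qed.

Lemma measurable_npdf : measurable_fun setT g.
Proof. exact: measurable_normal_pdf. Qed.

Lemma integrable_expR4 : mu.-integrable setT (fun x => (C0 * expR (- x ^+ 2 / 4))%:E).
Proof.
pose s : R := Num.sqrt 2.
have s0 : s != 0 by rewrite gt_eqF// sqrtr_gt0.
have -> : (fun x : R => (C0 * expR (- x ^+ 2 / 4))%:E) =
    (fun x => (C0 / normal_peak s)%:E * (normal_pdf 0 s x)%:E)%E.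
  apply/funext => x; rewrite -EFinM normal_pdfE// mulrA divfK ?gt_eqF ?normal_peak_gt0//.
  by rewrite /normal_fun subr0 /s sqr_sqrtr// -mulrnA.
apply: integrableZl => //; exact: integrable_normal_pdf.
Qed.

Lemma integrable_poly4_npdf h C : measurable_fun setT h -> (forall x, `|h x| <= C * (1 + x ^+ 4)) ->
  mu.-integrable setT (fun x => (h x * g x)%:E).
Proof.
move=> mh hC.
apply: (@le_integrable _ _ _ mu _ measurableT _ (fun x => `|C|%:E * (C0 * expR (- x ^+ 2 / 4))%:E)%E).
- apply/measurable_EFinP; apply: measurable_funM => //; exact: measurable_npdf.
- move=> x _; rewrite -EFinM /= lee_fin normrM [`|g x|]ger0_norm ?npdf_ge0//.
  rewrite (le_trans _ (ler_norm _))//.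
  apply: (@le_trans _ _ (`|C| * ((1 + x ^+ 4) * g x))).
    rewrite mulrA ler_wpM2r ?npdf_ge0// (le_trans (hC x))// ler_wpM2r ?ler_norm//.
    by rewrite addr_ge0// exprn_even_ge0.
  by rewrite ler_wpM2l//; exact: npdf_poly4_le.
- apply: integrableZl => //; exact: integrable_expR4.
Qed.

(** The sign [s] treats both ends of the line at once. *)
Lemma cvg_poly4_npdf h C (s : R) : `|s| = 1 -> (forall x, `|h x| <= C * (1 + x ^+ 4)) ->
  h (s * n%:R) * g (s * n%:R) @[n --> \oo] --> (0 : R).
Proof.
move=> s1 hC.
have key n : `|h (s * n%:R) * g (s * n%:R)| <= (`|C| * C0 * 4) * n.+1%:R^-1.
  set x := s * n%:R.
  have x2 : x ^+ 2 = n%:R ^+ 2 by rewrite /x exprMn -[s ^+ 2]real_normK ?num_real// s1 expr1n mul1r.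
  rewrite normrM [`|g x|]ger0_norm ?npdf_ge0//.
  apply: (@le_trans _ _ (`|C| * ((1 + x ^+ 4) * g x))).
    rewrite mulrA ler_wpM2r ?npdf_ge0// (le_trans (hC x))// ler_wpM2r ?ler_norm//.
    by rewrite addr_ge0// exprn_even_ge0.
  rewrite -2!mulrA ler_wpM2l// (le_trans (npdf_poly4_le x))// ler_wpM2l//.
    by rewrite mulr_ge0// normal_peak_ge0.
  rewrite x2 mulNr expRN -[4 / _]invf_div lef_pV2 ?posrE ?expR_gt0 ?divr_gt0//=.
  have := expR_ge1Dx (n%:R ^+ 2 / 4 : R).
  have : 0 <= (n%:R - 1) ^+ 2 :> R by rewrite sqr_ge0.
  have := ler0n R n; rewrite -[n.+1%:R]natr1; nra.
apply/norm_cvg0P.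
apply: (@squeeze_cvgr _ _ _ _ (cst 0) (fun n => (`|C| * C0 * 4) * n.+1%:R^-1)).
- by apply: nearW => n; rewrite normr_ge0 key.
- exact: cvg_cst.
- rewrite -[X in _ --> X](mulr0 (`|C| * C0 * 4)).
  by apply: cvgMr => //; exact: cvg_harmonic.
Qed.

(** Stein's identity [E h'(x) = E x h(x)]: the derivative of [h g] is [(h' - x h) g], and [h g]
    vanishes at both ends. The difference stays under one integral, so that integrability is needed
    for it alone. *)
Lemma npdf_byparts h h' C : continuous h' -> (forall x : R, is_derive x (1 : R) h (h' x)) ->
  (forall x, `|h x| <= C * (1 + x ^+ 4)) -> (forall x, `|h' x - x * h x| <= C * (1 + x ^+ 4)) ->
  \int[mu]_x ((h' x - x * h x) * g x) = 0.
Proof.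
move=> ch' dh hC h'C.
have ch : continuous h by move=> x; apply: differentiable_continuous; apply/derivable1_diffP; have [] := dh x.
have cH : continuous (fun x => h' x - x * h x).
  by move=> x; apply: cvgB; [exact: ch'|apply: cvgM; [exact: cvg_id|exact: ch]].
apply: (@integral_line_derive0 _ (fun x => h x * g x)).
- move=> x; apply: cvgM; first exact: cH.
  by apply: continuous_normal_pdf; exact: oner_neq0.
- apply: integrable_poly4_npdf h'C.
  exact: continuous_measurable_fun.
- move=> x; have := dh x; have := is_derive_npdf x => dg dhx.
  apply: is_derive_eq; rewrite /GRing.scale/=; ring.
- under eq_fun do rewrite -[_%:R]mul1r.
  by apply: cvg_poly4_npdf hC; rewrite normr1.
- under eq_fun do rewrite -mulN1r.
  by apply: cvg_poly4_npdf hC; rewrite normrN normr1.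
Qed.

Lemma Rintegral_npdf : \int[mu]_x g x = 1.
Proof. by rewrite /Rintegral integral_normal_pdf. Qed.

Lemma integrable_bnd_npdf h C : measurable_fun setT h -> (forall x, `|h x| <= C) ->
  mu.-integrable setT (fun x => (h x * g x)%:E).
Proof.
move=> mh hC; apply: (@integrable_poly4_npdf _ C) => // x.
have Cge0 : 0 <= C by exact: le_trans (hC 0).
by rewrite (le_trans (hC x))// ler_peMr// lerDl exprn_even_ge0.
Qed.

Lemma npdf_moment2 : \int[mu]_x (x ^+ 2 * g x) = 1.
Proof.
have h4 (x : R) : 0 <= x ^+ 4 by rewrite exprn_even_ge0.
have b (x : R) : `|x| <= 2 * (1 + x ^+ 4) /\ `|1 - x * x| <= 2 * (1 + x ^+ 4) /\ `|x ^+ 2| <= 2 * (1 + x ^+ 4).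
  by have := h4 x; have := sqr_ge0 (x - 1); have := sqr_ge0 (x + 1); have := sqr_ge0 (x ^+ 2 - 1); rewrite !ler_norml; nra.
have dx (x : R) : is_derive x (1 : R) (fun x : R => x) 1 by exact: is_derive_id.
have := @npdf_byparts (fun x => x) (fun=> 1) 2 _ dx (fun x => (b x).1) (fun x => (b x).2.1).
move=> /(_ (fun x => cvg_cst _)).
under eq_Rintegral do rewrite mulrBl mul1r -expr2.
rewrite RintegralB//; last 2 first.
- exact: integrable_normal_pdf.
- by apply: (@integrable_poly4_npdf _ 2) => [|x]; [exact: measurable_funX|have [_ []] := b x].
by rewrite Rintegral_npdf => /eqP; rewrite subr_eq0 => /eqP.
Qed.

(** Characteristic function of the standard normal law, with a real phase [a] in place of complex
    values. *)
Definition ncf (a t : R) := \int[mu]_x (cos (t * x + a) * g x).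

Lemma measurable_cosZ t a : measurable_fun setT (fun x : R => cos (t * x + a)).
Proof.
apply: (measurableT_comp (f := cos) (g := fun x => t * x + a)).
  by apply: continuous_measurable_fun; exact: continuous_cos.
by apply: measurable_funD => //; exact: mulrl_measurable.
Qed.

Lemma measurable_sinZ t a : measurable_fun setT (fun x : R => sin (t * x + a)).
Proof.
apply: (measurableT_comp (f := sin) (g := fun x => t * x + a)).
  by apply: continuous_measurable_fun; exact: continuous_sin.
by apply: measurable_funD => //; exact: mulrl_measurable.
Qed.

Lemma cos_abs_le1 (x : R) : `|cos x| <= 1.
Proof. by rewrite ler_norml cos_geN1 cos_le1. Qed.

Lemma sin_abs_le1 (x : R) : `|sin x| <= 1.
Proof. by rewrite ler_norml sin_geN1 sin_le1. Qed.

(** Differentiation under the integral, dominated by [|x| g], gives [- E x sin (t x + a)], and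
    Stein's identity for [sin (t x + a)] turns this into [- t E cos (t x + a)]. The differential
    equation is solved in [ncfE]. *)
Lemma ncf_derive a t : is_derive t (1 : R) (ncf a) (- t * ncf a t).
Proof.
have b4 (x : R) : `|x| <= 2 * (1 + x ^+ 4).
  by have := sqr_ge0 (x - 1); have := sqr_ge0 (x + 1); have := sqr_ge0 (x ^+ 2 - 1); rewrite ler_norml; nra.
pose f (t x : R) := cos (t * x + a) * g x.
have df s x : is_derive s (1 : R) (f ^~ x) (- (x * sin (s * x + a)) * g x).
  by apply: is_derive_eq; rewrite /GRing.scale/=; ring.
have d1 s x : partial1of2 f s x = - (x * sin (s * x + a)) * g x.
  by rewrite partial1of2E; exact: derive_val.
have intf s : (t - 1 < s < t + 1) -> mu.-integrable setT (EFin \o f s).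
  by move=> _; apply: (@integrable_bnd_npdf _ 1); [exact: measurable_cosZ|move=> x; exact: cos_abs_le1].
have intG : mu.-integrable setT (EFin \o (fun x => `|x| * g x)).
  by apply: (@integrable_poly4_npdf _ 2) => [|x]; [exact: normr_measurable|rewrite normr_id].
have Gub s x : (t - 1 < s < t + 1) -> setT x -> `|partial1of2 f s x| <= `|x| * g x.
  move=> _ _; rewrite d1 normrM normrN normrM [`|g x|]ger0_norm ?npdf_ge0//.
  by rewrite ler_wpM2r ?npdf_ge0// ler_piMr// sin_abs_le1.
have tI : (`]t - 1, t + 1[%classic : set R) t by rewrite /= in_itv/= ltrBlDr ltrDl ltr01.
have df1 s x : derivable (f ^~ x) s 1 by have [] := df s x.
have G0 x : 0 <= `|x| * g x by rewrite mulr_ge0// npdf_ge0.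
have D1 := @derivable_under_integral R _ _ mu f setT measurableT t (t - 1) (t + 1) tI
   intf (fun s x _ _ => df1 s x) _ G0 intG Gub.
have D2 := @differentiation_under_integral R _ _ mu f setT measurableT t (t - 1) (t + 1) tI
   intf (fun s x _ _ => df1 s x) _ G0 intG Gub.
apply: DeriveDef; first exact: D1.
rewrite -derive1E D2//.
under eq_Rintegral do rewrite d1.
have dh (x : R) : is_derive x (1 : R) (fun x => sin (t * x + a)) (t * cos (t * x + a)).
  by apply: is_derive_eq; rewrite /GRing.scale/=; ring.
have p4 (x : R) : 0 <= x ^+ 4 by rewrite exprn_even_ge0.
have := @npdf_byparts (fun x => sin (t * x + a)) (fun x => t * cos (t * x + a)) (`|t| + 2) _ dh.
have -> // : \int[mu]_x ((t * cos (t * x + a) - x * sin (t * x + a)) * g x) =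
   t * ncf a t + \int[mu]_x (- (x * sin (t * x + a)) * g x).
- rewrite -RintegralZl//; last by apply: (@integrable_bnd_npdf _ 1); [exact: measurable_cosZ|move=> x; exact: cos_abs_le1].
  rewrite -RintegralD//.
  + by apply: eq_Rintegral => x _; ring.
  + rewrite (_ : _ \o _ = (fun x => (t * cos (t * x + a) * g x)%:E)); last by apply/funext => x; rewrite /= mulrA.
    apply: (@integrable_bnd_npdf _ `|t|); last by move=> x; rewrite normrM ler_piMr// cos_abs_le1.
    by apply: measurable_funM => //; exact: measurable_cosZ.
  + apply: (@integrable_poly4_npdf _ 2).
      by apply: measurableT_comp => //; apply: measurable_funM => //; exact: measurable_sinZ.
    by move=> x; rewrite normrN normrM (le_trans _ (b4 x))// ler_piMr// sin_abs_le1.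
- move=> H; have {}H : t * ncf a t + \int[mu]_x (- (x * sin (t * x + a)) * g x) = 0.
    apply: H.
    + move=> x; apply: cvgM; [exact: cvg_cst|apply: (continuous_comp (f := fun x => t * x + a) (g := cos)); [apply: cvgD; [exact: mulrl_continuous|exact: cvg_cst]|exact: continuous_cos]].
    + move=> x; rewrite (le_trans (sin_abs_le1 _))//; have := p4 x; have := normr_ge0 t; nra.
    + move=> x; rewrite (le_trans (ler_normB _ _))// !normrM mulrDl lerD//.
        by rewrite ler_wpM2l// (le_trans (cos_abs_le1 _))// lerDl.
      by rewrite (le_trans _ (b4 x))// ler_piMr// sin_abs_le1.
  by apply/eqP; rewrite -subr_eq0 mulNr opprK addrC H.
Qed.

Lemma ncfE a t : ncf a t = cos a * expR (- t ^+ 2 / 2).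
Proof.
have d0 (x : R) : is_derive x (1 : R) (fun x => ncf a x * expR (x ^+ 2 / 2)) 0.
  have := ncf_derive a x => dn.
  by apply: is_derive_eq; rewrite /GRing.scale/=; field.
have := is_derive_0_is_cst t 0 d0.
rewrite expr0n/= mul0r expR0 mulr1.
have -> : ncf a 0 = cos a.
  rewrite -[RHS]mulr1 -Rintegral_npdf -RintegralZl//; last exact: integrable_normal_pdf.
  by apply: eq_Rintegral => x _; rewrite mul0r add0r.
move=> h; rewrite mulNr expRN; apply: (mulIf (x := expR (t ^+ 2 / 2))); rewrite ?gt_eqF ?expR_gt0//.
by rewrite h divfK// gt_eqF ?expR_gt0.
Qed.

Lemma npdf_moment4_lt : (\int[mu]_x (x ^+ 4 * g x)%:E < +oo)%E.
Proof.
have : mu.-integrable setT (fun x => (x ^+ 4 * g x)%:E).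
  apply: (@integrable_poly4_npdf _ 1) => [|x]; first exact: measurable_funX.
  by rewrite mul1r ger0_norm ?lerDr// exprn_even_ge0.
move=> /integrableP[_]; under eq_integral.
  move=> x _; rewrite gee0_abs; last by rewrite lee_fin mulr_ge0 ?npdf_ge0// exprn_even_ge0.
  over.
by [].
Qed.

Lemma ge0_integral_normal_prob (f : R -> \bar R) : measurable_fun setT f -> (forall x, 0 <= f x)%E ->
  (\int[normal_prob 0 1]_x f x = \int[mu]_x (f x * (g x)%:E))%E.
Proof.
move=> mf f0; apply: (ge0_integral_density (phi := idfun)) => //.
- exact: measurable_id.
- by move=> x; rewrite npdf_ge0.
- exact: measurable_npdf.
Qed.

Lemma normal_prob_unit_shift (m : R) (A : set (measurableTypeR R)) : measurable A ->
  normal_prob m 1 A = normal_prob 0 1 ((fun x => x + m) @^-1` A).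
Proof.
move=> mA.
pose phi (x : measurableTypeR R) : measurableTypeR R := x + m.
have mD : measurable_fun setT phi by exact: measurable_funD.
have muD (B : set (measurableTypeR R)) : measurable B -> mu B = mu (phi @^-1` B).
  move=> mB; rewrite -[RHS]/(pushforward mu phi B).
  apply: lebesgue_measure_unique => //= _ [[a b]] _ <-.
  rewrite /pushforward (_ : _ @^-1` _ = `]a - m, b - m]%classic); last first.
    by apply/seteqP; split => x /=; rewrite !in_itv/= ltrBlDr lerBrDr.
  by rewrite !lebesgue_measure_itv/= !lte_fin ltrD2r; case: ifP => // _; rewrite -!EFinB; congr EFin; ring.
rewrite /normal_prob; have -> := ge0_integral_image mD muD mA.
- by apply: eq_integral => x _; rewrite /phi normal_pdfE ?oner_neq0// npdfE /normal_fun addrK expr1n.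
- by apply: measurable_funTS; apply/measurable_EFinP; exact: measurable_normal_pdf.
- by move=> x _; rewrite lee_fin normal_pdf_ge0.
Qed.

Lemma integral_normal_prob_sqr : (\int[normal_prob (0 : R) 1]_x (x ^+ 2)%:E = 1)%E.
Proof.
rewrite ge0_integral_normal_prob//=.
- have i2 : mu.-integrable setT (fun x => (x ^+ 2 * g x)%:E).
    apply: (@integrable_poly4_npdf _ 1) => [|x]; first exact: measurable_funX.
    rewrite mul1r ger0_norm ?sqr_ge0//; have := sqr_ge0 (x ^+ 2 - 1); nra.
  by rewrite -[in RHS]npdf_moment2 /Rintegral fineK//; exact: integrable_fin_num.
- by apply/measurable_EFinP; exact: measurable_funX.
- by move=> x; rewrite lee_fin sqr_ge0.
Qed.

Lemma integral_normal_prob_pow4 : (\int[normal_prob (0 : R) 1]_x (x ^+ 4)%:E < +oo)%E.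
Proof.
rewrite ge0_integral_normal_prob//=; first exact: npdf_moment4_lt.
- by apply/measurable_EFinP; exact: measurable_funX.
- by move=> x; rewrite lee_fin exprn_even_ge0.
Qed.

(** The density formula is established for nonnegative functions, so it is applied to [1 + h] and
    the constant is cancelled. *)
Lemma Rintegral_normal_prob_bnd h : measurable_fun setT h -> (forall x, `|h x| <= 1) ->
  \int[normal_prob 0 1]_x h x = \int[mu]_x (h x * g x).
Proof.
move=> mh h1.
have h0 x : 0 <= 1 + h x by have := h1 x; rewrite ler_norml => /andP[]; lra.
have intN := bounded_integrable (normal_prob 0 1) mh h1.
have intM : mu.-integrable setT (fun x => (h x * g x)%:E).
  by apply: (@integrable_bnd_npdf _ 1).
have i1 : (normal_prob 0 1).-integrable setT (EFin \o cst (1 : R)) by apply: (@bounded_integrable _ _ _ _ _ 1) => // x; rewrite normr1.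
have := @ge0_integral_normal_prob (fun x => (1 + h x)%:E).
move=> /(_ _ (fun x => h0 x)) H.
have {}H : \int[normal_prob 0 1]_x (1 + h x) = \int[mu]_x ((1 + h x) * g x).
  by rewrite /Rintegral H//; apply/measurable_EFinP; exact: measurable_funD.
move: H; rewrite RintegralD//.
under [RHS]eq_Rintegral do rewrite mulrDl mul1r.
rewrite RintegralD//; last exact: integrable_normal_pdf.
rewrite Rintegral_npdf Rintegral_cst// mul1r.
have -> : fine (normal_prob 0 1 [set: R]) = 1 :> R by rewrite [X in fine X]probability_setT.
by move=> /addrI.
Qed.

Lemma normal_prob_cos (a t : R) : \int[normal_prob 0 1]_x cos (t * x + a) = cos a * expR (- t ^+ 2 / 2).
Proof.
rewrite Rintegral_normal_prob_bnd; first exact: ncfE.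
  exact: measurable_cosZ.
by move=> x; exact: cos_abs_le1.
Qed.
End normal_line.

(** * Random matrices and uniqueness of their laws *)

Section matrix_measurable.
Variables (R : realType) (a b : nat).
Implicit Types (s t M : 'M[R]_(a, b)).

(** Open orthants are stable under intersection, and the indicator of an orthant is a product of
    indicators of rays in single entries. Both facts serve in [cf_measure_unique]. *)
Definition mx_rays : set (set 'M[R]_(a, b)) :=
  [set A | exists c : 'M[R]_(a, b), A = [set M : 'M[R]_(a, b) | forall i j, c i j < M i j]].

Definition mxT := g_sigma_algebraType mx_rays.

Lemma measurable_entry i j : measurable_fun setT (fun M : mxT => M i j).
Proof.
apply: (measurability (@RGenOInfty.G R)); first exact: RGenOInfty.measurableE.
move=> _ [_ [c ->] <-]; rewrite setTI.
(* A ray in one entry is the increasing union of orthants whose other thresholds go to minus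
   infinity. *)
rewrite (_ : _ @^-1` _ = \bigcup_n [set M : mxT | forall k l,
    (if (k == i) && (l == j) then c else - n%:R) < M k l]).
  apply: bigcup_measurable => n _; apply: sub_sigma_algebra.
  exists (\matrix_(k, l) (if (k == i) && (l == j) then c else - n%:R)).
  by apply/seteqP; split => M /= h k l; have := h k l; rewrite mxE.
apply/seteqP; split => [M /=|M [n _] /= /(_ i j)]; rewrite in_itv/= andbT.
  move=> cM; pose B := \sum_k \sum_l `|M k l|.
  exists (Num.trunc B).+1 => // k l; case: ifPn => [/andP[/eqP-> /eqP->]//|_].
  rewrite ltrNl; apply: (@le_lt_trans _ _ B); last exact: truncnS_gt.
  rewrite (le_trans (ler_norm _))// normrN.
  rewrite /B (bigD1 k)//= (bigD1 l)//= -addrA lerDl addr_ge0// sumr_ge0// => ? _.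
  by rewrite sumr_ge0.
by rewrite !eqxx.
Qed.

Definition mfmx d (T : measurableType d) (f : T -> 'M[R]_(a, b)) :=
  forall i j, measurable_fun setT (fun w => f w i j).

Lemma measurable_mx d (T : measurableType d) (f : T -> 'M[R]_(a, b)) :
  mfmx f -> measurable_fun setT (f : T -> mxT).
Proof.
move=> mf; apply: (@measurability _ _ T mxT setT f mx_rays) => //.
move=> _ [_ [c ->] <-]; rewrite setTI.
rewrite (_ : _ @^-1` _ = \bigcap_(ij in [set: 'I_a * 'I_b]) [set w | c ij.1 ij.2 < f w ij.1 ij.2]).
  apply: fin_bigcap_measurable => [|[i j] _ /=]; first exact: finite_finset.
  rewrite (_ : [set w | _] = (fun w => f w i j) @^-1` `]c i j, +oo[); last first.
    by apply/seteqP; split => w /=; rewrite in_itv/= andbT.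
  by rewrite -[X in measurable X]setTI; apply: mf => //; exact: measurable_itv.
apply/seteqP; split => w /=; first by move=> h [i j] _ /=; exact: h.
by move=> h i j; exact: (h (i, j)).
Qed.

(** Frobenius inner product; on column vectors it is the usual scalar product. *)
Definition inner t M : R := \sum_i \sum_j t i j * M i j.

Lemma innerDl s t M : inner (s + t) M = inner s M + inner t M.
Proof.
rewrite /inner -big_split; apply: eq_bigr => i _; rewrite -big_split; apply: eq_bigr => j _.
by rewrite mxE mulrDl.
Qed.

Lemma innerNl t M : inner (- t) M = - inner t M.
Proof.
rewrite /inner -sumrN; apply: eq_bigr => i _; rewrite -sumrN; apply: eq_bigr => j _.
by rewrite mxE mulNr.
Qed.

Lemma innerZl c t M : inner (c *: t) M = c * inner t M.
Proof.
rewrite /inner mulr_sumr; apply: eq_bigr => i _; rewrite mulr_sumr; apply: eq_bigr => j _.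
by rewrite mxE mulrA.
Qed.

Lemma inner0l M : inner 0 M = 0.
Proof. by rewrite -[X in inner X _](scale0r (0 : 'M[R]_(a, b))) innerZl mul0r. Qed.

Lemma innerC t M : inner t M = inner M t.
Proof. by apply: eq_bigr => i _; apply: eq_bigr => j _; rewrite mulrC. Qed.

Lemma innerDr t M N : inner t (M + N) = inner t M + inner t N.
Proof. by rewrite innerC innerDl !(innerC t). Qed.

Lemma innerNr t M : inner t (- M) = - inner t M.
Proof. by rewrite innerC innerNl innerC. Qed.

Lemma innerZr c t M : inner t (c *: M) = c * inner t M.
Proof. by rewrite innerC innerZl innerC. Qed.

Lemma inner_delta i j M : inner (delta_mx i j) M = M i j.
Proof.
rewrite /inner (bigD1 i)//= (bigD1 j)//= big1 ?addr0 => [|l lj]; last first.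
  by rewrite mxE eqxx (negbTE lj) mul0r.
rewrite big1 ?addr0 => [|k ki]; last by rewrite big1// => l _; rewrite mxE (negbTE ki) mul0r.
by rewrite mxE !eqxx mul1r.
Qed.

Lemma measurable_inner d (T : measurableType d) t (f : T -> 'M[R]_(a, b)) :
  mfmx f -> measurable_fun setT (fun w => inner t (f w)).
Proof.
move=> mf; apply: measurable_sum => i; apply: measurable_sum => j.
exact: measurable_funM.
Qed.

End matrix_measurable.

Section bounded_limits.
Variable R : realType.
Implicit Types x : R.

(* Up to the point [1/2], [(1 - x^n)^(2^n)] converges to the indicator of [x < 1/2] on [0, 1] *)
Definition step_poly (n : nat) (x : R) := (1 - x ^+ n.+1) ^+ (2 ^ n.+1).

Lemma step_poly_bnd n x : 0 <= x <= 1 -> 0 <= step_poly n x <= 1.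
Proof.
move=> /andP[x0 x1]; have xn : 0 <= x ^+ n.+1 <= 1 by rewrite exprn_ge0// exprn_ile1.
case/andP: xn => xn0 xn1.
by rewrite exprn_ge0 ?subr_ge0// exprn_ile1 ?subr_ge0// gerBl.
Qed.

Lemma bernoulli_ge (x : R) n : -1 <= x -> 1 + n%:R * x <= (1 + x) ^+ n.
Proof.
move=> x1; elim: n => [|n IH]; first by rewrite mul0r addr0 expr0.
rewrite exprSr; apply: (@le_trans _ _ ((1 + n%:R * x) * (1 + x))).
  rewrite -natr1; have : 0 <= n%:R * (x ^+ 2) by rewrite mulr_ge0// sqr_ge0.
  by nra.
by rewrite ler_wpM2r// -lerBlDl sub0r.
Qed.

(** Bernoulli's inequality bounds [step_poly n x] below by [1 - (2 x)^(n+1)]. *)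
Lemma step_poly_cvg1 x : 0 <= x -> x < 2^-1 -> step_poly n x @[n --> \oo] --> (1 : R).
Proof.
move=> x0 x1; have x2 : `|2 * x| < 1 by rewrite ger0_norm ?mulr_ge0//; lra.
apply: (@squeeze_cvgr _ _ _ _ (fun n => 1 - (2 * x) ^+ n.+1) (cst 1)).
- apply: nearW => n; apply/andP; split; last first.
    by have /andP[] : 0 <= step_poly n x <= 1 by apply: step_poly_bnd; lra.
  have := @bernoulli_ge (- x ^+ n.+1) (2 ^ n.+1) _.
  rewrite lerN2 exprn_ile1//; last by lra.
  move=> /(_ isT); rewrite /step_poly => /(le_trans _); apply.
  by rewrite natrX exprMn mulrN.
- rewrite -[X in _ --> X]subr0; apply: cvgB; first exact: cvg_cst.
  rewrite (cvg_shiftS (fun n => (2 * x) ^+ n)); exact: cvg_expr.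
- exact: cvg_cst.
Qed.

(** Since [(1 - t) (1 + t) <= 1] on [0, 1], [step_poly n x] is at most the inverse of
    [(1 + x^(n+1))^(2^(n+1))], which by Bernoulli's inequality is at most [(2 x)^-(n+1)]. *)
Lemma step_poly_cvg0 x : 2^-1 < x -> x <= 1 -> step_poly n x @[n --> \oo] --> (0 : R).
Proof.
move=> x0 x1; have x2 : `|(2 * x)^-1| < 1 by rewrite ger0_norm ?invr_ge0 ?invf_lt1; lra.
have x00 : 0 <= x by lra.
apply: (@squeeze_cvgr _ _ _ _ (cst 0) (fun n => ((2 * x)^-1) ^+ n.+1)).
- apply: nearW => n; have /andP[s0 s1] := @step_poly_bnd n x (introT andP (conj x00 x1)).
  rewrite /= s0/=.
  have xn : 0 <= x ^+ n.+1 <= 1 by rewrite exprn_ge0// exprn_ile1.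
  have b := @bernoulli_ge (x ^+ n.+1) (2 ^ n.+1) _.
  have h1 : step_poly n x * (1 + x ^+ n.+1) ^+ (2 ^ n.+1) <= 1.
    rewrite /step_poly -exprMn -subr_sqr expr1n exprn_ile1 ?subr_ge0 ?gerBl ?sqr_ge0//.
    by case/andP: xn => ? ?; rewrite exprn_ile1.
  have h2 : (2 * x) ^+ n.+1 <= (1 + x ^+ n.+1) ^+ (2 ^ n.+1).
    apply: le_trans (b _); last by case/andP: xn; lra.
    by rewrite exprMn natrX lerDr.
  have p : 0 < (2 * x) ^+ n.+1 by rewrite exprn_gt0; lra.
  rewrite exprVn -[leRHS]mul1r ler_pdivlMr//; apply: le_trans h1.
  by rewrite ler_wpM2l.
- exact: cvg_cst.
- rewrite (cvg_shiftS (fun n => (2 * x)^-1 ^+ n)); exact: cvg_expr.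
Qed.

Context d (Y : measurableType d) (m1 m2 : probability Y R).
Implicit Types (f g h : Y -> R) (K : R).

Definition bfun f := measurable_fun setT f /\ exists K, forall y, `|f y| <= K.

Lemma bfun_int (m : probability Y R) f : bfun f -> m.-integrable setT (EFin \o f).
Proof. by move=> [mf [K fK]]; exact: bounded_integrable fK. Qed.

Lemma bfunM f g : bfun f -> bfun g -> bfun (f \* g).
Proof.
move=> [mf [K fK]] [mg [L gL]]; split; first exact: measurable_funM.
by exists (K * L) => y; rewrite normrM ler_pM.
Qed.

Lemma bfunD f g : bfun f -> bfun g -> bfun (f \+ g).
Proof.
move=> [mf [K fK]] [mg [L gL]]; split; first exact: measurable_funD.
by exists (K + L) => y; rewrite (le_trans (ler_normD _ _))// lerD.
Qed.

Lemma bfun_cst (c : R) : bfun (fun=> c).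
Proof. by split => //; exists `|c|. Qed.

Definition eint f := \int[m1]_y f y = \int[m2]_y f y.

Lemma eintD f g : bfun f -> bfun g -> eint f -> eint g -> eint (f \+ g).
Proof.
move=> bf bg ef eg; rewrite /eint !RintegralD//; [|exact: bfun_int..].
by congr (_ + _).
Qed.

Lemma eintZ c f : bfun f -> eint f -> eint (fun y => c * f y).
Proof. by move=> bf ef; rewrite /eint !RintegralZl//; [congr (_ * _)|exact: bfun_int..]. Qed.

Lemma Rintegral_bounded_cvg (m : probability Y R) (fn : nat -> Y -> R) f K :
  (forall n, measurable_fun setT (fn n)) -> (forall n y, `|fn n y| <= K) ->
  (forall y, fn n y @[n --> \oo] --> f y) ->
  measurable_fun setT f /\ (\int[m]_y fn n y) @[n --> \oo] --> \int[m]_y f y.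
Proof.
move=> mfn fnK fnf.
have mf : measurable_fun setT f by apply: (measurable_fun_cvg (h := fn)) => // y _; exact: fnf.
split => //.
have [] := @dominated_convergence _ _ _ m setT measurableT
  (fun n => EFin \o fn n) (EFin \o f) (EFin \o cst K).
- by move=> n; apply/measurable_EFinP.
- by apply/measurable_EFinP.
- by apply: aeW => y _; apply: cvg_EFin; [exact: nearW|exact: fnf].
- by apply: (@bounded_integrable _ _ _ _ _ `|K|).
- by apply: aeW => y n _; rewrite lee_fin fnK.
move=> intf _ cvgI; apply: fine_cvg; rewrite fineK//; exact: integrable_fin_num.
Qed.

Lemma eint_lim (fn : nat -> Y -> R) f K :
  (forall n, bfun (fn n)) -> (forall n, eint (fn n)) -> (forall n y, `|fn n y| <= K) ->
  (forall y, fn n y @[n --> \oo] --> f y) -> eint f.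
Proof.
move=> bfn efn fnK fnf.
have mfn n : measurable_fun setT (fn n) by have [] := bfn n.
have [_ c1] := Rintegral_bounded_cvg m1 mfn fnK fnf.
have [_ c2] := Rintegral_bounded_cvg m2 mfn fnK fnf.
have e12 : (fun n => \int[m1]_y fn n y) = (fun n => \int[m2]_y fn n y) by apply/funext => n; exact: efn.
by rewrite e12 in c1; exact: (cvg_unique _ c1 c2).
Qed.

(* a class of test functions closed under bounded pointwise limits and products
   by [h] whenever the multiplier condition holds *)
Variable F0 : set (Y -> R).
Hypothesis F0b : forall f, F0 f -> bfun f.
Hypothesis F0D : forall f g, F0 f -> F0 g -> F0 (f \+ g).
Hypothesis F0Z : forall c f, F0 f -> F0 (fun y => c * f y).
Hypothesis F0lim : forall (fn : nat -> Y -> R) f K,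
  (forall n, F0 (fn n)) -> (forall n y, `|fn n y| <= K) ->
  (forall y, fn n y @[n --> \oo] --> f y) -> F0 f.

(** Multipliers form an algebra closed under bounded pointwise limits. A functional monotone class
    argument can therefore climb from cosines to indicators without any inversion formula. *)
Definition mult h := bfun h /\ forall f, F0 f -> F0 (f \* h).

Lemma mult_cst c : mult (fun=> c).
Proof.
split; first exact: bfun_cst.
move=> f Ff; rewrite (_ : _ \* _ = (fun y => c * f y)); first exact: F0Z.
by apply/funext => y /=; rewrite mulrC.
Qed.

Lemma multM g h : mult g -> mult h -> mult (g \* h).
Proof.
move=> [bg Fg] [bh Fh]; split; first exact: bfunM.
move=> f Ff; rewrite (_ : _ \* _ = (f \* g) \* h); first exact/Fh/Fg.
by apply/funext => y /=; rewrite mulrA.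
Qed.

Lemma multD g h : mult g -> mult h -> mult (g \+ h).
Proof.
move=> [bg Fg] [bh Fh]; split; first exact: bfunD.
move=> f Ff; rewrite (_ : _ \* _ = (f \* g) \+ (f \* h)).
  by apply: F0D; [exact: Fg|exact: Fh].
by apply/funext => y /=; rewrite mulrDr.
Qed.

Lemma multX g n : mult g -> mult (fun y => g y ^+ n).
Proof.
move=> mg; elim: n => [|n IH].
  by under eq_fun do rewrite expr0; exact: mult_cst.
by under eq_fun do rewrite exprS; exact: multM.
Qed.

Lemma multB g h : mult g -> mult h -> mult (fun y => g y - h y).
Proof.
move=> mg mh; rewrite (_ : (fun y => _) = g \+ ((fun=> -1) \* h)).
  by apply: multD => //; apply: multM => //; exact: mult_cst.
by apply/funext => y /=; rewrite mulN1r.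
Qed.

Lemma mult_lim (hn : nat -> Y -> R) h K :
  (forall n, mult (hn n)) -> (forall n y, `|hn n y| <= K) ->
  (forall y, hn n y @[n --> \oo] --> h y) -> mult h.
Proof.
move=> mhn hnK hnh; split.
  split; first by have [] := Rintegral_bounded_cvg m1 (fun n => (mhn n).1.1) hnK hnh.
  exists K => y; rewrite -(cvg_lim _ (cvg_norm (hnh y)))//.
  apply: limr_le; first by apply/cvg_ex; eexists; exact: cvg_norm (hnh y).
  by apply: nearW => n.
move=> f Ff; have [_ [L fL]] := F0b Ff.
apply: (@F0lim (fun n => f \* hn n) _ (L * K)).
- by move=> n; apply: (mhn n).2.
- by move=> n y; rewrite normrM ler_pM.
- by move=> y; apply: cvgM; [exact: cvg_cst|exact: hnh].
Qed.

(** The polynomials [1 - (1 - g^2)^n] converge to the indicator. *)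
Lemma mult_neq0 g : mult g -> (forall y, `|g y| <= 1) -> mult (fun y => (g y != 0)%:R).
Proof.
move=> mg g1.
apply: (@mult_lim (fun n y => 1 - (1 - g y ^+ 2) ^+ n.+1) _ 1).
- move=> n; apply: multB; first exact: mult_cst.
  by apply: multX; apply: multB; [exact: mult_cst|exact: multX].
- move=> n y; have h : 0 <= 1 - g y ^+ 2 <= 1.
    by rewrite gerBl sqr_ge0 subr_ge0 -real_normK ?num_real// exprn_ile1.
  case/andP: h => h0 h1; rewrite ger0_norm ?subr_ge0 ?exprn_ile1//.
  by rewrite gerBl exprn_ge0.
- move=> y; have [->|gy0] := eqVneq (g y) 0.
    rewrite expr0n/= subr0; under eq_fun do rewrite expr1n subrr; exact: cvg_cst.
  rewrite -[X in _ --> X]subr0; apply: cvgB; first exact: cvg_cst.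
  rewrite (cvg_shiftS (fun n => (1 - g y ^+ 2) ^+ n)); apply: cvg_expr.
  have : 0 < g y ^+ 2 by rewrite exprn_even_gt0.
  have : g y ^+ 2 <= 1 by rewrite -real_normK ?num_real// exprn_ile1.
  by move=> ? ?; rewrite ger0_norm; lra.
Qed.

(** [step_poly] at [(1 - g) / 2] converges to the indicator of [0 < g] except where [g = 0], the
    point 1/2 at which its limit is not controlled; the factor from [mult_neq0] removes these
    points. *)
Lemma mult_gt0 g : mult g -> (forall y, `|g y| <= 1) -> mult (fun y => (0 < g y)%R%:R).
Proof.
move=> mg g1.
have b y : 0 <= (1 - g y) / 2 <= 1 by have := g1 y; rewrite ler_norml => /andP[]; lra.
apply: (@mult_lim (fun n y => step_poly n ((1 - g y) / 2) * (g y != 0)%:R) _ 1).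
- move=> n; apply: multM; last exact: mult_neq0.
  rewrite /step_poly; apply: multX; apply: multB; first exact: mult_cst.
  apply: multX; apply: multM; last exact: mult_cst.
  by apply: multB => //; exact: mult_cst.
- move=> n y; have /andP[s0 s1] := step_poly_bnd n (b y).
  by rewrite normrM ger0_norm// mulr_ile1//; case: eqP; rewrite ?normr0 ?normr1.
- move=> y; have [gy|gy|->] := ltgtP (g y) 0.
  + rewrite -[X in _ --> X]/(0%:R) -[X in _ --> X](mul0r (1 : R)); apply: cvgM.
      by apply: step_poly_cvg0; have /andP[] := b y; lra.
    exact: cvg_cst.
  + rewrite -[X in _ --> X]/(1%:R) -[X in _ --> X](mul1r (1 : R)); apply: cvgM.
      by apply: step_poly_cvg1; have /andP[] := b y; lra.
    exact: cvg_cst.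
  + rewrite /=; under eq_fun do rewrite mulr0; exact: cvg_cst.
Qed.

Lemma mult_prod (I : eqType) (s : seq I) (h : I -> Y -> R) :
  (forall i, mult (h i)) -> mult (fun y => \prod_(i <- s) h i y).
Proof.
move=> mh; elim: s => [|i s IH].
  by under eq_fun do rewrite big_nil; exact: mult_cst.
by under eq_fun do rewrite big_cons; exact: multM.
Qed.

End bounded_limits.

Section cf_unique.
Variables (R : realType) (a b : nat).
Notation Y := (mxT R a b).
Variables m1 m2 : probability Y R.
Hypothesis cfE : forall (t : 'M[R]_(a, b)) c,
  \int[m1]_M cos (inner t M + c) = \int[m2]_M cos (inner t M + c).

Lemma mfmx_id : mfmx (fun M : Y => M).
Proof. by move=> i j; exact: measurable_entry. Qed.

Let cs (t : 'M[R]_(a, b)) c (M : Y) := cos (inner t M + c).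

Let bcs t c : bfun (cs t c).
Proof.
split; last by exists 1 => y; exact: cos_abs_le1.
apply: (measurableT_comp (f := cos)).
  by apply: continuous_measurable_fun; exact: continuous_cos.
by apply: measurable_funD => //; exact: measurable_inner mfmx_id.
Qed.

(** Testing against all cosines, and not only against 1, makes the class stable under multiplication
    by a cosine: a product of two cosines is half the sum of two others. *)
Let F0 : set (Y -> R) := [set f | bfun f /\ forall t c, eint m1 m2 (f \* cs t c)].

Let mult_cs t c : mult F0 (cs t c).
Proof.
split; first exact: bcs.
move=> f [bf ef]; split; first exact: bfunM.
move=> s e; rewrite (_ : _ \* _ = (fun y => 2^-1 * (f \* cs (t + s) (c + e)) y) \+
   (fun y => 2^-1 * (f \* cs (t - s) (c - e)) y)).
  have bM u v : bfun (f \* cs u v) by exact: bfunM.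
  have bZ u v : bfun (fun y => 2^-1 * (f \* cs u v) y) by apply: bfunM => //; exact: bfun_cst.
  by apply: eintD => //; apply: eintZ.
apply/funext => y /=; rewrite /cs !innerDl innerNl.
set u := inner t y; set v := inner s y.
have -> : u + v + (c + e) = (u + c) + (v + e) by ring.
have -> : u - v + (c - e) = (u + c) - (v + e) by ring.
by rewrite (cosD (u + c)) (cosB (u + c)); field.
Qed.

Let F0b f : F0 f -> bfun f. Proof. by case. Qed.
Let F0D f g : F0 f -> F0 g -> F0 (f \+ g).
Proof.
move=> [bf ef] [bg eg]; split; first exact: bfunD.
move=> t c; rewrite (_ : _ \* _ = (f \* cs t c) \+ (g \* cs t c)); last first.
  by apply/funext => y /=; rewrite mulrDl.
by apply: eintD => //; exact: bfunM.
Qed.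
Let F0Z (c : R) f : F0 f -> F0 (fun y => c * f y).
Proof.
move=> [bf ef]; split; first by apply: bfunM => //; exact: bfun_cst.
move=> t e; rewrite (_ : _ \* _ = (fun y => c * (f \* cs t e) y)); last first.
  by apply/funext => y /=; rewrite mulrA.
by apply: eintZ => //; exact: bfunM.
Qed.
Let F0lim (fn : nat -> Y -> R) f (K : R) :
  (forall n, F0 (fn n)) -> (forall n y, `|fn n y| <= K) ->
  (forall y, fn n y @[n --> \oo] --> f y) -> F0 f.
Proof.
move=> Ffn fnK fnf; split.
  split; first by have [] := Rintegral_bounded_cvg m1 (fun n => (Ffn n).1.1) fnK fnf.
  exists K => y; rewrite -(cvg_lim _ (cvg_norm (fnf y)))//.
  apply: limr_le; first by apply/cvg_ex; eexists; exact: cvg_norm (fnf y).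
  by apply: nearW => n.
move=> t c; apply: (@eint_lim _ _ _ _ _ (fun n => fn n \* cs t c) _ K).
- by move=> n; apply: bfunM => //; exact: (Ffn n).1.
- by move=> n; apply: (Ffn n).2.
- move=> n y; rewrite normrM -[leRHS]mulr1 ler_pM//; exact: cos_abs_le1.
- by move=> y; apply: cvgM; [exact: fnf|exact: cvg_cst].
Qed.

(** The function [sin ((M i j - c) / n)] is a cosine with shifted phase, and for large [n] its
    argument lies in ]-1, 1[, where the sine has the sign of [M i j - c]. The indicator of its
    positivity is thus eventually that of the ray. *)
Let mult_ray i j (c : R) : mult F0 (fun M : Y => (c < M i j)%R%:R).
Proof.
pose sn n (M : Y) : R := sin ((M i j - c) / n.+1%:R).
have sE n : sn n = cs (n.+1%:R^-1 *: delta_mx i j) (- c / n.+1%:R - pi / 2).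
  apply/funext => M; rewrite /cs innerZl inner_delta /sn -cosBpihalf; congr cos.
  by rewrite mulrDl mulNr mulrC addrA.
apply: (@mult_lim _ _ _ m1 _ F0b F0lim (fun n y => (0 < sn n y)%R%:R) _ 1).
- move=> n; have ms : mult F0 (sn n) by rewrite sE; exact: mult_cs.
  have sb y : `|sn n y| <= 1 by exact: sin_abs_le1.
  exact (@mult_gt0 _ _ _ m1 _ F0b F0D F0Z F0lim (sn n) ms sb).
- by move=> n y; case: (0 < sn n y); rewrite ?normr0 ?normr1.
- move=> M; apply: cvg_near_cst; near=> n.
  have nb : `|M i j - c| < n.+1%:R.
    by near: n; exists (Num.trunc `|M i j - c|).+1 => // k /= hk; rewrite (lt_trans (truncnS_gt _))// ltr_nat.
  have n0 : 0 < n.+1%:R :> R by [].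
  have p2 := pi_ge2 R.
  have bd : -1 < (M i j - c) / n.+1%:R < 1.
    by move: nb; rewrite ltr_norml ltr_pdivrMr// ltr_pdivlMr// mulN1r mul1r.
  congr (_%:R : R); congr nat_of_bool.
  have [cM|Mc] := ltP c (M i j).
    apply: sin_gt0_pi; case/andP: bd => _ bd; rewrite divr_gt0 ?subr_gt0//=.
    by rewrite (lt_le_trans bd)// (le_trans _ p2)// ler1n.
  apply/negbTE; rewrite -leNgt -oppr_ge0 -sinN; apply: sin_ge0_pi.
  rewrite -mulNr opprB divr_ge0 ?subr_ge0 ?(ltW n0)//=; apply: ltW.
  rewrite -[c - _]opprB mulNr; move: bd; set q := _ / _ => bd; lra.
Unshelve. all: by end_near. Qed.

(** The hypothesis places the constant 1 in [F0]. Multiplying it by ray indicators gives the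
    indicator of an orthant, and testing against the cosine with [t = 0] and [c = 0] compares the
    two measures on it. *)
Lemma cf_measure_unique A : measurable A -> m1 A = m2 A.
Proof.
pose G := @mx_rays R a b.
apply: (@measure_unique _ R Y G (fun n => [set M : 'M[R]_(a, b) | forall i j, - n%:R < M i j])).
- by [].
- move=> _ _ [c ->] [e ->]; exists (\matrix_(i, j) Num.max (c i j) (e i j)).
  apply/seteqP; split => M /=.
    by move=> [h1 h2] i j; rewrite mxE gt_max h1 h2.
  by move=> h; split=> i j; have := h i j; rewrite mxE gt_max => /andP[].
- move=> n; exists (const_mx (- n%:R)); apply/seteqP; split => M /= h i j; have := h i j; by rewrite mxE.
- apply/seteqP; split => // M _ /=; pose B := \sum_k \sum_l `|M k l|.
  exists (Num.trunc B).+1 => // k l.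
  rewrite ltrNl; apply: (@le_lt_trans _ _ B); last exact: truncnS_gt.
  rewrite (le_trans (ler_norm _))// normrN.
  rewrite /B (bigD1 k)//= (bigD1 l)//= -addrA lerDl addr_ge0// sumr_ge0// => ? _.
  by rewrite sumr_ge0.
- move=> _ [c ->]; set E := [set M | _].
  have F01 : F0 (fun=> 1).
    split; first exact: bfun_cst.
    move=> t e; rewrite (_ : _ \* _ = cs t e); last by apply/funext => y /=; rewrite mul1r.
    exact: cfE.
  pose h (ij : 'I_a * 'I_b) (M : Y) : R := (c ij.1 ij.2 < M ij.1 ij.2)%R%:R.
  have [bh Fh] := mult_prod F0Z (index_enum _) (fun ij => mult_ray ij.1 ij.2 (c ij.1 ij.2)) .
  have [_ /(_ 0 0)] := Fh _ F01.
  have -> : ((fun=> 1) \* (fun y : Y => \prod_(ij <- index_enum _) h ij y)) \* cs 0 0 = (\1_E : Y -> R).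
    apply/funext => M /=; rewrite mul1r /cs inner0l add0r cos0 mulr1.
    rewrite indicE; case: (boolP (M \in E)) => [/[!inE] ME|].
      by rewrite big1// => ij _; rewrite /h (ME ij.1 ij.2).
    rewrite notin_setE /E/= -existsNP => -[i] /existsNP[j] /negP nij.
    by rewrite (bigD1 (i, j))//= /h/= (negbTE nij) mul0r.
  have mE : measurable (E : set Y) by apply: sub_sigma_algebra; exists c.
  rewrite /eint /Rintegral !integral_indic// !setIT => e12; have {e12} := congr1 EFin e12.
  by rewrite !fineK ?fin_num_measure.
- by move=> k; rewrite (le_lt_trans (probability_le1 _ _)) ?ltry//; apply: sub_sigma_algebra; exists (const_mx (- k%:R)); apply/seteqP; split => M /= h i j; have := h i j; rewrite mxE.
Qed.
End cf_unique.

Section same_law.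
Variables (R : realType) (a b : nat).
Context d (T : measurableType d) (P : probability T R).
Context d' (T' : measurableType d') (P' : probability T' R).
Variables (z : T -> 'M[R]_(a, b)) (z' : T' -> 'M[R]_(a, b)).
Hypotheses (mz : mfmx z) (mz' : mfmx z').
Hypothesis cfE : forall t c,
  \int[P]_w cos (inner t (z w) + c) = \int[P']_w cos (inner t (z' w) + c).

Lemma cf_law A : measurable (A : set (mxT R a b)) -> P (z @^-1` A) = P' (z' @^-1` A).
Proof.
have mZ := measurable_mx mz; have mZ' := measurable_mx mz'.
pose X : {RV P >-> mxT R a b} := HB.pack (z : T -> mxT R a b) (isMeasurableFun.Build _ _ _ _ _ mZ).
pose X' : {RV P' >-> mxT R a b} := HB.pack (z' : T' -> mxT R a b) (isMeasurableFun.Build _ _ _ _ _ mZ').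
move=> mA; apply: (@cf_measure_unique _ _ _ (distribution P X) (distribution P' X')) => // t c.
have mc : measurable_fun setT (fun M : mxT R a b => cos (inner t M + c)).
  apply: (measurableT_comp (f := cos)).
    by apply: continuous_measurable_fun; exact: continuous_cos.
  by apply: measurable_funD => //; exact: measurable_inner (@mfmx_id _ _ _).
have bc (y : mxT R a b) : `|cos (inner t y + c)| <= 1 by exact: cos_abs_le1.
rewrite /Rintegral (@integral_image _ _ _ _ _ P (distribution P X) z mZ)//; last exact: bounded_integrable bc.
rewrite (@integral_image _ _ _ _ _ P' (distribution P' X') z' mZ')//; last exact: bounded_integrable bc.
exact: cfE.
Qed.

Lemma cf_ge0_integral (f : mxT R a b -> \bar R) : measurable_fun setT f -> (forall M, 0 <= f M)%E ->
  (\int[P]_w f (z w) = \int[P']_w f (z' w))%E.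
Proof.
move=> mf f0; have mZ := measurable_mx mz; have mZ' := measurable_mx mz'.
have := @ge0_integral_pushforward _ _ _ _ _ _ mZ P setT f measurableT mf (fun y _ => f0 y).
rewrite preimage_setT => <-.
have := @ge0_integral_pushforward _ _ _ _ _ _ mZ' P' setT f measurableT mf (fun y _ => f0 y).
rewrite preimage_setT => <-.
by apply: eq_measure_integral => A mA _; exact: cf_law.
Qed.
End same_law.

(** * Measurability of matrix operations *)

Lemma measurable_inv (R : realType) : measurable_fun setT (fun x : R => x^-1).
Proof.
have <- : [set 0] `|` ~` [set 0] = [set: R] by rewrite setUv.
apply/measurable_funU => //; first exact: measurableC.
split; first exact: measurable_fun_set1.
apply: open_continuous_measurable_fun; first exact/closed_openC/closed_eq.
by move=> x; rewrite inE /= => /eqP x0; exact: inv_continuous.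
Qed.

Section mfmx_ops.
Variable R : realType.
Context d (T : measurableType d).

Lemma mfmx_comp d1 (T1 : measurableType d1) a b (f : T1 -> 'M[R]_(a, b)) (g : T -> T1) :
  measurable_fun setT g -> mfmx f -> mfmx (f \o g).
Proof. by move=> mg mf i j; exact: (measurableT_comp (mf i j)). Qed.

Lemma mfmx_cst a b (M : 'M[R]_(a, b)) : mfmx (fun _ : T => M).
Proof. by move=> i j. Qed.

Lemma mfmxD a b (f g : T -> 'M[R]_(a, b)) : mfmx f -> mfmx g -> mfmx (fun w => f w + g w).
Proof. by move=> mf mg i j; under eq_fun do rewrite mxE; exact: measurable_funD. Qed.

Lemma mfmxN a b (f : T -> 'M[R]_(a, b)) : mfmx f -> mfmx (fun w => - f w).
Proof. by move=> mf i j; under eq_fun do rewrite mxE; exact: measurableT_comp. Qed.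

Lemma mfmxB a b (f g : T -> 'M[R]_(a, b)) : mfmx f -> mfmx g -> mfmx (fun w => f w - g w).
Proof. by move=> mf mg; apply: mfmxD => //; exact: mfmxN. Qed.

Lemma mfmxZ a b (k : T -> R) (f : T -> 'M[R]_(a, b)) : measurable_fun setT k ->
  mfmx f -> mfmx (fun w => k w *: f w).
Proof. by move=> mk mf i j; under eq_fun do rewrite mxE; exact: measurable_funM. Qed.

Lemma mfmxM a b c (f : T -> 'M[R]_(a, b)) (g : T -> 'M[R]_(b, c)) :
  mfmx f -> mfmx g -> mfmx (fun w => f w *m g w).
Proof.
move=> mf mg i j; under eq_fun do rewrite mxE.
by apply: measurable_sum => k; exact: measurable_funM.
Qed.

Lemma mfmx_tr a b (f : T -> 'M[R]_(a, b)) : mfmx f -> mfmx (fun w => (f w)^T).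
Proof. by move=> mf i j; under eq_fun do rewrite mxE; exact: mf. Qed.

Lemma mfmx_sum (I : Type) (s : seq I) (p : pred I) a b (f : I -> T -> 'M[R]_(a, b)) :
  (forall i, mfmx (f i)) -> mfmx (fun w => \sum_(i <- s | p i) f i w).
Proof.
move=> mf i j; under eq_fun do rewrite summxE big_mkcond.
apply: measurable_sum => k; case: (p k) => //; exact: mf.
Qed.

Lemma measurable_det n (f : T -> 'M[R]_n) : mfmx f -> measurable_fun setT (fun w => \det (f w)).
Proof.
move=> mf; apply: measurable_sum => s; apply: measurable_funM => //.
by apply: measurable_prod => i _; exact: mf.
Qed.

Lemma measurable_unitmx n (f : T -> 'M[R]_n) : mfmx f -> measurable [set w | f w \in unitmx].
Proof.
move=> mf.
rewrite (_ : [set w | _] = ~` ((fun w => \det (f w)) @^-1` [set 0])); last first.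
  by apply/seteqP; split => w /=; rewrite unitmxE unitfE => /eqP.
apply: measurableC; rewrite -[X in measurable X]setTI.
by apply: measurable_det.
Qed.

Lemma mfmx_adj n (f : T -> 'M[R]_n) : mfmx f -> mfmx (fun w => \adj (f w)).
Proof.
move=> mf i j; under eq_fun do rewrite mxE.
apply: measurable_funM => //; apply: measurable_det => k l.
by under eq_fun do rewrite !mxE; exact: mf.
Qed.

Lemma mfmx_inv n (f : T -> 'M[R]_n) : mfmx f -> mfmx (fun w => invmx (f w)).
Proof.
move=> mf i j.
(* Cramer's rule on the invertible matrices; elsewhere [invmx] returns its argument. *)
rewrite (_ : (fun w => _) = (fun w => if f w \in unitmx then (\det (f w))^-1 * (\adj (f w)) i j else f w i j)).
  apply: measurable_fun_ifT => //.
  - apply: (measurable_fun_bool true); rewrite setTI; exact: measurable_unitmx.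
  - apply: measurable_funM; last exact: mfmx_adj.
    by apply: measurableT_comp; [exact: measurable_inv|exact: measurable_det].
by apply/funext => w; rewrite /invmx; case: ifP => // _; rewrite mxE.
Qed.
End mfmx_ops.

Section inner_mul.
Variable R : realType.

Lemma innerE a b (t M : 'M[R]_(a, b)) : inner t M = \tr (t^T *m M).
Proof.
rewrite /inner /mxtrace exchange_big; apply: eq_bigr => j _; rewrite mxE.
by apply: eq_bigr => i _; rewrite mxE.
Qed.

Lemma tr_mul_inner n (u v : 'cV[R]_n) : u^T *m v = (inner u v)%:M.
Proof. by rewrite [LHS]mx11_scalar innerE /mxtrace big_ord1. Qed.

Lemma inner_mull a b c (A : 'M[R]_(a, c)) (t : 'M[R]_(a, b)) M :
  inner t (A *m M) = inner (A^T *m t) M.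
Proof. by rewrite !innerE trmx_mul trmxK mulmxA. Qed.

Lemma inner_mulr a b c (B : 'M[R]_(c, b)) (t : 'M[R]_(a, b)) M :
  inner t (M *m B) = inner (t *m B^T) M.
Proof. by rewrite !innerE trmx_mul trmxK mulmxA mxtrace_mulC mulmxA. Qed.

Lemma inner_ge0 a b (t : 'M[R]_(a, b)) : 0 <= inner t t.
Proof. by apply: sumr_ge0 => i _; apply: sumr_ge0 => j _; rewrite -expr2 sqr_ge0. Qed.

Lemma inner_eq0 a b (t : 'M[R]_(a, b)) : (inner t t == 0) = (t == 0).
Proof.
apply/idP/eqP => [/eqP|->]; last by rewrite inner0l.
move=> t0; apply/matrixP => i j; rewrite mxE; apply/eqP; rewrite -sqrf_eq0.
have h k : 0 <= \sum_l t k l * t k l by apply: sumr_ge0 => l _; rewrite -expr2 sqr_ge0.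
move: t0 => /eqP; rewrite psumr_eq0 => [/allP/(_ i)|k _]; last exact: h.
rewrite mem_index_enum => /(_ isT)/=; rewrite psumr_eq0 => [/allP/(_ j)|l _]; last by rewrite -expr2 sqr_ge0.
by rewrite mem_index_enum => /(_ isT); rewrite -expr2.
Qed.
End inner_mul.

Section product_integrals.
Context (R : realType) d (T : measurableType d) (P : probability T R).
Context d' (T' : measurableType d') (P' : probability T' R).

Lemma Rintegral_prod (h : T * T' -> R) C : measurable_fun setT h -> (forall x, `|h x| <= C) ->
  \int[(P \x P')%E]_x h x = \int[P]_x \int[P']_y h (x, y).
Proof.
move=> mh hC.
have intf : (P \x P')%E.-integrable setT (EFin \o h) by exact: bounded_integrable hC.
rewrite /Rintegral -(integral12_prod_meas1 intf)/=.
congr fine; apply: eq_integral => x _; rewrite /fubini_F fineK//.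
apply: integrable_fin_num => //.
apply: (@bounded_integrable _ _ _ P' (fun y => h (x, y)) C) => //.
exact: measurableT_comp.
Qed.

(** This plays the part of conditioning on the first factor: a bound valid at every fixed [x] passes
    to the product. *)
Lemma prod_measure_le (E : set (T * T')) (r : \bar R) : measurable E ->
  (forall x : T, P' [set y | E (x, y)] <= r)%E -> ((P \x P') E <= r)%E.
Proof.
move=> mE h; rewrite /product_measure1.
have h' x : (P' (xsection E x) <= r)%E.
  rewrite (_ : xsection E x = [set y | E (x, y)]); first exact: h.
  by apply/seteqP; split => y; rewrite /xsection/= inE.
have r0 : (0 <= r)%E by apply: le_trans (h' point); exact: measure_ge0.
case: r r0 h h' => [r| |] r0 h h' //; last by rewrite leey.
apply: (@le_trans _ _ (\int[P]_x r%:E)%E).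
  apply: ge0_le_integral => //; first exact: measurable_fun_xsection.
  by move=> x _; exact: h'.
by rewrite integral_cst// [X in (_ * X)%E]probability_setT mule1.
Qed.
End product_integrals.

Lemma prob_integral_cst (R : realType) d (T : measurableType d) (P : probability T R) (r : R) :
  (\int[P]_w r%:E = r%:E)%E.
Proof. by rewrite integral_cst// [X in (_ * X)%E]probability_setT mule1. Qed.

Lemma sqr_ge_norm (R : realType) (a b : R) : 0 <= a -> a <= `|b| -> a ^+ 2 <= b ^+ 2.
Proof. by move=> a0 ab; rewrite -[leRHS]real_normK ?num_real// lerXn2r// ?nnegrE. Qed.

Lemma chebyshev_sqr (R : realType) d (T : measurableType d) (P : probability T R)
  (f : T -> R) (v eta : R) : measurable_fun setT f -> 0 < eta ->
  (\int[P]_w (f w ^+ 2)%:E = v%:E)%E -> (P [set w | (eta <= `|f w|)%R] <= (v / eta ^+ 2)%:E)%E.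
Proof.
move=> mf eta0 fv.
have mE : measurable [set w | eta <= `|f w|].
  rewrite (_ : [set w | _] = (fun w => `|f w|) @^-1` `[eta, +oo[); last first.
    by apply/seteqP; split => w /=; rewrite in_itv/= andbT.
  by rewrite -[X in measurable X]setTI; apply: measurableT_comp.
rewrite mulrC EFinM -fv -lee_pdivrMl ?exprn_gt0 ?invr_gt0//; last by rewrite exprn_gt0.
rewrite invrK -[X in P X]setIT -integral_indic// -ge0_integralZl//; last 2 first.
- exact/measurable_EFinP/measurable_indic.
- by rewrite lee_fin sqr_ge0.
apply: ge0_le_integral => //.
- by move=> w _; rewrite -EFinM lee_fin mulr_ge0// sqr_ge0.
- by apply: measurable_funeM; exact/measurable_EFinP/measurable_indic.
- by apply/measurable_EFinP; exact: measurable_funX.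
move=> w _; rewrite -EFinM lee_fin indicE; case: (boolP (w \in _)) => [|_]; last by rewrite mulr0 sqr_ge0.
by rewrite inE/= mulr1 => h; apply: sqr_ge_norm => //; exact: ltW.
Qed.

(* Independent standard normal entries, through the characteristic function: [c = 0] and [c = - pi / 2]
   give the expectations of its real and imaginary parts. *)
Definition gaussmx (R : realType) d (T : measurableType d) (P : probability T R) a b (z : T -> 'M[R]_(a, b)) :=
  mfmx z /\ forall t c, \int[P]_w cos (inner t (z w) + c) = cos c * expR (- inner t t / 2).

Lemma gauss_normal (R : realType) : gaussmx (normal_prob (0 : R) 1) (fun x : measurableTypeR R => const_mx x : 'M[R]_(1, 1)).
Proof.
split=> [i j|t c]; first by under eq_fun do rewrite mxE; exact: measurable_id.
have -> : inner t t = t 0 0 ^+ 2 by rewrite /inner !big_ord1 expr2.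
rewrite -normal_prob_cos; apply: eq_Rintegral => x _.
by rewrite /inner !big_ord1 mxE.
Qed.

(** * Gaussian matrices and their moments *)

Section gaussian_matrices.
Variable R : realType.
Context d (T : measurableType d) (P : probability T R).
Context d' (T' : measurableType d') (P' : probability T' R).

(** [L'] is the adjoint of [L]; that it preserves norms means that the image has again independent
    standard entries. *)
Lemma gauss_lin a b a1 b1 (z : T -> 'M[R]_(a, b)) (L : 'M[R]_(a, b) -> 'M[R]_(a1, b1)) L' :
  gaussmx P z -> (forall t M, inner t (L M) = inner (L' t) M) ->
  (forall t, inner (L' t) (L' t) = inner t t) -> mfmx (L \o z) -> gaussmx P (L \o z).
Proof.
move=> [mz cz] LL' L'1 mL; split => // t c /=.
by under eq_Rintegral do rewrite LL'; rewrite cz L'1.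
Qed.

Lemma measurable_cos_inner a b (z : T -> 'M[R]_(a, b)) t c :
  mfmx z -> measurable_fun setT (fun w => cos (inner t (z w) + c)).
Proof.
move=> mz; apply: (measurableT_comp (f := cos)).
  by apply: continuous_measurable_fun; exact: continuous_cos.
by apply: measurable_funD => //; exact: measurable_inner.
Qed.

(** The form in which independence enters: two Gaussian matrices on the factors of a product space
    are combined linearly, [A] and [B] being the adjoints in the two slots. The norm identity says
    that the two covariances add up to the identity. *)
Lemma gauss_mix a b a1 b1 e f (z : T -> 'M[R]_(a, b)) (z' : T' -> 'M[R]_(a1, b1))
    (F : 'M[R]_(a, b) -> 'M[R]_(a1, b1) -> 'M[R]_(e, f)) A B :
  gaussmx P z -> gaussmx P' z' ->
  (forall t M M', inner t (F M M') = inner (A t) M + inner (B t) M') ->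
  (forall t, inner (A t) (A t) + inner (B t) (B t) = inner t t) ->
  mfmx (fun w => F (z w.1) (z' w.2)) -> gaussmx (P \x P')%E (fun w => F (z w.1) (z' w.2)).
Proof.
move=> [mz cz] [mz' cz'] FE AB mF; split => // t c.
rewrite (@Rintegral_prod _ _ _ P _ _ P' _ 1); last 2 first.
- apply: (measurableT_comp (f := cos)).
    by apply: continuous_measurable_fun; exact: continuous_cos.
  by apply: measurable_funD => //; exact: measurable_inner.
- by move=> x; exact: cos_abs_le1.
transitivity (\int[P]_x (cos (inner (A t) (z x) + c) * expR (- inner (B t) (B t) / 2))).
  apply: eq_Rintegral => x _ /=; rewrite -cz'; apply: eq_Rintegral => y _.
  by rewrite FE; congr cos; ring.
rewrite RintegralZr//; last first.
  apply: (@bounded_integrable _ _ _ _ _ 1); first exact: measurable_cos_inner.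
  by move=> x; exact: cos_abs_le1.
by rewrite cz -mulrA -expRD -AB; congr (_ * expR _); ring.
Qed.

Lemma gauss_ge0_integral a b (z : T -> 'M[R]_(a, b)) (z' : T' -> 'M[R]_(a, b)) f :
  gaussmx P z -> gaussmx P' z' ->
  measurable_fun setT (f : mxT R a b -> \bar R) -> (forall M, 0 <= f M)%E ->
  (\int[P]_w f (z w) = \int[P']_w f (z' w))%E.
Proof. by move=> [mz cz] [mz' cz']; apply: cf_ge0_integral => // t c; rewrite cz cz'. Qed.

Lemma gauss_law a b (z : T -> 'M[R]_(a, b)) (z' : T' -> 'M[R]_(a, b)) (A : set (mxT R a b)) :
  gaussmx P z -> gaussmx P' z' -> measurable A -> P (z @^-1` A) = P' (z' @^-1` A).
Proof. by move=> [mz cz] [mz' cz']; apply: cf_law => // t c; rewrite cz cz'. Qed.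

Lemma gauss_unit a b (z : T -> 'M[R]_(a, b)) t : gaussmx P z -> inner t t = 1 ->
  gaussmx P (fun w => const_mx (inner t (z w)) : 'M[R]_(1, 1)).
Proof.
move=> gz t1; have [mz cz] := gz.
apply: (@gauss_lin _ _ _ _ z (fun M => const_mx (inner t M)) (fun s => s 0 0 *: t)) => //.
- by move=> s M; rewrite innerZl /inner !big_ord1 mxE.
- by move=> s; rewrite innerZl innerZr t1 /inner !big_ord1 mulr1.
- by move=> i j /=; under eq_fun do rewrite mxE; exact: measurable_inner.
Qed.

End gaussian_matrices.

Section gaussian_moments.
Variable R : realType.
Context d (T : measurableType d) (P : probability T R).

Lemma gauss_unit_integral a b (z : T -> 'M[R]_(a, b)) t (f : R -> \bar R) :
  gaussmx P z -> inner t t = 1 -> measurable_fun setT f -> (forall x, 0 <= f x)%E ->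
  (\int[P]_w f (inner t (z w)) = \int[normal_prob 0 1]_x f x)%E.
Proof.
move=> gz t1 mf f0.
have := @gauss_ge0_integral _ _ _ P _ _ (normal_prob 0 1) 1 1 _ _ (fun M => f (M 0 0)) (gauss_unit gz t1) (gauss_normal R).
move=> /(_ (measurableT_comp mf (@measurable_entry R 1 1 0 0)) (fun M => f0 _)).
under eq_integral do rewrite mxE.
by move=> ->; apply: eq_integral => x _; rewrite mxE.
Qed.

Lemma gauss_sqr a b (z : T -> 'M[R]_(a, b)) t : gaussmx P z ->
  (\int[P]_w (inner t (z w) ^+ 2)%:E = (inner t t)%:E)%E.
Proof.
move=> gz; have [t0|t0] := eqVneq (inner t t) 0.
  have /eqP := t0; rewrite inner_eq0 => /eqP ->.
  rewrite inner0l; apply: integral0_eq => w _; by rewrite inner0l expr0n.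
pose l := Num.sqrt (inner t t).
have l2 : l ^+ 2 = inner t t by rewrite sqr_sqrtr// inner_ge0.
have l0 : l != 0 by apply: contra_neq t0 => l0; rewrite -l2 l0 expr0n.
have u1 : inner (l^-1 *: t) (l^-1 *: t) = 1 by rewrite innerZl innerZr -l2; field.
transitivity (\int[P]_w ((inner t t)%:E * (inner (l^-1 *: t) (z w) ^+ 2)%:E))%E.
  apply: eq_integral => w _; rewrite -EFinM -l2 innerZl; congr EFin; by field.
have mi : measurable_fun setT (fun w => (inner (l^-1 *: t) (z w) ^+ 2)%:E).
  by apply/measurable_EFinP; apply: measurable_funX; apply: measurable_inner; case: gz.
rewrite ge0_integralZl//; last 2 first.
- by move=> w _; rewrite lee_fin sqr_ge0.
- by rewrite lee_fin inner_ge0.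
rewrite (gauss_unit_integral (f := fun x => (x ^+ 2)%:E) gz u1) ?integral_normal_prob_sqr ?mule1//.
- by apply/measurable_EFinP; exact: measurable_funX.
- by move=> x; rewrite lee_fin sqr_ge0.
Qed.

Lemma gauss_pow4 a b (z : T -> 'M[R]_(a, b)) t : gaussmx P z ->
  (\int[P]_w (inner t (z w) ^+ 4)%:E < +oo)%E.
Proof.
move=> gz; have [t0|t0] := eqVneq (inner t t) 0.
  have /eqP := t0; rewrite inner_eq0 => /eqP ->.
  by rewrite integral0_eq ?ltry// => w _; rewrite inner0l expr0n.
pose l := Num.sqrt (inner t t).
have l2 : l ^+ 2 = inner t t by rewrite sqr_sqrtr// inner_ge0.
have l0 : l != 0 by apply: contra_neq t0 => l0; rewrite -l2 l0 expr0n.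
have u1 : inner (l^-1 *: t) (l^-1 *: t) = 1 by rewrite innerZl innerZr -l2; field.
have -> : (\int[P]_w (inner t (z w) ^+ 4)%:E = \int[P]_w ((l ^+ 4)%:E * (inner (l^-1 *: t) (z w) ^+ 4)%:E))%E.
  by apply: eq_integral => w _; rewrite -EFinM innerZl; congr EFin; field.
have mi : measurable_fun setT (fun w => (inner (l^-1 *: t) (z w) ^+ 4)%:E).
  by apply/measurable_EFinP; apply: measurable_funX; apply: measurable_inner; case: gz.
rewrite ge0_integralZl//; last 2 first.
- by move=> w _; rewrite lee_fin exprn_even_ge0.
- by rewrite lee_fin exprn_even_ge0.
rewrite (gauss_unit_integral (f := fun x => (x ^+ 4)%:E) gz u1).
- by rewrite lte_mul_pinfty// ?lee_fin ?exprn_even_ge0// integral_normal_prob_pow4.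
- by apply/measurable_EFinP; exact: measurable_funX.
- by move=> x; rewrite lee_fin exprn_even_ge0.
Qed.

Lemma gauss_neq0 a b (z : T -> 'M[R]_(a, b)) t : gaussmx P z -> t != 0 ->
  P [set w | inner t (z w) = 0] = 0%E.
Proof.
move=> gz; rewrite -inner_eq0 => t0.
pose l := Num.sqrt (inner t t).
have l2 : l ^+ 2 = inner t t by rewrite sqr_sqrtr// inner_ge0.
have l0 : l != 0 by apply: contra_neq t0 => l0; rewrite -l2 l0 expr0n.
have u1 : inner (l^-1 *: t) (l^-1 *: t) = 1 by rewrite innerZl innerZr -l2; field.
have := @gauss_law _ _ _ P _ _ (normal_prob 0 1) 1 1 _ _ ((fun M : mxT R 1 1 => M 0 0) @^-1` [set 0]) (gauss_unit gz u1) (gauss_normal R).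
have mA : measurable ((fun M : mxT R 1 1 => M 0 0) @^-1` [set 0]).
  by rewrite -[X in measurable X]setTI; exact: measurable_entry.
move=> /(_ mA).
have -> : (fun w => const_mx (inner (l^-1 *: t) (z w))) @^-1` ((fun M : mxT R 1 1 => M 0 0) @^-1` [set 0]) =
   [set w | inner t (z w) = 0].
  apply/seteqP; split => w /=; rewrite mxE innerZl => /eqP.
    by rewrite mulf_eq0 invr_eq0 (negbTE l0) => /eqP.
  by move=> /eqP ->; rewrite mulr0.
move=> ->.
have -> : (fun x : R => const_mx x) @^-1` ((fun M : mxT R 1 1 => M 0 0) @^-1` [set 0]) = [set (0 : R)].
  by apply/seteqP; split => x /=; rewrite mxE.
have /null_content_dominatesP := @normal_prob_dominates R 0 1.
by apply => //; exact: lebesgue_measure_set1.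
Qed.

Import HBNNSimple.

(** Only finiteness is at stake, so [(a + b)^2 <= 2 a^2 + 2 b^2] is enough. It lets the second
    moment be cancelled in [gauss_proj_sqr]. *)
Lemma integral_sum_sqr_lt (I : eqType) (s : seq I) (f : I -> T -> R) :
  (forall i, measurable_fun setT (f i)) -> (forall i, \int[P]_w (f i w ^+ 2)%:E < +oo)%E ->
  (\int[P]_w ((\sum_(i <- s) f i w) ^+ 2)%:E < +oo)%E.
Proof.
move=> mf fi; elim: s => [|i s IH].
  by rewrite integral0_eq ?ltry// => w _; rewrite big_nil expr0n.
have m1 : measurable_fun setT (fun w => (f i w ^+ 2)%:E) by apply/measurable_EFinP; exact: measurable_funX.
have ms : measurable_fun setT (fun w => \sum_(i <- s) f i w) by exact: measurable_sum.
have m2 : measurable_fun setT (fun w => ((\sum_(i <- s) f i w) ^+ 2)%:E) by apply/measurable_EFinP; exact: measurable_funX.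
apply: (@le_lt_trans _ _ (\int[P]_w (2%:E * (f i w ^+ 2)%:E + 2%:E * ((\sum_(i <- s) f i w) ^+ 2)%:E))%E).
  apply: ge0_le_integral => //=.
  - by move=> w _; rewrite lee_fin sqr_ge0.
  - by apply/measurable_EFinP; apply: measurable_funX; apply: measurable_sum.
  - by apply: emeasurable_funD; exact: measurable_funeM.
  - move=> w _; rewrite big_cons -!EFinM -EFinD lee_fin.
    by have := sqr_ge0 (f i w - \sum_(j <- s) f j w); nra.
rewrite ge0_integralD//; last 4 first.
- by move=> w _; rewrite -EFinM lee_fin mulr_ge0// sqr_ge0.
- exact: measurable_funeM.
- by move=> w _; rewrite -EFinM lee_fin mulr_ge0// sqr_ge0.
- exact: measurable_funeM.
rewrite !ge0_integralZl//; [|by move=> w _; rewrite lee_fin sqr_ge0..].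
by rewrite lte_add_pinfty// lte_mul_pinfty.
Qed.

Variables (n : nat) (x : T -> 'cV[R]_n).
Hypothesis gx : gaussmx P x.
Let mx : mfmx x. Proof. by case: gx. Qed.

Lemma measurable_inner2 m b c (A : 'M[R]_(c, m)) (y : T -> 'M[R]_(m, b)) : mfmx y ->
   measurable_fun setT (fun w => inner (A *m y w) (A *m y w)).
Proof.
move=> my; have mA : mfmx (fun w => A *m y w) by apply: mfmxM => //; exact: mfmx_cst.
by apply: measurable_sum => i; apply: measurable_sum => j; exact: measurable_funM.
Qed.

Lemma inner_mulmx_sum m (A : 'M[R]_(m, n)) (v : 'cV[R]_n) :
  inner (A *m v) (A *m v) = \sum_i inner (row i A)^T v ^+ 2.
Proof.
rewrite /inner; apply: eq_bigr => i _; rewrite big_ord1 expr2.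
have -> // : (A *m v) i 0 = \sum_(k < n) \sum_(j < 1) (row i A)^T k j * v k j.
by rewrite mxE; apply: eq_bigr => k _; rewrite big_ord1 !mxE.
Qed.

Lemma gauss_quad_mean m (A : 'M[R]_(m, n)) :
  (\int[P]_w (inner (A *m x w) (A *m x w))%:E = (\tr (A *m A^T))%:E)%E.
Proof.
under eq_integral do rewrite inner_mulmx_sum -sumEFin.
rewrite ge0_integral_sum//; last 2 first.
- by move=> i; apply/measurable_EFinP; apply: measurable_funX; apply: measurable_inner.
- by move=> i w _; rewrite lee_fin sqr_ge0.
rewrite -sumEFin; apply: eq_bigr => i _; rewrite gauss_sqr//; congr EFin.
by rewrite mxE /inner; apply: eq_bigr => k _; rewrite big_ord1 !mxE.
Qed.

Lemma gauss_quad_sqr_lt m (A : 'M[R]_(m, n)) :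
  (\int[P]_w (inner (A *m x w) (A *m x w) ^+ 2)%:E < +oo)%E.
Proof.
under eq_integral do rewrite inner_mulmx_sum.
apply: integral_sum_sqr_lt => i; first by apply: measurable_funX; apply: measurable_inner.
under eq_integral do rewrite -exprM.
exact: gauss_pow4.
Qed.

End gaussian_moments.

Section nonneg_integral.
Context (R : realType) d (T : measurableType d) (P : {measure set T -> \bar R}).

Lemma ge0_integral_lin (f g : T -> R) (k l : R) :
  measurable_fun setT f -> measurable_fun setT g -> (forall w, 0 <= f w) -> (forall w, 0 <= g w) ->
  0 <= k -> 0 <= l ->
  (\int[P]_w (k * f w + l * g w)%:E = k%:E * \int[P]_w (f w)%:E + l%:E * \int[P]_w (g w)%:E)%E.
Proof.
move=> mf mg f0 g0 k0 l0.
under eq_integral do rewrite EFinD !EFinM.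
have mfe : measurable_fun setT (EFin \o f) by apply/measurable_EFinP.
have mge : measurable_fun setT (EFin \o g) by apply/measurable_EFinP.
rewrite ge0_integralD//; last 4 first.
- by move=> w _; rewrite -EFinM lee_fin mulr_ge0.
- exact: measurable_funeM.
- by move=> w _; rewrite -EFinM lee_fin mulr_ge0.
- exact: measurable_funeM.
by rewrite !ge0_integralZl//; move=> w _; rewrite lee_fin.
Qed.
End nonneg_integral.

Section projection_moments.
Variable R : realType.
Context d (T : measurableType d) (P : probability T R).
Variables (n : nat) (x : T -> 'cV[R]_n).
Hypothesis gx : gaussmx P x.
Let mx : mfmx x. Proof. by case: gx. Qed.
Variable Q : 'M[R]_n.
Hypotheses (Qsym : Q^T = Q) (Qidem : Q *m Q = Q).
Let S (v : 'cV[R]_n) := inner (Q *m v) (Q *m v).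
Let a := \tr Q.

Let S_ge0 v : 0 <= S v. Proof. exact: inner_ge0. Qed.

Let mS d1 (T1 : measurableType d1) (y : T1 -> 'cV[R]_n) : mfmx y -> measurable_fun setT (fun w => S (y w)).
Proof. by move=> my; exact: measurable_inner2. Qed.

Let meanS : (\int[P]_w (S (x w))%:E = a%:E)%E.
Proof. by rewrite gauss_quad_mean// Qsym Qidem. Qed.

Let a_ge0 : 0 <= a.
Proof. by rewrite -lee_fin -meanS integral_ge0// => w _; rewrite lee_fin. Qed.

Let pm (s : R) (w : T * T) : 'cV[R]_n := (Num.sqrt 2)^-1 *: (x w.1 + s *: x w.2).

Let mx1 : mfmx (fun w : T * T => x w.1). Proof. exact: (mfmx_comp (g := fst)). Qed.
Let mx2 : mfmx (fun w : T * T => x w.2). Proof. exact: (mfmx_comp (g := snd)). Qed.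

Let gauss_pm s : s ^+ 2 = 1 -> gaussmx (P \x P)%E (pm s).
Proof.
move=> s1; apply: (@gauss_mix _ _ _ P _ _ P _ _ _ _ _ _ x x (fun M M' => (Num.sqrt 2)^-1 *: (M + s *: M'))
  (fun t => (Num.sqrt 2)^-1 *: t) (fun t => ((Num.sqrt 2)^-1 * s) *: t)) => //.
- by move=> t M M'; rewrite innerZr innerDr innerZr !innerZl; ring.
- move=> t; rewrite !innerZl !innerZr.
  have s2 : Num.sqrt 2 ^+ 2 = 2 :> R by rewrite sqr_sqrtr.
  have s0 : Num.sqrt 2 != 0 :> R by rewrite gt_eqF// sqrtr_gt0.
  have -> : (Num.sqrt 2)^-1 * s * ((Num.sqrt 2)^-1 * s * inner t t) = s ^+ 2 * ((Num.sqrt 2)^-1) ^+ 2 * inner t t by ring.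
  by rewrite mulrA -expr2 s1 exprVn s2; field.
- apply: mfmxZ => //; apply: mfmxD => //; exact: mfmxZ.
Qed.

Let Spm s (w : T * T) : s ^+ 2 = 1 ->
  S (pm s w) = 2^-1 * (S (x w.1) + S (x w.2)) + s * inner (Q *m x w.1) (x w.2).
Proof.
move=> s1; rewrite /S /pm -scalemxAr mulmxDr -scalemxAr !(innerZl, innerZr, innerDl, innerDr).
have s2 : Num.sqrt 2 ^+ 2 = 2 :> R by rewrite sqr_sqrtr.
have s0 : Num.sqrt 2 != 0 :> R by rewrite gt_eqF// sqrtr_gt0.
have -> : inner (Q *m x w.1) (Q *m x w.2) = inner (Q *m x w.1) (x w.2).
  by rewrite inner_mull mulmxA Qsym Qidem.
rewrite (innerC (Q *m x w.2) (Q *m x w.1)).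
have -> : inner (Q *m x w.1) (Q *m x w.2) = inner (Q *m x w.1) (x w.2).
  by rewrite inner_mull mulmxA Qsym Qidem.
have e2 : ((Num.sqrt 2)^-1) ^+ 2 = 2^-1 :> R by rewrite exprVn s2.
move: (inner _ _) (inner _ _) (inner _ _) => B C A.
transitivity (((Num.sqrt 2)^-1) ^+ 2 * (A + s * C + (s * C + s ^+ 2 * B))); first by ring.
by rewrite e2 s1; field.
Qed.

(** Invariance under rotation replaces the fourth moment of the normal law. For independent copies
    [x], [x'], both [(x + x') / sqrt 2] and [(x - x') / sqrt 2] are Gaussian, and [S] takes on them
    the values [(S + S') / 2 + T] and [(S + S') / 2 - T] with [T = (Q x) . x']. Summing the squares
    gives [2 m = m + a^2 + 2 E T^2]. Given [x], the mean of [T^2] is [S], so [E T^2 = a], and [m],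
    being finite, cancels. *)
Lemma gauss_proj_sqr : (\int[P]_w (S (x w) ^+ 2)%:E = (a ^+ 2 + 2 * a)%:E)%E.
Proof.
pose m := (\int[P]_w (S (x w) ^+ 2)%:E)%E.
have m0 : (0 <= m)%E by apply: integral_ge0 => w _; rewrite lee_fin sqr_ge0.
have mf : m \is a fin_num by rewrite ge0_fin_numE//; exact: gauss_quad_sqr_lt.
have mSS : measurable_fun setT (fun w => S (x w) ^+ 2) by apply: measurable_funX; exact: mS.
have mpm s : s ^+ 2 = 1 -> (\int[P \x P]_w (S (pm s w) ^+ 2)%:E = m)%E.
  move=> s1; apply/esym; apply: (@gauss_ge0_integral _ _ _ P _ _ (P \x P)%E _ _ _ _ (fun M => (S M ^+ 2)%:E)) => //.
  - exact: gauss_pm.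
  - by apply/measurable_EFinP; apply: measurable_funX; apply: mS; exact: mfmx_id.
  - by move=> M; rewrite lee_fin sqr_ge0.
have mpmf s : s ^+ 2 = 1 -> measurable_fun setT (fun w => S (pm s w) ^+ 2).
  by move=> s1; apply: measurable_funX; apply: mS; have [] := gauss_pm s1.
have two : (2%:E * m = \int[P \x P]_w (1 * S (pm 1 w) ^+ 2 + 1 * S (pm (-1) w) ^+ 2)%:E)%E.
  rewrite ge0_integral_lin//; [|by apply: mpmf; rewrite ?sqrrN expr1n|by apply: mpmf; rewrite ?sqrrN expr1n|by move=> w; rewrite sqr_ge0|by move=> w; rewrite sqr_ge0].
  by rewrite !mpm ?sqrrN ?expr1n// !mul1e -[in RHS](fineK mf) -EFinD -[in LHS](fineK mf) -EFinM; congr EFin; ring.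
have inn w1 : (\int[P]_w2 (1 * S (pm 1 (w1, w2)) ^+ 2 + 1 * S (pm (-1) (w1, w2)) ^+ 2)%:E
    = (2^-1 * S (x w1) ^+ 2 + 1 * (2^-1 * fine m + (a + 2) * S (x w1)))%:E)%E.
  transitivity (\int[P]_w2 (1 * (2^-1 * S (x w1) ^+ 2 + 2^-1 * S (x w2) ^+ 2) + 1 * (S (x w1) * S (x w2) + 2 * inner (Q *m x w1) (x w2) ^+ 2))%:E)%E.
    apply: eq_integral => w2 _; congr EFin; rewrite !Spm ?sqrrN ?expr1n//=; by field.
  have mT : measurable_fun setT (fun w => inner (Q *m x w1) (x w) ^+ 2) by apply: measurable_funX; exact: measurable_inner.
  have mS1 : measurable_fun setT (fun w => S (x w)) by exact: mS.
  rewrite ge0_integral_lin//; last 4 first.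
  - by apply: measurable_funD => //; apply: measurable_funM.
  - by apply: measurable_funD => //; apply: measurable_funM.
  - by move=> w; rewrite addr_ge0// mulr_ge0// sqr_ge0.
  - by move=> w; rewrite addr_ge0// mulr_ge0// ?sqr_ge0.
  rewrite (@ge0_integral_lin _ _ _ P (fun=> S (x w1) ^+ 2))//; [|by move=> w; rewrite sqr_ge0|by move=> w; rewrite sqr_ge0].
  rewrite ge0_integral_lin//; last by move=> w; rewrite sqr_ge0.
  rewrite meanS prob_integral_cst (gauss_sqr (Q *m x w1) gx) -/(S (x w1)) -/m.
  rewrite -[in LHS](fineK mf) !mul1e -!EFinM -!EFinD; congr EFin.
  by field.
move: two; rewrite fubini_tonelli1; last 2 first.
- by apply/measurable_EFinP; apply: measurable_funD; apply: measurable_funM => //; apply: mpmf; rewrite ?sqrrN expr1n.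
- by move=> w; rewrite lee_fin addr_ge0// mulr_ge0// sqr_ge0.
rewrite /fubini_F; under eq_integral do rewrite inn.
have mS1 : measurable_fun setT (fun w => S (x w)) by exact: mS.
have fm0 : 0 <= fine m by exact: fine_ge0.
rewrite ge0_integral_lin//; last 3 first.
- by apply: measurable_funD => //; apply: measurable_funM.
- by move=> w; rewrite sqr_ge0.
- by move=> w; rewrite addr_ge0// mulr_ge0// addr_ge0.
have -> : (\int[P]_w (2^-1 * fine m + (a + 2) * S (x w))%:E = (2^-1 * fine m + (a + 2) * a)%:E)%E.
  transitivity (\int[P]_w ((2^-1 * fine m) * cst 1 w + (a + 2) * S (x w))%:E)%E.
    by apply: eq_integral => w _; rewrite /= mulr1.
  rewrite ge0_integral_lin//; [|by rewrite mulr_ge0|by rewrite addr_ge0].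
  have -> : (\int[P]_w (cst (1 : R) w)%:E = 1)%E := prob_integral_cst P 1.
  by rewrite meanS mule1.
rewrite -/m -(fineK mf) -!EFinM -!EFinD.
by move=> [e]; congr EFin; lra.
Qed.

Lemma gauss_proj_chebyshev (eta : R) : 0 < eta ->
  (P [set w | (eta <= `|S (x w) - a|)%R] <= (2 * a / eta ^+ 2)%:E)%E.
Proof.
move=> eta0.
have mS1 : measurable_fun setT (fun w => S (x w)) by exact: mS.
have mD : measurable_fun setT (fun w => (S (x w) - a) ^+ 2).
  by apply: measurable_funX; exact: measurable_funB.
have var : (\int[P]_w ((S (x w) - a) ^+ 2)%:E = (2 * a)%:E)%E.
  (* The variance is read off from an identity with nonnegative terms on both sides, since integrals
     in the extended reals are not subtracted. *)
  have : (\int[P]_w (1 * (S (x w) - a) ^+ 2 + (2 * a) * S (x w))%:E = \int[P]_w (1 * S (x w) ^+ 2 + a ^+ 2 * cst 1 w)%:E)%E.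
    by apply: eq_integral => w _; congr EFin; rewrite /=; ring.
  rewrite ge0_integral_lin//; [|by move=> w; rewrite sqr_ge0|by rewrite mulr_ge0].
  rewrite (@ge0_integral_lin _ _ _ P _ (cst 1))//; [|by apply: measurable_funX|by move=> w; rewrite sqr_ge0|by rewrite sqr_ge0].
  have -> : (\int[P]_w (cst (1 : R) w)%:E = 1)%E := prob_integral_cst P 1.
  rewrite meanS gauss_proj_sqr !mul1e mule1.
  have v0 : (0 <= \int[P]_w ((S (x w) - a) ^+ 2)%:E)%E by apply: integral_ge0 => w _; rewrite lee_fin sqr_ge0.
  case: (\int[P]_w ((S (x w) - a) ^+ 2)%:E)%E v0 => //= r _; rewrite -!EFinM -!EFinD => -[e]; congr EFin; lra.
apply: chebyshev_sqr => //; exact: measurable_funB.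
Qed.

End projection_moments.

Section gaussian_duality.
Variable R : realType.
Context d (T : measurableType d) (P : probability T R).
Context d' (T' : measurableType d') (P' : probability T' R).

Lemma Rintegral_swap (h : T * T' -> R) C : measurable_fun setT h -> (forall x, `|h x| <= C) ->
  \int[P]_x \int[P']_y h (x, y) = \int[P']_y \int[P]_x h (x, y).
Proof.
move=> mh hC.
have intf : (P \x P')%E.-integrable setT (EFin \o h) by exact: bounded_integrable hC.
have hx y : measurable_fun setT (fun x => h (x, y)) by exact: measurableT_comp.
have hy x : measurable_fun setT (fun y => h (x, y)) by exact: measurableT_comp.
rewrite /Rintegral; congr fine.
transitivity (\int[P]_x \int[P']_y (h (x, y))%:E)%E.
  apply: eq_integral => x _; rewrite fineK//; apply: integrable_fin_num => //.
  by apply: (@bounded_integrable _ _ _ P' (fun y => h (x, y)) C).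
rewrite (Fubini intf); apply: eq_integral => y _; rewrite fineK//; apply: integrable_fin_num => //.
by apply: (@bounded_integrable _ _ _ P (fun x => h (x, y)) C).
Qed.

(* both sides are the double integral of [cos (g^T B x)] *)
Lemma gauss_expR_quad_dual n m (x : T -> 'cV[R]_n) (g : T' -> 'cV[R]_m) (B : 'M[R]_(m, n)) :
  gaussmx P x -> gaussmx P' g ->
  \int[P]_w expR (- inner (B *m x w) (B *m x w) / 2) =
  \int[P']_w expR (- inner (B^T *m g w) (B^T *m g w) / 2).
Proof.
move=> [mx cx] [mg cg].
have mB : measurable_fun setT (fun w : T * T' => cos (inner (B *m x w.1) (g w.2))).
  apply: (measurableT_comp (f := cos)).
    by apply: continuous_measurable_fun; exact: continuous_cos.
  have m1 : mfmx (fun w : T * T' => B *m x w.1).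
    apply: mfmxM; first exact: mfmx_cst.
    exact: (mfmx_comp (f := x) (g := fst)).
  have m2 : mfmx (fun w : T * T' => g w.2) by exact: (mfmx_comp (f := g) (g := snd)).
  by apply: measurable_sum => i; apply: measurable_sum => j; exact: measurable_funM.
transitivity (\int[P]_w \int[P']_w' cos (inner (B *m x w) (g w'))).
  apply: eq_Rintegral => w _; have := cg (B *m x w) 0; rewrite cos0 mul1r => <-.
  by apply: eq_Rintegral => w' _; rewrite addr0.
rewrite (@Rintegral_swap (fun w => cos (inner (B *m x w.1) (g w.2))) 1)//=; last by move=> w; exact: cos_abs_le1.
apply: eq_Rintegral => w' _; have := cx (B^T *m g w') 0; rewrite cos0 mul1r => <-.
apply: eq_Rintegral => w _; by rewrite addr0 innerC inner_mull.
Qed.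
End gaussian_duality.

(** * Bordered Gram matrices *)

Section gram_schur.
Variables (R : realType) (n p : nat).
Variable M : 'M[R]_n.
Hypotheses (Msym : M^T = M) (Midem : M *m M = M).
Variable z : 'M[R]_(n, p).
Implicit Types (D : 'M[R]_p) (u v : 'cV[R]_p).

Definition proj D := D^T = D /\ D *m D = D.

Lemma proj_mx1 : proj 1%:M.
Proof. by split; rewrite ?trmx1 ?mulmx1. Qed.

(* the Gram matrix of the columns of [M z], compressed to the range of the projection [D]
   and extended by the identity on its kernel *)
Definition gram D := (z *m D)^T *m M *m (z *m D) + (1%:M - D).

Lemma gram_sym D : proj D -> (gram D)^T = gram D.
Proof.
move=> [Ds _]; rewrite /gram linearD linearB/= trmx1 Ds.
by rewrite !trmx_mul !trmxK Msym !mulmxA !Ds.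
Qed.

Lemma inner_proj m (Q : 'M[R]_m) (v : 'cV[R]_m) : Q^T = Q -> Q *m Q = Q ->
  inner v (Q *m v) = inner (Q *m v) (Q *m v).
Proof. by move=> Qs QQ; rewrite (inner_mull Q (Q *m v)) Qs mulmxA QQ innerC. Qed.

(** The quadratic form of [gram D] at [v] is [|M z D v|^2 + |(1 - D) v|^2], so it vanishes only when
    both terms do. *)
Lemma gram_ker D v : proj D -> (gram D *m v = 0) <-> (D *m v = v /\ M *m z *m v = 0).
Proof.
move=> pD; have [Ds DD] := pD; split; last first.
  move=> [Dv Mzv]; rewrite /gram mulmxDl mulmxBl mul1mx Dv subrr addr0.
  by rewrite -!mulmxA Dv (mulmxA M) Mzv mulmx0.
move=> Wv.
have E1 : (1%:M - D)^T = 1%:M - D by rewrite linearB/= trmx1 Ds.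
have E2 : (1%:M - D) *m (1%:M - D) = 1%:M - D.
  by rewrite mulmxBl mul1mx mulmxBr mulmx1 DD subrr subr0.
have : inner v (gram D *m v) = inner (M *m (z *m D *m v)) (M *m (z *m D *m v)) +
    inner ((1%:M - D) *m v) ((1%:M - D) *m v).
  rewrite /gram mulmxDl innerDr; congr (_ + _); last exact: inner_proj.
  by rewrite -mulmxA -[_ *m M *m _]mulmxA inner_mull trmxK inner_proj.
rewrite Wv innerC inner0l => /esym/eqP; rewrite paddr_eq0 ?inner_ge0// !inner_eq0 => /andP[/eqP h1 /eqP h2].
have Dv : D *m v = v by apply/esym/eqP; rewrite -subr_eq0 -[X in X - _](mul1mx v) -mulmxBl h2.
by split => //; move: h1; rewrite -(mulmxA z) Dv mulmxA.
Qed.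

Lemma gram_unit D : proj D ->
  reflect (forall v, D *m v = v -> M *m z *m v = 0 -> v = 0) (gram D \in unitmx).
Proof.
move=> pD; apply: (iffP idP).
  move=> Wu v Dv Mzv; have /(_ v pD) [_ /(_ (conj Dv Mzv)) h] := @gram_ker D.
  by rewrite -[v]mul1mx -(mulVmx Wu) -mulmxA h mulmx0.
move=> h; rewrite unitmxE unitfE; apply/negP => /det0P[v v0 vW].
have : gram D *m v^T = 0 by rewrite -(gram_sym pD) -trmx_mul vW trmx0.
move=> /(gram_ker _ pD)[Dv Mzv]; have := h _ Dv Mzv => /(congr1 trmx); rewrite trmxK trmx0 => v00.
by rewrite v00 eqxx in v0.
Qed.

Section rank_one_step.
Variables (D D' E : 'M[R]_p) (u : 'cV[R]_p).
Hypotheses (pD : proj D) (Du : D *m u = u) (u1 : inner u u = 1).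
Hypotheses (D'E : D' = D - u *m u^T) (EE : E = 1%:M - D').

Let uu : u^T *m u = 1%:M.
Proof. by rewrite tr_mul_inner u1. Qed.
Let uD : u^T *m D = u^T. Proof. by case: pD => Ds _; rewrite -{1}Ds -trmx_mul Du. Qed.

Lemma proj_step : proj D'.
Proof.
have [Ds DD] := pD; split; first by rewrite D'E linearB/= trmx_mul trmxK Ds.
rewrite D'E mulmxBl !mulmxBr DD mulmxA Du -(mulmxA u) uD.
by rewrite -(mulmxA u) (mulmxA u^T) uu mul1mx subrr subr0.
Qed.

Let D'u : D' *m u = 0. Proof. by rewrite D'E mulmxBl Du -mulmxA uu mulmx1 subrr. Qed.
Let DD' : D *m D' = D'.
Proof. by have [Ds DD] := pD; rewrite D'E mulmxBr DD mulmxA Du. Qed.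
Let D's : D'^T = D'. Proof. by case: proj_step. Qed.
Let D'D' : D' *m D' = D'. Proof. by case: proj_step. Qed.

Lemma tr_step : \tr D' = \tr D - 1.
Proof. by rewrite D'E linearB/= mxtrace_mulC uu mxtrace1. Qed.

Lemma gram_unit_step : gram D \in unitmx -> gram D' \in unitmx.
Proof.
move=> /(gram_unit pD) h; apply/(gram_unit proj_step) => v D'v; apply: h.
by rewrite -D'v mulmxA DD'.
Qed.

Hypothesis W'u : gram D' \in unitmx.
Variables (Wi : 'M[R]_p) (z' : 'M[R]_(n, p)) (x : 'cV[R]_n).
Hypotheses (WiE : Wi = invmx (gram D')) (z'E : z' = z *m D') (xE : x = z *m u).

Definition regr := Wi *m z'^T *m M.
Definition resid := M - M *m z' *m regr.

Let Wis : Wi^T = Wi. Proof. by rewrite WiE trmx_inv gram_sym//; exact: proj_step. Qed.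
Let z'E0 : z' *m E = 0.
Proof. by rewrite z'E EE -mulmxA mulmxBr mulmx1 D'D' subrr mulmx0. Qed.
Let D1 : 1%:M - E = D'. Proof. by rewrite EE opprB addrC subrK. Qed.
Let Es : E^T = E. Proof. by rewrite EE linearB/= trmx1 D's. Qed.
Let Ez' : E *m z'^T = 0.
Proof. by rewrite -[LHS]trmxK trmx_mul trmxK Es z'E0 trmx0. Qed.
Let gramE : gram D' = z'^T *m M *m z' + E. Proof. by rewrite /gram -z'E -EE. Qed.
Let E2 : E *m E = E.
Proof. by rewrite EE mulmxBr mulmx1 mulmxBl mul1mx D'D' subrr subr0. Qed.
Let EW : E *m gram D' = E.
Proof. by rewrite gramE mulmxDr E2 !mulmxA Ez' !mul0mx add0r. Qed.
Let WE : gram D' *m E = E.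
Proof. by rewrite gramE mulmxDl E2 -!mulmxA z'E0 !mulmx0 add0r. Qed.
Let EWi : E *m Wi = E. Proof. by rewrite -{1}EW WiE mulmxK. Qed.
Let WiEE : Wi *m E = E. Proof. by rewrite -{1}WE WiE mulKmx. Qed.
Let z'Mz' : z'^T *m M *m z' = gram D' - E. Proof. by rewrite gramE addrK. Qed.
Let z'u : z' *m u = 0. Proof. by rewrite z'E -mulmxA D'u mulmx0. Qed.
Let Eu : E *m u = u. Proof. by rewrite EE mulmxBl mul1mx D'u subr0. Qed.
Let zD : z *m D = x *m u^T + z'.
Proof. by rewrite z'E D'E xE mulmxBr mulmxA addrC subrK. Qed.

Lemma resid_sym : resid^T = resid.
Proof. by rewrite /resid /regr linearB/= !trmx_mul !trmxK Msym Wis !mulmxA. Qed.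

Let z'R : z'^T *m resid = 0.
Proof.
rewrite /resid mulmxBr.
have -> : z'^T *m (M *m z' *m regr) = (z'^T *m M *m z') *m regr by rewrite !mulmxA.
rewrite z'Mz' mulmxBl.
have -> : gram D' *m regr = z'^T *m M by rewrite /regr !mulmxA WiE mulmxV// mul1mx.
have -> : E *m regr = 0 by rewrite /regr !mulmxA EWi Ez' mul0mx.
by rewrite subr0 subrr.
Qed.

Let MR : M *m resid = resid.
Proof. by rewrite /resid mulmxBr Midem !mulmxA Midem. Qed.

Lemma resid_idem : resid *m resid = resid.
Proof.
rewrite {1}/resid mulmxBl MR.
have -> : M *m z' *m regr *m resid = M *m z' *m Wi *m (z'^T *m (M *m resid)) by rewrite /regr !mulmxA.
by rewrite MR z'R mulmx0 subr0.
Qed.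

(** By cyclicity the projection subtracted from [M] has the trace of
    [Wi *m (gram D' - E) = 1 - E = D'], which is [\tr D - 1]. *)
Lemma tr_resid : \tr resid = \tr M - \tr D + 1.
Proof.
rewrite /resid linearB/= -/(\tr _).
have -> : \tr (M *m z' *m regr) = \tr (Wi *m (z'^T *m M *m z')).
  by rewrite mxtrace_mulC /regr -!mulmxA (mulmxA M M) Midem.
rewrite z'Mz' mulmxBr {1}WiE mulVmx// WiEE D1 tr_step; ring.
Qed.

Variables (s : R) (b : 'cV[R]_p).
Hypotheses (sE : s = inner (resid *m x) (resid *m x)) (bE : b = regr *m x).

Let xRx : x^T *m (resid *m x) = s%:M.
Proof.
rewrite [LHS]mx11_scalar; congr (_%:M); rewrite sE -inner_proj ?resid_sym ?resid_idem//.
by rewrite innerE /mxtrace big_ord1.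
Qed.

Let Eb : E *m b = 0. Proof. by rewrite bE /regr !mulmxA EWi Ez' !mul0mx. Qed.
Let ub : u^T *m b = 0.
Proof.
have <- : u^T *m E = u^T by rewrite -[RHS]trmxK -[in RHS]Eu trmx_mul trmxK Es.
by rewrite -mulmxA Eb mulmx0.
Qed.

(** The normal equations in place of block inversion. The vector [z D (u - b)] is [x - z' b], which
    [M] sends to the residual of [x]; this is orthogonal to [z'] and has inner product [s] with [x].
    Hence the inverse of [gram D] maps [u] to [(u - b) / s]. *)
Lemma gram_mul_step : gram D *m (u - b) = s *: u.
Proof.
have zb : z *m D *m (u - b) = x - z' *m b.
  by rewrite zD mulmxDl !mulmxBr z'u -!mulmxA uu ub mulmx0 mulmx1 subr0 sub0r.
have Mzb : M *m (z *m D *m (u - b)) = resid *m x.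
  by rewrite zb mulmxBr bE /resid mulmxBl !mulmxA.
have -> : gram D *m (u - b) = (z *m D)^T *m (M *m (z *m D *m (u - b))) + (1%:M - D) *m (u - b).
  by rewrite /gram mulmxDl !mulmxA.
have DE : 1%:M - D = E - u *m u^T.
  by rewrite EE D'E opprB addrA addrAC addrK addrC.
have -> : (1%:M - D) *m (u - b) = 0.
  rewrite DE mulmxBl -mulmxA !mulmxBr Eu Eb uu ub.
  by rewrite mulmx1 mulmx0 subrr.
rewrite Mzb addr0.
rewrite zD linearD/= mulmxDl trmx_mul trmxK -mulmxA xRx mulmxA z'R mul0mx addr0.
by rewrite mul_mx_scalar.
Qed.

(** Pairing a kernel vector with [gram_mul_step] shows that it is orthogonal to [u]. It then lies in
    the range of [D'], where [gram D'] excludes it. *)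
Lemma gram_unit_of_step : s != 0 -> gram D \in unitmx.
Proof.
move=> s0; apply/(gram_unit pD) => v Dv Mzv.
have Wv : gram D *m v = 0 by apply/gram_ker.
have : v^T *m (gram D *m (u - b)) = 0.
  by rewrite mulmxA -[v^T *m _]trmxK trmx_mul trmxK gram_sym// Wv trmx0 mul0mx.
rewrite gram_mul_step -scalemxAr => /eqP; rewrite scaler_eq0 (negbTE s0)/= => /eqP vu.
have uv : u^T *m v = 0 by rewrite -[LHS]trmxK trmx_mul trmxK vu trmx0.
have D'v : D' *m v = v by rewrite D'E mulmxBl Dv -mulmxA uv mulmx0 subr0.
by have /(gram_unit proj_step) := W'u; apply.
Qed.

Hypothesis Wu : gram D \in unitmx.

Lemma step_neq0 : s != 0.
Proof.
apply/eqP => s0; have := gram_mul_step; rewrite s0 scale0r => /(congr1 (mulmx (invmx (gram D)))).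
rewrite mulKmx// mulmx0 => ub0.
have : u^T *m (u - b) = 0 by rewrite ub0 mulmx0.
rewrite mulmxBr uu ub subr0 => /matrixP/(_ 0 0); rewrite !mxE eqxx => /eqP.
by rewrite oner_eq0.
Qed.

Lemma inv_gram_step : invmx (gram D) *m u = s^-1 *: (u - b).
Proof.
apply: (can_inj (mulKmx Wu)); rewrite mulKVmx// -scalemxAr gram_mul_step scalerA mulVf ?step_neq0// scale1r //.
Qed.

Lemma inner_inv_gram_step : inner u (invmx (gram D) *m u) = s^-1.
Proof.
rewrite inv_gram_step innerZr innerDr u1; have -> : inner u (- b) = 0 by rewrite innerNr innerE ub mxtrace0 oppr0.
by rewrite addr0 mulr1.
Qed.

(** Pythagoras: [b] is orthogonal to [u]. *)
Lemma inner_inv_gram_step2 : inner (invmx (gram D) *m u) (invmx (gram D) *m u) = (1 + inner b b) / s ^+ 2.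
Proof.
have iub : inner u b = 0 by rewrite innerE ub mxtrace0.
rewrite inv_gram_step innerZr innerZl innerDr !innerDl !innerNr !innerNl iub (innerC b u) iub u1.
by field; exact: step_neq0.
Qed.

(** This closes the circle for the duality: since [regr regr^T = Wi - E], the dual quadratic form is
    an inverse moment of [gram D'] in the direction [D' g], of the kind already under control. *)
Lemma inner_regr_tr (g : 'cV[R]_p) :
  inner (regr^T *m g) (regr^T *m g) = inner (D' *m g) (Wi *m (D' *m g)).
Proof.
have H : regr *m regr^T = Wi - E.
  rewrite /regr !trmx_mul trmxK Msym Wis.
  have -> : Wi *m z'^T *m M *m (M *m (z' *m Wi)) = Wi *m (z'^T *m M *m z') *m Wi.
    by rewrite !mulmxA -(mulmxA _ M M) Midem.
  by rewrite z'Mz' mulmxBr mulmxBl {1}WiE mulVmx// mul1mx WiEE EWi.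
rewrite (inner_mull regr^T) trmxK mulmxA H [RHS]innerC [RHS](inner_mull D') D's !mulmxA.
congr (inner (_ *m g) g).
by rewrite -D1 mulmxBl mul1mx EWi !mulmxBr mulmx1 !mulmxBl WiEE E2 subrr subr0.
Qed.

End rank_one_step.
End gram_schur.

(** * Concentration of the residual *)

Section measurable_sets.
Context (R : realType) d (T : measurableType d).

Lemma measurable_preim (f : T -> R) (A : set R) : measurable_fun setT f -> measurable A ->
  measurable [set w | A (f w)].
Proof. by move=> mf mA; rewrite -[X in measurable X]setTI; exact: mf. Qed.

Lemma measurable_ge_set (f : T -> R) c : measurable_fun setT f -> measurable [set w | c <= f w].
Proof.
move=> mf; rewrite (_ : [set w | _] = [set w | `[c, +oo[%classic (f w)]); first exact: measurable_preim.
by apply/seteqP; split => w /=; rewrite in_itv/= andbT.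
Qed.

Lemma measurable_dist_ge (f : T -> R) a c : measurable_fun setT f ->
  measurable [set w | c <= `|f w - a|].
Proof.
by move=> mf; apply: measurable_ge_set; apply: measurableT_comp => //; exact: measurable_funB.
Qed.

Lemma measurable_inner_fun m k (f g : T -> 'M[R]_(m, k)) : mfmx f -> mfmx g ->
  measurable_fun setT (fun w => inner (f w) (g w)).
Proof. by move=> mf mg; apply: measurable_sum => i; apply: measurable_sum => j; exact: measurable_funM. Qed.

Lemma mfmx_gram n p (M : 'M[R]_n) (f : T -> 'M[R]_(n, p)) (D : 'M[R]_p) : mfmx f ->
  mfmx (fun w => gram M (f w) D).
Proof.
move=> mf; have mD : mfmx (fun w => f w *m D) by apply: mfmxM => //; exact: mfmx_cst.
apply: mfmxD; last exact: mfmx_cst.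
apply: mfmxM => //; apply: mfmxM; last exact: mfmx_cst.
exact: mfmx_tr.
Qed.
End measurable_sets.

Section product_bound.
Context (R : realType) d (T : measurableType d) (P : probability T R).
Context d' (T' : measurableType d') (P' : probability T' R).

Lemma prod_measure_le_except (E : set (T * T')) (B : set T) (q r : R) :
  measurable E -> measurable B -> (P B <= q%:E)%E ->
  (forall x : T, ~ B x -> P' [set y | E (x, y)] <= r%:E)%E -> (0 <= r)%R ->
  ((P \x P') E <= (q + r)%:E)%E.
Proof.
move=> mE mB Bq Er r0.
have mBT : measurable (B `*` [set: T']) by exact: measurableX.
apply: (@le_trans _ _ ((P \x P')%E (B `*` setT) + (P \x P')%E (E `\` (B `*` setT)))%E).
  apply: (@le_trans _ _ ((P \x P')%E ((B `*` setT) `|` (E `\` (B `*` setT))))).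
    apply: le_measure; rewrite ?inE//; first by apply: measurableU => //; exact: measurableD.
    by move=> x Ex; have [Bx|Bx] := pselect ((B `*` [set: T']) x); [left|right; split].
  by apply: measureU2 => //; exact: measurableD.
rewrite EFinD leeD//.
  by rewrite product_measure1E// [X in (_ * X)%E]probability_setT mule1.
apply: prod_measure_le; first exact: measurableD.
move=> x; have [Bx|nBx] := pselect (B x).
  rewrite (_ : [set y | _] = set0) ?measure0 ?lee_fin//.
  by apply/seteqP; split => y //= [_ []]; split.
rewrite (_ : [set y | _] = [set y | E (x, y)]); first exact: Er.
by apply/seteqP; split => y /=; [case|move=> Exy; split => // -[]].
Qed.
End product_bound.

Lemma inner_proj_split (R : realType) n p (t : 'M[R]_(n, p)) (Q : 'M[R]_p) : proj Q ->
  inner (t *m (1%:M - Q)) (t *m (1%:M - Q)) + inner (t *m Q) (t *m Q) = inner t t.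
Proof.
move=> [Qs QQ].
have E1 : (1%:M - Q)^T = 1%:M - Q by rewrite linearB/= trmx1 Qs.
have E2 : (1%:M - Q) *m (1%:M - Q) = 1%:M - Q.
  by rewrite mulmxBl mul1mx mulmxBr mulmx1 QQ subrr subr0.
rewrite !inner_mulr E1 Qs -!mulmxA E2 QQ -innerDl; congr inner.
by rewrite -mulmxDr subrK mulmx1.
Qed.

Section resampling.
Variable R : realType.
Context d (T : measurableType d) (P : probability T R).
Variables (n p : nat) (z : T -> 'M[R]_(n, p)).
Hypothesis gz : gaussmx P z.
Let mz : mfmx z. Proof. by case: gz. Qed.
Let mz1 : mfmx (fun w : T * T => z w.1). Proof. exact: (mfmx_comp (g := fst)). Qed.
Let mz2 : mfmx (fun w : T * T => z w.2). Proof. exact: (mfmx_comp (g := snd)). Qed.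

(** Replacing the component along [Q] by an independent copy keeps the law. On the right this frees
    the column [z u] from the others; on the left, in [resample_left], it frees [M z] from the class
    means. *)
Lemma resample_right (Q : 'M[R]_p) : proj Q ->
  gaussmx (P \x P)%E (fun w => z w.1 *m (1%:M - Q) + z w.2 *m Q).
Proof.
move=> pQ; have [Qs QQ] := pQ.
apply: (@gauss_mix _ _ _ P _ _ P _ _ _ _ _ _ z z (fun A B => A *m (1%:M - Q) + B *m Q)
  (fun t => t *m (1%:M - Q)) (fun t => t *m Q)) => //.
- by move=> t A B; rewrite innerDr !inner_mulr Qs linearB/= trmx1 Qs.
- by move=> t; exact: inner_proj_split.
- by apply: mfmxD; apply: mfmxM => //; exact: mfmx_cst.
Qed.

Lemma resample_left (Q : 'M[R]_n) : proj Q ->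
  gaussmx (P \x P)%E (fun w => (1%:M - Q) *m z w.1 + Q *m z w.2).
Proof.
move=> pQ; have [Qs QQ] := pQ.
apply: (@gauss_mix _ _ _ P _ _ P _ _ _ _ _ _ z z (fun A B => (1%:M - Q) *m A + Q *m B)
  (fun t => (1%:M - Q) *m t) (fun t => Q *m t)) => //.
- by move=> t A B; rewrite innerDr !inner_mull Qs linearB/= trmx1 Qs.
- move=> t; rewrite -[RHS]/(inner t t).
  have tr a b (A B : 'M[R]_(a, b)) : inner A^T B^T = inner A B by rewrite !innerE trmxK mxtrace_mulC -mxtrace_tr trmx_mul trmxK.
  rewrite -(tr _ _ t) -(inner_proj_split t^T pQ) -[X in X + _]tr -[X in _ + X]tr.
  by rewrite !trmx_mul Qs linearB/= trmx1 Qs.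
- by apply: mfmxD; apply: mfmxM => //; exact: mfmx_cst.
Qed.

Lemma gauss_mulr (u : 'cV[R]_p) : inner u u = 1 -> gaussmx P (fun w => z w *m u).
Proof.
move=> u1; apply: (@gauss_lin _ _ _ P _ _ _ _ z (fun A => A *m u) (fun t => t *m u^T)) => //.
- by move=> t A; rewrite inner_mulr.
- move=> t; rewrite inner_mulr trmxK -mulmxA.
  have -> : u^T *m u = 1%:M by rewrite tr_mul_inner u1.
  by rewrite mulmx1.
- by apply: mfmxM => //; exact: mfmx_cst.
Qed.

Lemma gauss_tr_mul (e : 'cV[R]_n) : inner e e = 1 -> gaussmx P (fun w => (z w)^T *m e).
Proof.
move=> e1; apply: (@gauss_lin _ _ _ P _ _ _ _ z (fun A => A^T *m e) (fun t => e *m t^T)) => //.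
- move=> t A; rewrite !innerE trmx_mul trmxK -mulmxA.
  by rewrite -[LHS]mxtrace_tr !trmx_mul !trmxK mxtrace_mulC.
- move=> t; rewrite !innerE trmx_mul trmxK -mulmxA (mulmxA e^T).
  have -> : e^T *m e = 1%:M by rewrite tr_mul_inner e1.
  by rewrite mul1mx mxtrace_mulC.
- by apply: mfmxM; [exact: mfmx_tr|exact: mfmx_cst].
Qed.

End resampling.

Section gram_law.
Variable R : realType.
Context d (T : measurableType d) (P : probability T R).
Variables (n p : nat) (z : T -> 'M[R]_(n, p)).
Hypothesis gz : gaussmx P z.
Let mz : mfmx z. Proof. by case: gz. Qed.
Variable M : 'M[R]_n.
Hypothesis pM : proj M.

Section step.
Variables (D : 'M[R]_p) (u : 'cV[R]_p).
Hypotheses (pD : proj D) (Du : D *m u = u) (u1 : inner u u = 1).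
Let D' := D - u *m u^T.
Let Q := u *m u^T.

Let uu : u^T *m u = 1%:M.
Proof. by rewrite tr_mul_inner u1. Qed.
Let pQ : proj Q.
Proof. by split; [rewrite /Q trmx_mul trmxK|rewrite /Q mulmxA -(mulmxA u) uu mulmx1]. Qed.

(** The column in the direction [u] comes from the second sample and everything orthogonal to [u]
    from the first. Fixing [w.1] therefore fixes the regressors and leaves a standard Gaussian
    response. *)
Definition zmix (w : T * T) := z w.1 *m (1%:M - Q) + z w.2 *m Q.

Lemma gauss_zmix : gaussmx (P \x P)%E zmix. Proof. exact: resample_right. Qed.

Lemma zmix_u w : zmix w *m u = z w.2 *m u.
Proof. by rewrite /zmix mulmxDl -!mulmxA mulmxBl mul1mx -mulmxA uu mulmx1 subrr mulmx0 add0r. Qed.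

Lemma zmix_D' w : zmix w *m D' = z w.1 *m D'.
Proof.
have uD' : u^T *m D' = 0.
  by rewrite /D' mulmxBr mulmxA uu mul1mx -{1}Du trmx_mul (pD.1) -mulmxA pD.2 -[in X in _ - X]Du trmx_mul pD.1 subrr.
by rewrite /zmix mulmxDl -!mulmxA uD' !mulmx0 addr0 mulmxBl mul1mx -mulmxA uD' mulmx0 subr0.
Qed.

Lemma gram_zmix_D' w : gram M (zmix w) D' = gram M (z w.1) D'.
Proof. by rewrite /gram zmix_D'. Qed.

Definition residual (w : T) := resid M (invmx (gram M (z w) D')) (z w *m D').
Definition regression (w : T) := regr M (invmx (gram M (z w) D')) (z w *m D').

Let residualE w : residual w.1 = resid M (invmx (gram M (zmix w) D')) (zmix w *m D').
Proof. by rewrite gram_zmix_D' zmix_D'. Qed.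
Let regressionE w : regression w.1 = regr M (invmx (gram M (zmix w) D')) (zmix w *m D').
Proof. by rewrite gram_zmix_D' zmix_D'. Qed.

Let Ms := pM.1.
Let MM := pM.2.

Lemma proj_residual w : gram M (z w) D' \in unitmx -> proj (residual w).
Proof.
move=> Wu; split.
- by apply: (@resid_sym _ _ _ M _ (z w) D D' u).
- by apply: (@resid_idem _ _ _ M _ (z w) D D' (1%:M - D') u).
Qed.

Lemma tr_residual w : gram M (z w) D' \in unitmx -> \tr (residual w) = \tr M - \tr D + 1.
Proof. by move=> Wu; apply: (@tr_resid _ _ _ M _ (z w) D D' (1%:M - D') u). Qed.

Section mixed.
Variable w : T * T.
Let x := z w.2 *m u.
Let s := inner (residual w.1 *m x) (residual w.1 *m x).
Let b := regression w.1 *m x.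
Hypothesis Wu : gram M (zmix w) D \in unitmx.

Lemma zmix_unit_step : gram M (z w.1) D' \in unitmx.
Proof. by rewrite -gram_zmix_D'; exact: (gram_unit_step pM.1 pM.2 pD Du u1 erefl Wu). Qed.

Let W'u : gram M (zmix w) D' \in unitmx. Proof. by rewrite gram_zmix_D' zmix_unit_step. Qed.
Let sE : s = inner (resid M (invmx (gram M (zmix w) D')) (zmix w *m D') *m (zmix w *m u))
   (resid M (invmx (gram M (zmix w) D')) (zmix w *m D') *m (zmix w *m u)).
Proof. by rewrite /s residualE zmix_u. Qed.
Let bE : b = regr M (invmx (gram M (zmix w) D')) (zmix w *m D') *m (zmix w *m u).
Proof. by rewrite /b regressionE zmix_u. Qed.

Lemma zmix_inner : inner u (invmx (gram M (zmix w) D) *m u) = s^-1.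
Proof. by rewrite (inner_inv_gram_step pM.1 pM.2 pD Du u1 erefl erefl W'u erefl erefl erefl sE bE Wu). Qed.

Lemma zmix_inner2 :
  inner (invmx (gram M (zmix w) D) *m u) (invmx (gram M (zmix w) D) *m u) = (1 + inner b b) / s ^+ 2.
Proof. by rewrite (inner_inv_gram_step2 pM.1 pM.2 pD Du u1 erefl erefl W'u erefl erefl erefl sE bE Wu). Qed.
End mixed.

Lemma zmix_unit w : gram M (z w.1) D' \in unitmx -> residual w.1 *m (z w.2 *m u) != 0 ->
  gram M (zmix w) D \in unitmx.
Proof.
move=> W'u; rewrite -inner_eq0 => s0.
have W'u2 : gram M (zmix w) D' \in unitmx by rewrite gram_zmix_D'.
apply: (gram_unit_of_step pM.1 pM.2 pD Du u1 erefl erefl W'u2 erefl erefl erefl erefl erefl).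
by rewrite -residualE zmix_u.
Qed.

Lemma mfmx_zmix : mfmx zmix. Proof. by case: gauss_zmix. Qed.

Lemma mfmx_zmix2 w1 : mfmx (fun w2 => zmix (w1, w2)).
Proof.
apply: mfmxD; apply: mfmxM; [exact: (mfmx_cst (z w1))|exact: mfmx_cst|exact: mz|exact: mfmx_cst].
Qed.

Lemma zmix_law (A : set 'M[R]_(n, p)) : measurable (A : set (mxT R n p)) ->
  P [set w | A (z w)] = (P \x P)%E [set w | A (zmix w)] /\ measurable [set w | A (zmix w)].
Proof.
move=> mA; split; first by apply: (gauss_law (A := A)) => //; exact: gauss_zmix.
by rewrite -[X in measurable X]setTI; apply: (measurable_mx mfmx_zmix).
Qed.

(** Given the first sample, the inverse of [u^T W^-1 u] is the squared length of a Gaussian vector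
    projected onto a space of dimension [a], with variance [2 a]. Chebyshev's inequality at distance
    [eps * a] gives [2 / (a * eps ^+ 2)]. *)
Lemma gram_step_conc (eps a : R) : a = \tr M - \tr D + 1 -> 0 < a -> 0 < eps ->
  (P [set w | gram M (z w) D \in unitmx /\
      (eps * a <= `|(inner u (invmx (gram M (z w) D) *m u))^-1 - a|)%R] <= (2 / (a * eps ^+ 2))%:E)%E.
Proof.
move=> aE a0 e0.
pose A := [set N : 'M[R]_(n, p) | gram M N D \in unitmx /\ eps * a <= `|(inner u (invmx (gram M N D) *m u))^-1 - a|].
have mN : mfmx (fun N : mxT R n p => gram M N D) by apply: mfmx_gram; exact: mfmx_id.
have mA : measurable (A : set (mxT R n p)).
  apply: measurableI; first exact: measurable_unitmx.
  apply: measurable_dist_ge; apply: measurableT_comp; first exact: measurable_inv.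
  by apply: measurable_inner; apply: mfmxM; [exact: mfmx_inv|exact: mfmx_cst].
have [-> mE] := zmix_law mA.
apply: prod_measure_le => // w1.
have [W'u|W'u] := boolP (gram M (z w1) D' \in unitmx); last first.
  rewrite (_ : [set y | _] = set0) ?measure0 ?lee_fin ?divr_ge0 ?mulr_ge0 ?sqr_ge0 ?ltW//.
  apply/seteqP; split => // w2 [/= Wu _].
  by move: W'u; rewrite (@zmix_unit_step (w1, w2)).
have [Rs RR] := proj_residual W'u.
have ga := gauss_mulr gz u1.
apply: (@le_trans _ _ (P [set w2 | eps * a <= `|inner (residual w1 *m (z w2 *m u)) (residual w1 *m (z w2 *m u)) - \tr (residual w1)|])).
  apply: le_measure; rewrite ?inE.
  - rewrite -[X in measurable X]setTI; exact: (measurable_mx (mfmx_zmix2 w1)).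
  - apply: measurable_dist_ge; apply: measurable_inner2; by case: ga.
  by move=> w2 [/= Wu]; rewrite tr_residual// -aE (@zmix_inner (w1, w2))// invrK.
apply: le_trans (gauss_proj_chebyshev ga Rs RR _) _; first by rewrite mulr_gt0.
rewrite tr_residual// -aE lee_fin le_eqVlt; apply/orP; left; apply/eqP; field.
by rewrite !gt_eqF.
Qed.

(** A projection of positive trace has a nonzero row. The corresponding linear form of the Gaussian
    column is almost surely nonzero, hence so is the residual, and [zmix_unit] applies. *)
Lemma gram_step_singular : 0 < \tr M - \tr D + 1 ->
  (P [set w | gram M (z w) D' \notin unitmx] = 0 -> P [set w | gram M (z w) D \notin unitmx] = 0)%E.
Proof.
move=> a0 P0.
pose A := [set N : 'M[R]_(n, p) | gram M N D \notin unitmx].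
have mN D0 : mfmx (fun N : mxT R n p => gram M N D0) by apply: mfmx_gram; exact: mfmx_id.
have mA0 D0 : measurable ([set N : mxT R n p | gram M N D0 \notin unitmx]).
  rewrite (_ : [set N | _] = ~` [set N : mxT R n p | gram M N D0 \in unitmx]); last first.
    by apply/seteqP; split => N /= /negP.
  by apply: measurableC; exact: measurable_unitmx.
have mA : measurable (A : set (mxT R n p)) by exact: mA0.
have [-> mE] := zmix_law mA.
have mB : measurable [set w | gram M (z w) D' \notin unitmx].
  by rewrite -[X in measurable X]setTI; exact: (measurable_mx mz measurableT (mA0 _)).
apply/eqP; rewrite eq_le measure_ge0 andbT -[X in (_ <= X)%E]/((0 : R)%:E) -[X in X%:E]addr0.
apply: (prod_measure_le_except mE mB) => //; first by rewrite P0.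
move=> w1 /= /negP; rewrite negbK => W'u.
have [Rs RR] := proj_residual W'u.
have ga := gauss_mulr gz u1.
have R0 : residual w1 != 0.
  apply: contraTneq a0 => R0; rewrite -(tr_residual W'u) R0 mxtrace0 ltxx//.
have [i [j Rij]] : exists i j, residual w1 i j != 0.
  apply: contrapT => h; case/eqP: R0; apply/matrixP => i j; rewrite [RHS]mxE; apply: contrapT => ne.
  by apply: h; exists i, j; apply/eqP.
have t0 : (row i (residual w1))^T != 0.
  by apply: contraNneq Rij => /matrixP/(_ j 0); rewrite !mxE => ->.
rewrite -[X in (_ <= X)%E](gauss_neq0 ga t0); apply: le_measure; rewrite ?inE.
- rewrite -[X in measurable X]setTI; exact: (measurable_mx (mfmx_zmix2 w1)).
- apply: (measurable_preim (A := [set 0])) => //; apply: measurable_inner; by case: ga.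
- move=> w2 /= /negP nW; apply: contrapT => ne; apply: nW.
  apply: (@zmix_unit (w1, w2)) => //=; apply: contra_notN ne => /eqP R0'.
  have := congr1 (fun v : 'cV_n => v i 0) R0'; rewrite !mxE => <-.
  by rewrite /inner; apply: eq_bigr => k _; rewrite big_ord1 !mxE.
Qed.

End step.

Lemma gram0_unit N : gram M N (0 : 'M[R]_p) \in unitmx.
Proof. by rewrite /gram mulmx0 trmx0 !mul0mx add0r subr0 unitmx1. Qed.

Lemma proj_pid j : proj (pid_mx j : 'M[R]_p).
Proof. by split; [rewrite tr_pid_mx|rewrite mul_pid_mx minnn -[in RHS]pid_mx_minv]. Qed.

Lemma pid_mx_step j (jp : (j < p)%N) (u : 'cV[R]_p := delta_mx (Ordinal jp) 0) :
  [/\ inner u u = 1, pid_mx j.+1 *m u = u & pid_mx j = pid_mx j.+1 - u *m u^T :> 'M[R]_p].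
Proof.
have uE : u = delta_mx (Ordinal jp) 0 by [].
split.
- by rewrite uE inner_delta mxE !eqxx.
- apply/matrixP => i k; rewrite uE mxE (bigD1 (Ordinal jp))//= big1 => [|l lj].
    rewrite !mxE !eqxx (ord1 k) /= addr0 mulr1 -val_eqE/= andbT.
    by case: eqP => // ->; rewrite ltnSn.
  by rewrite !mxE (negbTE lj) mulr0.
- apply/matrixP => i k; rewrite uE !mxE big_ord1 !mxE -!val_eqE/= !andbT.
  rewrite -natrM mulnb; have [ik|ik] := eqVneq (nat_of_ord i) (nat_of_ord k).
    rewrite -(val_inj ik) andbb ltnS [(i <= j)%N]leq_eqVlt andTb andTb.
    by case: (ltngtP i j) => _ /=; rewrite ?subr0 ?subrr.
  rewrite !andFb sub0r; case: eqP => [ij|]; last by rewrite oppr0.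
  by case: eqP => [kj|]; rewrite ?oppr0//; move: ik; rewrite ij kj eqxx.
Qed.

Lemma mxtrace_pid j : (j <= p)%N -> \tr (pid_mx j : 'M[R]_p) = j%:R.
Proof.
elim: j => [|j IH] jp.
  by rewrite /mxtrace big1// => i _; rewrite mxE andbF.
have [u1 _ E] := pid_mx_step jp.
have /eqP := IH (ltnW jp); rewrite E raddfB/= mxtrace_mulC -innerE u1 subr_eq natr1.
by move=> /eqP.
Qed.

(** The columns enter one at a time. On adding column [j + 1] the residual still has dimension
    [\tr M - j], positive as long as [j + 1 <= \tr M]. *)
Lemma gram_pid_singular j : (j <= p)%N -> (j%:R <= \tr M) ->
  P [set w | gram M (z w) (pid_mx j) \notin unitmx] = 0%E.
Proof.
elim: j => [|j IH] jp jN.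
  rewrite (_ : [set w | _] = set0) ?measure0//.
  apply/seteqP; split => w //=; rewrite (_ : pid_mx 0 = 0); last by apply/matrixP => i k; rewrite !mxE andbF.
  by rewrite gram0_unit.
have [u1 Du DD] := pid_mx_step jp.
apply: (gram_step_singular (proj_pid j.+1) Du u1).
  by rewrite mxtrace_pid// ltr_pwDr// subr_ge0.
by rewrite -DD; apply: IH; [exact: ltnW|rewrite (le_trans _ jN)// ler_nat].
Qed.

Lemma gram1_singular : p%:R <= \tr M -> P [set w | gram M (z w) 1%:M \notin unitmx] = 0%E.
Proof. by move=> pN; rewrite -pid_mx_1; exact: gram_pid_singular. Qed.

End gram_law.

(** * Concentration of the regression coefficients *)

Lemma sqr_le_norm (R : realType) (a b : R) : `|a| <= b -> a ^+ 2 <= b ^+ 2.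
Proof.
by move=> ab; rewrite -[leLHS]real_normK ?num_real// lerXn2r// ?nnegrE// (le_trans _ ab).
Qed.

(** The least distance between [expR (- x / 2)] and [expR (- c / 2)] when [x] is at distance at
    least [e] from [c]. *)
Definition laplace_gap (R : realType) (c e : R) := expR (- c / 2) * (1 - expR (- e / 2)).

Section laplace_concentration.
Context (R : realType) d (T : measurableType d) (P : probability T R).

Lemma prob_le_Rintegral (E : set T) (f : T -> R) C k : measurable E -> measurable_fun setT f ->
  (forall w, `|f w| <= C) -> (forall w, 0 <= f w) -> (forall w, E w -> k <= f w) -> 0 < k ->
  (P E <= (\int[P]_w f w / k)%:E)%E.
Proof.
move=> mE mf fC f0 kf k0.
have intf : P.-integrable setT (EFin \o f) by exact: bounded_integrable fC.
rewrite EFinM fineK; last exact: integrable_fin_num.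
rewrite muleC -[k^-1]invrK lee_pdivlMl ?invr_gt0// invrK.
rewrite -[X in P X]setIT -integral_indic// -ge0_integralZl//; last 2 first.
- exact/measurable_EFinP/measurable_indic.
- by rewrite lee_fin ltW.
apply: ge0_le_integral => //.
- by move=> w _; rewrite -EFinM lee_fin mulr_ge0// ltW.
- by apply: measurable_funeM; exact/measurable_EFinP/measurable_indic.
- exact/measurable_EFinP.
move=> w _; rewrite -EFinM lee_fin indicE; case: (boolP (w \in _)) => [|_]; last by rewrite mulr0.
by rewrite inE/= mulr1; exact: kf.
Qed.

Lemma Rintegral_le_prob (E : set T) (f : T -> R) (e q : R) : measurable E -> measurable_fun setT f ->
  (forall w, `|f w| <= 1) -> (forall w, ~ E w -> f w <= e) -> 0 <= e -> (P E <= q%:E)%E ->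
  \int[P]_w f w <= e + q.
Proof.
move=> mE mf f1 fe e0 Eq.
have PE : P E \is a fin_num by rewrite ge0_fin_numE ?measure_ge0// (le_lt_trans Eq) ?ltry.
have i1 : P.-integrable setT (EFin \o cst e) by apply: (@bounded_integrable _ _ _ _ _ `|e|).
have mI : measurable_fun setT (\1_E : T -> R) by exact: measurable_indic.
have i2 : P.-integrable setT (EFin \o (\1_E : T -> R)).
  by apply: (@bounded_integrable _ _ _ _ _ 1) => // w; rewrite indicE; case: (_ \in _); rewrite ?normr1 ?normr0.
have -> : e + q = e + (q - fine (P E)) + \int[P]_w (\1_E w : R).
  by rewrite /Rintegral integral_indic// setIT; ring.
have -> : e = \int[P]_w (cst e w) by rewrite /Rintegral prob_integral_cst.
rewrite addrAC -RintegralD// -[X in X <= _]addr0; apply: lerD; last by rewrite subr_ge0 -lee_fin fineK.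
apply: le_Rintegral => //.
- exact: bounded_integrable f1.
- by apply: (@bounded_integrable _ _ _ _ _ (e + 1)) => [|w]; [exact: measurable_funD|
    rewrite (le_trans (ler_normD _ _))// lerD ?(ger0_norm e0)// indicE; case: (_ \in _); rewrite ?normr1 ?normr0].
move=> w _; rewrite /= indicE; case: (boolP (w \in E)) => [_|]; last by rewrite notin_setE => /fe h; rewrite addr0.
by rewrite (le_trans (ler_norm _))// (le_trans (f1 w))// lerDr.
Qed.

Variables (B r : T -> R).
Hypotheses (mB : measurable_fun setT B) (mr : measurable_fun setT r).
Hypotheses (B0 : forall w, 0 <= B w) (r0 : forall w, 0 <= r w).
Hypothesis E1 : \int[P]_w expR (- B w / 2) = \int[P]_w expR (- r w / 2).
Hypothesis E2 : \int[P]_w expR (- B w) = \int[P]_w expR (- r w).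

Lemma expR_half_dist (x y : R) : 0 <= x -> 0 <= y -> `|expR (- x / 2) - expR (- y / 2)| <= `|x - y|.
Proof.
wlog xy : x y / x <= y => [hw x0 y0|x0 y0].
  have [xy|/ltW yx] := leP x y; first exact: hw.
  by rewrite distrC [leRHS]distrC; exact: hw.
have e1 : expR (- x / 2) <= 1 by rewrite expR_le1; lra.
have e2 : expR (- y / 2) = expR (- x / 2) * expR (- (y - x) / 2) by rewrite -expRD; congr expR; lra.
have e3 := expR_ge1Dx (- (y - x) / 2).
have e4 := expR_gt0 (- x / 2).
have e5 : expR (- y / 2) <= expR (- x / 2) by rewrite ler_expR; lra.
rewrite [leRHS]distrC !ger0_norm ?subr_ge0//.
have e6 : expR (- (y - x) / 2) <= 1 by rewrite expR_le1; lra.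
apply: (@le_trans _ _ (1 - expR (- (y - x) / 2))); last lra.
by rewrite e2 -{1}[expR (- x / 2)]mulr1 -mulrBr ler_piMl// subr_ge0.
Qed.

Lemma laplace_gap_gt0 (c e : R) : 0 < e -> 0 < laplace_gap c e.
Proof. by move=> e0; rewrite mulr_gt0 ?expR_gt0// subr_gt0 expR_lt1; lra. Qed.

(** The exponential is decreasing and convex, so the smaller gap lies above [c], at [x = c + e].
    Below [c] the gap exceeds it because [expR (e / 2) + expR (- e / 2) >= 2]. *)
Lemma expR_half_far (c e x : R) : 0 < e -> e <= `|x - c| -> laplace_gap c e <= `|expR (- x / 2) - expR (- c / 2)|.
Proof.
move=> e0; have c0 := expR_gt0 (- c / 2); have e1 : expR (- e / 2) < 1 by rewrite expR_lt1; lra.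
have ee : expR (- e / 2) * expR (e / 2) = 1 by rewrite -expRD (_ : _ + _ = 0) ?expR0//; lra.
have e2 := expR_gt0 (- e / 2).
rewrite /laplace_gap ler_normr => /orP[h|h].
  have : expR (- x / 2) <= expR (- c / 2) * expR (- e / 2) by rewrite -expRD ler_expR; lra.
  by move=> h2; rewrite ler_normr; apply/orP; right; nra.
have : expR (- c / 2) * expR (e / 2) <= expR (- x / 2) by rewrite -expRD ler_expR; lra.
move=> h2; rewrite ler_normr; apply/orP; left.
have h3 : 2 - expR (- e / 2) <= expR (e / 2).
  have : 0 <= (1 - expR (- e / 2)) ^+ 2 * expR (e / 2) by rewrite mulr_ge0 ?sqr_ge0 ?expR_ge0.
  have -> : (1 - expR (- e / 2)) ^+ 2 * expR (e / 2) =
    expR (e / 2) - 2 * (expR (- e / 2) * expR (e / 2)) + expR (- e / 2) * (expR (- e / 2) * expR (e / 2)) by ring.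
  rewrite ee; lra.
apply: le_trans (lerB h2 (lexx _)); rewrite -{3}[expR (- c / 2)]mulr1 -mulrBr ler_wpM2l//; lra.
Qed.

(* Equality of the Laplace transforms at 1/2 and 1 means that [expR (- B / 2)] and [expR (- r / 2)]
   have the same mean square distance to any constant. *)
Lemma laplace_conc (c eta e q : R) : 0 <= c -> 0 < e -> 0 <= eta ->
  (P [set w | (eta <= `|r w - c|)%R] <= q%:E)%E ->
  (P [set w | (e <= `|B w - c|)%R] <= ((eta ^+ 2 + q) / laplace_gap c e ^+ 2)%:E)%E.
Proof.
move=> c0 e0 eta0 hq.
pose k := expR (- c / 2).
have k0 : 0 < k by exact: expR_gt0.
have k1 : k <= 1 by rewrite expR_le1; lra.
have mex (f : T -> R) : measurable_fun setT f -> measurable_fun setT (fun w => expR (f w)).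
  by move=> mf; exact: (measurableT_comp (f := @expR R)).
have mh (f : T -> R) : measurable_fun setT f -> measurable_fun setT (fun w => - f w / 2).
  by move=> mf; apply: measurable_funM => //; exact: measurableT_comp.
have mV (f : T -> R) : measurable_fun setT f -> measurable_fun setT (fun w => (expR (- f w / 2) - k) ^+ 2).
  by move=> mf; apply: measurable_funX; apply: measurable_funB => //; exact/mex/mh.
have V1 (f : T -> R) : (forall w, 0 <= f w) -> forall w, `|(expR (- f w / 2) - k) ^+ 2| <= 1.
  move=> f0 w; rewrite ger0_norm ?sqr_ge0//.
  have : expR (- f w / 2) <= 1 by rewrite expR_le1; have := f0 w; lra.
  have := expR_gt0 (- f w / 2); nra.
have EV (f : T -> R) : measurable_fun setT f -> (forall w, 0 <= f w) ->
    \int[P]_w (expR (- f w / 2) - k) ^+ 2 = \int[P]_w expR (- f w) - 2 * k * \int[P]_w expR (- f w / 2) + k ^+ 2.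
  move=> mf f0.
  have i1 : P.-integrable setT (EFin \o (fun w => expR (- f w))).
    apply: (@bounded_integrable _ _ _ _ _ 1) => [|w]; first by apply: mex; exact: measurableT_comp.
    by rewrite ger0_norm ?expR_ge0// expR_le1 oppr_le0.
  have i2 : P.-integrable setT (EFin \o (fun w => expR (- f w / 2))).
    apply: (@bounded_integrable _ _ _ _ _ 1) => [|w]; first exact/mex/mh.
    by rewrite ger0_norm ?expR_ge0// expR_le1; have := f0 w; lra.
  have i3 : P.-integrable setT (EFin \o (fun w => (- 2 * k) * expR (- f w / 2))).
    apply: (@bounded_integrable _ _ _ _ _ (`|- 2 * k| * 1)) => [|w]; first by apply: measurable_funM => //; exact/mex/mh.
    by rewrite normrM ler_wpM2l// ger0_norm ?expR_ge0// expR_le1; have := f0 w; lra.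
  have i4 : P.-integrable setT (EFin \o cst (k ^+ 2)) by apply: (@bounded_integrable _ _ _ _ _ `|k ^+ 2|).
  have -> : k ^+ 2 = \int[P]_w (cst (k ^+ 2) w) by rewrite /Rintegral prob_integral_cst.
  rewrite -!mulNr -(RintegralZl (- 2 * k) measurableT i2) -(RintegralD measurableT i1 i3).
  rewrite -(RintegralD measurableT (integrableD measurableT i1 i3) i4).
  apply: eq_Rintegral => w _ /=.
  have -> : expR (- f w) = expR (- f w / 2) ^+ 2 by rewrite expr2 -expRD; congr expR; lra.
  ring.
apply: le_trans (prob_le_Rintegral (k := laplace_gap c e ^+ 2) (measurable_dist_ge _ _ mB) (mV _ mB) (V1 _ B0) _ _ _) _.
- by move=> w; exact: sqr_ge0.
- by move=> w /= h; apply: sqr_ge_norm; [exact/ltW/laplace_gap_gt0|exact: expR_half_far].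
- by rewrite exprn_gt0// laplace_gap_gt0.
rewrite lee_fin ler_wpM2r ?invr_ge0 ?sqr_ge0//.
rewrite (EV _ mB B0) E1 E2 -(EV _ mr r0).
apply: (Rintegral_le_prob (measurable_dist_ge _ _ mr) (mV _ mr) (V1 _ r0) _ _ hq).
- move=> w /= /negP; rewrite -ltNge => h.
  apply: sqr_le_norm; exact: le_trans (expR_half_dist (r0 w) c0) (ltW h).
- exact: sqr_ge0.
Qed.
End laplace_concentration.

Lemma dist_gt0 (R : realType) (q q0 e : R) : 0 < q0 -> e <= 2^-1 -> `|q - q0| < e * q0 -> 0 < q.
Proof. by move=> q00 e2; rewrite ltr_norml => /andP[+ _]; nra. Qed.

(** Two relative errors [e] add up to [2 e], and the divisor [t^-1] is at least [a / 2] because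
    [e <= 2^-1]; this doubles the error to [4 e]. *)
Lemma ratio_conc (R : realType) (q q0 t a e : R) : 0 < q0 -> 0 < a -> 0 < e -> e <= 2^-1 ->
  `|q - q0| < e * q0 -> `|t^-1 - a| < e * a -> `|q * t - q0 / a| < 4 * e * (q0 / a).
Proof.
move=> q00 a0 e0 e2 hq ht; rewrite -[t in q * t]invrK.
set s := t^-1 in ht *.
have s2 : a / 2 < s by move: ht; rewrite ltr_norml => /andP[+ _]; nra.
have s0 : 0 < s by lra.
have -> : q / s - q0 / a = (q * a - q0 * s) / (s * a) by field; rewrite !gt_eqF.
rewrite normrM normfV (ger0_norm (ltW (mulr_gt0 s0 a0))) ltr_pdivrMr ?mulr_gt0//.
have -> : q * a - q0 * s = (q - q0) * a - q0 * (s - a) by ring.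
apply: le_lt_trans (ler_normB _ _) _; rewrite !normrM (gtr0_norm a0) (gtr0_norm q00).
have -> : 4 * e * (q0 / a) * (s * a) = 4 * e * q0 * s by field; rewrite gt_eqF.
have h1 : `|q - q0| * a < e * q0 * a by rewrite ltr_pM2r.
have h2 : q0 * `|s - a| < q0 * (e * a) by rewrite ltr_pM2l.
have h3 : e * q0 * (a / 2) < e * q0 * s by rewrite ltr_pM2l ?mulr_gt0.
lra.
Qed.

Section product_swap.
Context (R : realType) d (T : measurableType d) (P : probability T R).
Context d' (T' : measurableType d') (P' : probability T' R).

Lemma product_measure_swap (E : set (T * T')) : measurable E ->
  (P \x P')%E E = (P' \x P)%E [set w | E (w.2, w.1)].
Proof.
move=> mE.
have msw : measurable_fun setT (fun w : T' * T => (w.2, w.1)).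
  by apply: measurable_fun_pair; [exact: measurable_snd|exact: measurable_fst].
rewrite (@product_measure_unique _ _ T T' R P P' (pushforward (P' \x P)%E (fun w : T' * T => (w.2, w.1))))//.
move=> A B mA mB; transitivity ((P' \x P)%E (B `*` A)); last by rewrite product_measure1E// muleC.
by rewrite /pushforward; congr ((P' \x P)%E _); apply/seteqP; split => w /= [].
Qed.
End product_swap.

Section laplace_dual.
Context (R : realType) d (T : measurableType d) (P : probability T R).
Context d' (T' : measurableType d') (P' : probability T' R).
Variables (n m : nat) (B : T -> 'M[R]_(m, n)) (x : T' -> 'cV[R]_n) (g : T' -> 'cV[R]_m).
Hypotheses (mB : mfmx B) (gx : gaussmx P' x) (gg : gaussmx P' g).

Let mB1 : mfmx (fun w : T * T' => B w.1). Proof. exact: (mfmx_comp (f := B) (g := fst)). Qed.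

Lemma mfmx_mul2 : mfmx (fun w : T * T' => B w.1 *m x w.2).
Proof. by apply: mfmxM => //; case: gx => mx _; exact: (mfmx_comp (f := x) (g := snd)). Qed.

Lemma mfmx_tr_mul2 : mfmx (fun w : T * T' => (B w.1)^T *m g w.2).
Proof.
apply: mfmxM; first exact: mfmx_tr.
by case: gg => mg _; exact: (mfmx_comp (f := g) (g := snd)).
Qed.

(** Scaling [B] by the square root of [k] moves the duality to the argument [k / 2] of the Laplace
    transform; [k = 1] and [k = 2] supply the two hypotheses of [laplace_conc]. *)
Lemma prod_laplace_dual (k : R) : 0 <= k ->
  \int[(P \x P')%E]_w expR (- (k * inner (B w.1 *m x w.2) (B w.1 *m x w.2)) / 2) =
  \int[(P \x P')%E]_w expR (- (k * inner ((B w.1)^T *m g w.2) ((B w.1)^T *m g w.2)) / 2).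
Proof.
move=> k0.
have bnd m' (f : T * T' -> 'cV[R]_m') w : `|expR (- (k * inner (f w) (f w)) / 2)| <= 1.
  by rewrite ger0_norm ?expR_ge0// expR_le1; have := inner_ge0 (f w); nra.
have mes m' (f : T * T' -> 'cV[R]_m') : mfmx f ->
    measurable_fun setT (fun w => expR (- (k * inner (f w) (f w)) / 2)).
  move=> mf; apply: (measurableT_comp (f := @expR R)) => //.
  apply: measurable_funM => //; apply: measurableT_comp => //.
  by apply: measurable_funM => //; exact: measurable_inner_fun.
rewrite (Rintegral_prod _ _ (mes _ _ mfmx_mul2) (bnd _ _)).
rewrite (Rintegral_prod _ _ (mes _ _ mfmx_tr_mul2) (bnd _ _)).
apply: eq_Rintegral => w _ /=.
have := gauss_expR_quad_dual (Num.sqrt k *: B w) gx gg.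
have sq m' (v : 'cV[R]_m') : inner (Num.sqrt k *: v) (Num.sqrt k *: v) = k * inner v v.
  by rewrite innerZl innerZr mulrA -expr2 sqr_sqrtr.
have E1 w' : inner ((Num.sqrt k *: B w) *m x w') ((Num.sqrt k *: B w) *m x w') =
  k * inner (B w *m x w') (B w *m x w') by rewrite -scalemxAl sq.
have E2 w' : inner ((Num.sqrt k *: B w)^T *m g w') ((Num.sqrt k *: B w)^T *m g w') =
  k * inner ((B w)^T *m g w') ((B w)^T *m g w') by rewrite linearZ/= -scalemxAl sq.
under eq_Rintegral do rewrite E1.
by under [RHS]eq_Rintegral do rewrite E2.
Qed.
End laplace_dual.

Section regression_norm.
Variable R : realType.
Context d (T : measurableType d) (P : probability T R).
Variables (n p : nat) (z : T -> 'M[R]_(n, p)).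
Hypothesis gz : gaussmx P z.
Let mz : mfmx z. Proof. by case: gz. Qed.
Variable M : 'M[R]_n.
Hypothesis pM : proj M.
Variables (u : 'cV[R]_p) (e : 'cV[R]_n).
Hypotheses (u1 : inner u u = 1) (e1 : inner e e = 1).
Hypotheses (p1 : 1 < (p%:R : R)) (pN : p%:R <= \tr M).
Let D' := 1%:M - u *m u^T.
Let B := regression z M 1%:M u.
Let x w := z w *m u.
(** The auxiliary Gaussian vector of the duality is taken from the sample itself. It is evaluated on
    the second factor, hence independent of [B] on the first. *)
Let g w := (z w)^T *m e.
Let q0 : R := p%:R - 1.
(** Residual dimension for [gram D'], not for the full matrix: [\tr M - \tr D' + 1] with
    [\tr D' = p - 1]. *)
Let a := \tr M - p%:R + 2.
Let c := q0 / a.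

Let p1M : proj (1%:M : 'M[R]_p). Proof. exact: proj_mx1. Qed.
Let pD' : proj D'. Proof. by apply: (proj_step p1M _ u1 erefl); rewrite mul1mx. Qed.
Let trD' : \tr D' = q0. Proof. by rewrite (tr_step u1 erefl) mxtrace1. Qed.
Let q00 : 0 < q0. Proof. by rewrite subr_gt0. Qed.
Let a0 : 0 < a. Proof. by rewrite ltr_wpDl ?subr_ge0. Qed.

Lemma mfmx_regression : mfmx B.
Proof.
apply: mfmxM; last exact: mfmx_cst.
apply: mfmxM; first by apply: mfmx_inv; exact: mfmx_gram.
by apply: mfmx_tr; apply: mfmxM => //; exact: mfmx_cst.
Qed.

Lemma gram_step_null : P [set w | gram M (z w) D' \notin unitmx] = 0%E.
Proof.
have h := gram1_singular gz pM pN.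
apply/eqP; rewrite eq_le measure_ge0 andbT -h.
have mS D0 : measurable [set w | gram M (z w) D0 \notin unitmx].
  rewrite (_ : [set w | _] = ~` [set w | gram M (z w) D0 \in unitmx]); last first.
    by apply/seteqP; split => w /= /negP.
  by apply: measurableC; apply: measurable_unitmx; exact: mfmx_gram.
apply: le_measure; rewrite ?inE; [exact: mS|exact: mS|].
move=> w /=; apply: contra => Wu.
by apply: (gram_unit_step pM.1 pM.2 p1M _ u1 erefl Wu); rewrite mul1mx.
Qed.

Let r (w : T * T) := inner ((B w.1)^T *m g w.2) ((B w.1)^T *m g w.2).
Let gg : gaussmx P g. Proof. exact: gauss_tr_mul. Qed.
Let gx : gaussmx P x. Proof. exact: gauss_mulr. Qed.

Let mr : measurable_fun setT r.
Proof. by apply: measurable_inner_fun; apply: mfmx_tr_mul2 mfmx_regression gg. Qed.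

(** The dual form is [q * (v^T W'^-1 v)] with [q = |D' g|^2] and [v] the unit vector along [D' g].
    The first factor is near [q0] by the projection bound and the second near [1 / a] by
    [gram_step_conc]. *)
Lemma regression_dual_conc (eps : R) : 0 < eps -> eps <= 2^-1 ->
  ((P \x P) [set w | (4 * eps * c <= `|r w - c|)%R] <=
    (2 / (q0 * eps ^+ 2) + 2 / (a * eps ^+ 2))%:E)%E.
Proof.
move=> eps0 eps2.
have mE : measurable [set w | (4 * eps * c <= `|r w - c|)%R] by exact: measurable_dist_ge.
(* The order is exchanged so that [g], and with it the direction [v], is fixed before the Gram
   matrix varies. *)
rewrite product_measure_swap//.
set E := [set w | _].
have mE' : measurable E.
  apply: (measurable_dist_ge (f := fun w => r (w.2, w.1))); apply: measurableT_comp => //.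
  by apply: measurable_fun_pair; [exact: measurable_snd|exact: measurable_fst].
have mg : mfmx g by case: gg.
pose Bd := [set w2 | eps * q0 <= `|inner (D' *m g w2) (D' *m g w2) - q0|].
have mBd : measurable Bd by apply: measurable_dist_ge; exact: measurable_inner2.
apply: (prod_measure_le_except mE' mBd).
- rewrite /Bd -trD'; apply: le_trans (gauss_proj_chebyshev gg pD'.1 pD'.2 _) _; rewrite trD' ?mulr_gt0//.
  rewrite lee_fin le_eqVlt; apply/orP; left; apply/eqP; field; by rewrite !gt_eqF.
- move=> w2 /= /negP; rewrite -ltNge => hq.
  set q := inner (D' *m g w2) (D' *m g w2) in hq.
  have qgt0 : 0 < q := dist_gt0 q00 eps2 hq.
  pose v := (Num.sqrt q)^-1 *: (D' *m g w2).
  have sq2 : Num.sqrt q ^+ 2 = q by rewrite sqr_sqrtr// ltW.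
  have sq0 : Num.sqrt q != 0 by rewrite sqrtr_eq0 -ltNge.
  have gv : D' *m g w2 = Num.sqrt q *: v by rewrite scalerA mulfV// scale1r.
  have v1 : inner v v = 1.
    by rewrite /v innerZl innerZr mulrA -invfM -expr2 sq2 -/q mulVf// gt_eqF.
  have D'v : D' *m v = v by rewrite /v -scalemxAr mulmxA pD'.2.
  have aE : a = \tr M - \tr D' + 1 by rewrite trD' /a /q0; ring.
  have h := gram_step_conc gz pM pD' D'v v1 aE a0 eps0.
  set S1 := [set w | gram M (z w) D' \notin unitmx].
  set S2 := [set w | _] in h.
  have mS D0 : measurable [set w | gram M (z w) D0 \notin unitmx].
    rewrite (_ : [set w | _] = ~` [set w | gram M (z w) D0 \in unitmx]); last first.
      by apply/seteqP; split => w /= /negP.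
    by apply: measurableC; apply: measurable_unitmx; exact: mfmx_gram.
  have mS2 : measurable S2.
    apply: measurableI; first by apply: measurable_unitmx; exact: mfmx_gram.
    apply: measurable_dist_ge; apply: measurableT_comp; first exact: measurable_inv.
    apply: measurable_inner; apply: mfmxM; last exact: mfmx_cst.
    by apply: mfmx_inv; exact: mfmx_gram.
  apply: (@le_trans _ _ (P (S1 `|` S2))).
    apply: le_measure; rewrite ?inE.
    + apply: (measurable_dist_ge (f := fun w => r (w, w2))).
      by apply: measurableT_comp => //; exact: measurable_pair2.
    + by apply: measurableU => //; exact: mS.
    + move=> w; have [Wu|Wu] := boolP (gram M (z w) D' \in unitmx); last by left.
      move=> Ew; right; split => //; rewrite leNgt; apply/negP => hs; move: Ew.
      apply/negP; rewrite -ltNge.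
      have -> : r (w, w2) = q * inner v (invmx (gram M (z w) D') *m v).
        have D1u : 1%:M *m u = u by rewrite mul1mx.
        rewrite /r /B /regression (inner_regr_tr pM.1 pM.2 p1M D1u u1 erefl erefl Wu erefl erefl).
        by rewrite -/D' gv -scalemxAr innerZl innerZr mulrA -expr2 sq2.
      exact: (ratio_conc q00 a0 eps0 eps2 hq hs).
  apply: le_trans (measureU2 _ (mS D') mS2) _.
  by rewrite [X in (X + _ <= _)%E]gram_step_null add0e.
- by rewrite divr_ge0// mulr_ge0 ?sqr_ge0// ltW.
Qed.

(** With [u^T W^-1 u = 1 / s] and [u^T W^-2 u = (1 + |b|^2) / s^2], the expression compared with [c]
    is exactly [|b|^2], which does not involve the fluctuation of [s]. *)
Lemma regression_norm_conc (eps eps' : R) : 0 < eps -> eps <= 2^-1 -> 0 < eps' ->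
  (P [set w | gram M (z w) 1%:M \in unitmx /\
     (eps' <= `|inner (invmx (gram M (z w) 1%:M) *m u) (invmx (gram M (z w) 1%:M) *m u) /
       inner u (invmx (gram M (z w) 1%:M) *m u) ^+ 2 - 1 - c|)%R] <=
   (((4 * eps * c) ^+ 2 + (2 / (q0 * eps ^+ 2) + 2 / (a * eps ^+ 2))) / laplace_gap c eps' ^+ 2)%:E)%E.
Proof.
move=> eps0 eps2 e0.
pose G N := invmx (gram M N 1%:M) *m u.
pose A := [set N : 'M[R]_(n, p) | gram M N 1%:M \in unitmx /\
   eps' <= `|inner (G N) (G N) / inner u (G N) ^+ 2 - 1 - c|].
have mN : mfmx (fun N : mxT R n p => gram M N 1%:M) by apply: mfmx_gram; exact: mfmx_id.
have mG : mfmx (fun N : mxT R n p => G N) by apply: mfmxM; [exact: mfmx_inv|exact: mfmx_cst].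
have mA : measurable (A : set (mxT R n p)).
  apply: measurableI; first exact: measurable_unitmx.
  apply: measurable_dist_ge; apply: measurable_funB => //; apply: measurable_funM.
    exact: measurable_inner_fun.
  apply: measurableT_comp; first exact: measurable_inv.
  by apply: measurable_funX; exact: measurable_inner.
have [-> mE] := zmix_law gz u1 mA.
pose Bt (w : T * T) := inner (B w.1 *m x w.2) (B w.1 *m x w.2).
have mBt : measurable_fun setT Bt.
  by apply: measurable_inner_fun; apply: mfmx_mul2 mfmx_regression gx.
apply: (@le_trans _ _ ((P \x P)%E [set w | eps' <= `|Bt w - c|])).
  apply: le_measure; rewrite ?inE//; first exact: measurable_dist_ge.
  move=> w [/= Wu]; rewrite /G.
  have D1u : 1%:M *m u = u by rewrite mul1mx.
  have h1 := zmix_inner pM p1M D1u u1 Wu; have h2 := zmix_inner2 pM p1M D1u u1 Wu.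
  set s := (X in _ = X^-1) in h1; rewrite -/s -/x -/B -/(Bt w) in h2.
  (* As [0^-1 = 0], a vanishing [s] would force [W^-1 u = 0], hence [u = 0]. *)
  have s0 : s != 0.
    apply/eqP => s0; move: h2; rewrite s0 expr0n invr0 mulr0 => /eqP; rewrite inner_eq0 => /eqP h2.
    have : gram M (zmix z u w) 1%:M *m (invmx (gram M (zmix z u w) 1%:M) *m u) = u by rewrite mulKVmx.
    rewrite h2 mulmx0 => uE; move: u1; rewrite -uE => /eqP.
    by rewrite innerE trmx0 mul0mx mxtrace0 eq_sym oner_eq0.
  rewrite h1 h2 (_ : (1 + Bt w) / s ^+ 2 / s^-1 ^+ 2 - 1 = Bt w)//.
  by field.
have B0 (w : T * T) : 0 <= Bt w by exact: inner_ge0.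
have r0 w : 0 <= r w by exact: inner_ge0.
apply: (laplace_conc mBt mr B0 r0 _ _ _ e0 _ (regression_dual_conc eps0 eps2)).
- have := prod_laplace_dual P mfmx_regression gx gg ler01.
  under eq_Rintegral do rewrite mul1r.
  by under [in X in _ = X -> _]eq_Rintegral do rewrite mul1r.
- have := prod_laplace_dual P mfmx_regression gx gg (ler0n R 2).
  have E2 y : - (2 * y) / 2 = - y :> R by field.
  under eq_Rintegral do rewrite E2.
  by under [in X in _ = X -> _]eq_Rintegral do rewrite E2.
- by rewrite divr_ge0// ltW.
- by rewrite mulr_ge0 ?divr_ge0// ?ltW// mulr_gt0.
Qed.
End regression_norm.

(** * Moments of the inverse Gram matrix *)

Section limit_functions.
Variable R : realType.

Lemma dist_shift (v s t y d : R) : `|v - (1 - s + t)| < d / 4 -> `|s - y| < d / 4 -> 0 < t -> t <= d / 4 ->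
  `|v - (1 - y)| < d.
Proof. rewrite !ltr_norml => /andP[? ?] /andP[? ?] ? ?; apply/andP; split; lra. Qed.

(** Here [v] stands for [s / N] and [b] for the squared norm of the regression coefficients, so the
    two quantities are the normalized inverse moments. *)
Lemma inverse_moments_cont (v0 b0 e : R) : 0 < v0 -> 0 < e ->
  exists2 d : R, 0 < d & forall v b, `|v - v0| < d -> `|b - b0| < d ->
    `|v^-1 - v0^-1| < e /\ `|(1 + b) * v^-1 ^+ 2 - (1 + b0) * v0^-1 ^+ 2| < e.
Proof.
move=> v00 e0; have v0n : v0 != 0 by rewrite gt_eqF.
have c1 : (fun t : R * R => t.1^-1) @ (v0, b0) --> v0^-1.
  by apply: cvgV => //; exact: cvg_fst.
have c2 : (fun t : R * R => (1 + t.2) * t.1^-1 ^+ 2) @ (v0, b0) --> (1 + b0) * v0^-1 ^+ 2.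
  apply: cvgM; first by apply: cvgD; [exact: cvg_cst|exact: cvg_snd].
  by apply: cvgM.
have /cvgrPdist_lt/(_ _ e0)/nbhs_ballP[d1 d10 h1] := c1.
have /cvgrPdist_lt/(_ _ e0)/nbhs_ballP[d2 d20 h2] := c2.
exists (Num.min d1 d2); first by rewrite lt_min d10.
move=> v b; rewrite !lt_min => /andP[v1 v2] /andP[b1 b2]; split; rewrite distrC.
- by apply: (h1 (v, b)); split; rewrite /ball/= distrC.
- by apply: (h2 (v, b)); split; rewrite /ball/= distrC.
Qed.

(** With [s = p / N] and [t = 1 / N] the fraction is [(p - 1) / (N - p + 2)], the value around which
    [|b|^2] concentrates. *)
Lemma aspect_ratio_cont (y e : R) : y < 1 -> 0 < e ->
  exists2 d : R, 0 < d & forall s t, `|s - y| < d -> `|t| < d ->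
    `|(s - t) / (1 - s + 2 * t) - y / (1 - y)| < e.
Proof.
move=> y1 e0.
have c1 : (fun t : R * R => (t.1 - t.2) / (1 - t.1 + 2 * t.2)) @ (y, 0 : R) --> (y - 0) / (1 - y + 2 * 0).
  apply: cvgM; first by apply: cvgB; [exact: cvg_fst|exact: cvg_snd].
  apply: cvgV; first by rewrite mulr0 addr0 subr_eq0 gt_eqF.
  apply: cvgD; first by apply: cvgB; [exact: cvg_cst|exact: cvg_fst].
  by apply: cvgM; [exact: cvg_cst|exact: cvg_snd].
rewrite subr0 mulr0 addr0 in c1.
have /cvgrPdist_lt/(_ _ e0)/nbhs_ballP[d1 d10 h1] := c1.
exists d1 => // s t sd td; rewrite distrC.
by apply: (h1 (s, t)); split; rewrite /ball/= distrC ?subr0.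
Qed.

Lemma laplace_gap_le (c c' e : R) : 0 < e -> c <= c' -> laplace_gap c' e <= laplace_gap c e.
Proof.
move=> e0 cc; rewrite /laplace_gap; apply: ler_wpM2r; first by rewrite subr_ge0 expR_le1; lra.
by rewrite ler_expR; lra.
Qed.
End limit_functions.

Section gram_measurability.
Context (R : realType) d (T : measurableType d).
Variables (n p : nat) (z : T -> 'M[R]_(n, p)) (M : 'M[R]_n).
Hypothesis mz : mfmx z.

Lemma mfmx_gram_inv_mul k (u : 'M[R]_(p, k)) : mfmx (fun w => invmx (gram M (z w) 1%:M) *m u).
Proof. by apply: mfmxM; [apply: mfmx_inv; exact: mfmx_gram|exact: mfmx_cst]. Qed.

Lemma measurable_gram_unit D : measurable [set w | gram M (z w) D \in unitmx].
Proof. by apply: measurable_unitmx; exact: mfmx_gram. Qed.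

Lemma measurable_gram_singular D : measurable [set w | gram M (z w) D \notin unitmx].
Proof.
rewrite (_ : [set w | _] = ~` [set w | gram M (z w) D \in unitmx]); last first.
  by apply/seteqP; split => w /= /negP.
by apply: measurableC; exact: measurable_gram_unit.
Qed.
End gram_measurability.

Section inverse_moments.
Variable R : realType.

Definition inverse_moments_bad (n p : nat) (M : 'M[R]_n) (y e : R) (u : 'cV[R]_p) : set 'M[R]_(n, p) :=
  [set z | gram M z 1%:M \notin unitmx] `|`
  ([set z | e <= `|\tr M * inner u (invmx (gram M z 1%:M) *m u) - (1 - y)^-1|] `|`
   [set z | e <= `|\tr M ^+ 2 * inner (invmx (gram M z 1%:M) *m u) (invmx (gram M z 1%:M) *m u) - (1 - y)^-1 ^+ 3|]).

Lemma measurable_inverse_moments_bad d (T : measurableType d) (n p : nat) (M : 'M[R]_n) (y e : R)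
  (u : 'cV[R]_p) (z : T -> 'M[R]_(n, p)) : mfmx z ->
  measurable [set w | inverse_moments_bad M y e u (z w)].
Proof.
move=> mz; apply: measurableU; first exact: measurable_gram_singular.
have mG := mfmx_gram_inv_mul M mz u.
apply: measurableU; apply: measurable_dist_ge; apply: measurable_funM => //.
- exact: measurable_inner.
- exact: measurable_inner_fun.
Qed.

(** The order of quantifiers matters: [del] and [K] serve all spaces, sizes and unit vectors, so
    that [u] may later be the direction of a random vector that has been fixed. *)
Lemma inverse_moments_conc (y e r : R) : 0 < y -> y < 1 -> 0 < e -> 0 < r ->
  exists2 del : R, 0 < del & exists K : R,
  forall d (T : measurableType d) (P : probability T R) (n p : nat) (z : T -> 'M[R]_(n, p))
    (M : 'M[R]_n) (u : 'cV[R]_p),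
  gaussmx P z -> proj M -> inner u u = 1 -> `|p%:R / \tr M - y| < del -> K <= p%:R ->
  (P [set w | inverse_moments_bad M y e u (z w)] <= r%:E)%E.
Proof.
move=> y0 y1 e0 r0.
have v00 : 0 < 1 - y by rewrite subr_gt0.
pose b0 := y / (1 - y).
have b00 : 0 < b0 by rewrite divr_gt0.
have [d0 d00 hd0] := @inverse_moments_cont R (1 - y) b0 e v00 e0.
have [d1 d10 hd1] := aspect_ratio_cont y1 (divr_gt0 d00 (ltr0Sn R 1)).
(* An upper bound for the center [c] of [|b|^2]; through [g] it makes the Laplace gap uniform in the
   problem. *)
pose C := b0 + d0.
have C0 : 0 < C by rewrite addr_gt0.
pose g := laplace_gap C (d0 / 2).
have g0 : 0 < g by apply: laplace_gap_gt0; rewrite divr_gt0.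
(* The error [e1 * a1 / N] must stay below [d0 / 4], and [a1 <= 2 * N]. *)
pose e1 := Num.min (d0 / 8) 2^-1.
have e10 : 0 < e1 by rewrite lt_min divr_gt0// invr_gt0 ltr0n.
have e11 : e1 <= d0 / 8 by rewrite ge_min lexx.
have e12 : e1 <= 2^-1 by rewrite ge_min lexx orbT.
pose e2 := Num.min (r * g ^+ 2 / (64 * C ^+ 2)) 2^-1.
have e20 : 0 < e2 by rewrite lt_min divr_gt0 ?invr_gt0 ?ltr0n// mulr_gt0 ?exprn_gt0.
have e21 : 16 * e2 * C ^+ 2 <= r * g ^+ 2 / 4.
  have : e2 <= r * g ^+ 2 / (64 * C ^+ 2) by rewrite ge_min lexx.
  by rewrite ler_pdivlMr ?mulr_gt0 ?exprn_gt0//; lra.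
have e22 : e2 <= 2^-1 by rewrite ge_min lexx orbT.
(* Chosen so that the bound for [s] is at most [r / 4] and each Chebyshev term in the bound for
   [|b|^2] at most [r * g ^+ 2 / 8]. *)
pose K' := 8 / (r * e1 ^+ 2) + 16 / (r * g ^+ 2 * e2 ^+ 2).
have k1 : 0 < 8 / (r * e1 ^+ 2) by apply: divr_gt0 => //; apply: mulr_gt0 => //; exact: exprn_gt0.
have k2 : 0 < 16 / (r * g ^+ 2 * e2 ^+ 2).
  by apply: divr_gt0 => //; apply: mulr_gt0; [apply: mulr_gt0 => //; exact: exprn_gt0|exact: exprn_gt0].
have K'0 : 0 < K' by rewrite addr_gt0.
have K1 : 8 / (r * e1 ^+ 2) <= K' by rewrite /K' lerDl ltW.
have K2 : 16 / (r * g ^+ 2 * e2 ^+ 2) <= K' by rewrite /K' lerDr ltW.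
have gC c : c <= C -> g <= laplace_gap c (d0 / 2) by move=> cC; apply: laplace_gap_le => //; rewrite divr_gt0.
clearbody K' e1 e2 g; clear k1 k2.
(* The first two bounds serve the continuity estimates. The last two keep [p / N] positive and below
   [(1 + y) / 2], so that [N - p] grows with [p]. *)
exists (Num.min (Num.min d1 (d0 / 4)) (Num.min (y / 2) ((1 - y) / 2))).
  by rewrite !lt_min d10 !divr_gt0.
exists (2 + K' + 2 * K' / (1 - y) + (2 / d1 + 4 / d0)).
move=> d T P n p z M u gz pM u1; rewrite !lt_min => /andP[/andP[hy1 hy2] /andP[hy3 hy4]] Kp.
have mz : mfmx z by case: gz.
have [N NE] : exists N, N = \tr M by exists (\tr M).
rewrite -NE in hy1 hy2 hy3 hy4.
have i1 : 0 < 2 / d1 by rewrite divr_gt0.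
have i2 : 0 < 4 / d0 by rewrite divr_gt0.
have i3 : 0 < 2 * K' / (1 - y) by rewrite divr_gt0// mulr_gt0.
have p2 : 2 + K' <= p%:R by lra.
have p0 : 0 < (p%:R : R) by lra.
have s1 : 0 < p%:R / N by move: hy3; rewrite ltr_norml => /andP[+ _]; lra.
have N0 : 0 < N by move: s1; rewrite pmulr_rgt0// invr_gt0.
have s2 : p%:R < (1 + y) / 2 * N.
  by rewrite -ltr_pdivrMr//; move: hy4; rewrite ltr_norml => /andP[_]; lra.
have pN : p%:R <= N.
  apply: (le_trans (ltW s2)); rewrite -[leRHS]mul1r ler_pM2r//; lra.
have NK : K' <= N - p%:R.
  have : 2 * K' / (1 - y) <= N by lra.
  rewrite ler_pdivrMr// => h; have : (1 + y) / 2 * N = N - N * (1 - y) / 2 by field.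
  lra.
have t0 : 0 < N^-1 by rewrite invr_gt0.
have t1 : N^-1 < d1.
  have : 2 / d1 < N by lra.
  by rewrite ltr_pdivrMr// => h; rewrite -div1r ltr_pdivrMr//; lra.
have t2 : N^-1 <= d0 / 4.
  have : 4 / d0 < N by lra.
  by rewrite ltr_pdivrMr// => h; rewrite -div1r ler_pdivrMr//; lra.
have n0 : (0 < n)%N.
  rewrite lt0n; apply: contraTneq N0 => n0.
  by rewrite NE /mxtrace big1 ?ltxx// => i; move: (ltn_ord i); rewrite {2}n0.
(* Any unit vector will do; it produces the Gaussian vector [z^T en] of the duality. *)
have [en en1] : exists en : 'cV[R]_n, inner en en = 1.
  by exists (delta_mx (Ordinal n0) 0); rewrite inner_delta mxE !eqxx.
have p1 : 1 < (p%:R : R) by lra.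
have [a1 a1N] : exists a1, a1 = N - p%:R + 1 by exists (N - p%:R + 1).
have a1K : K' <= a1 by rewrite a1N ler_wpDr.
have a1E : a1 = \tr M - \tr (1%:M : 'M[R]_p) + 1 by rewrite mxtrace1 a1N NE.
have a10 : 0 < a1 by exact: lt_le_trans a1K.
have D1u : 1%:M *m u = u by rewrite mul1mx.
have p1M : proj (1%:M : 'M[R]_p) := proj_mx1 _ _.
have B2 := gram_step_conc gz pM p1M D1u u1 a1E a10 e10.
have d02 : 0 < d0 / 2 by rewrite divr_gt0.
have pN' : p%:R <= \tr M by rewrite -NE.
have B3 := regression_norm_conc gz pM u1 en1 p1 pN' e20 e22 d02.
rewrite -NE in B3.
have [c c_def] : exists c, c = (p%:R - 1) / (N - p%:R + 2) by exists ((p%:R - 1) / (N - p%:R + 2)).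
rewrite -c_def in B3.
have cE : c = (p%:R / N - N^-1) / (1 - p%:R / N + 2 * N^-1).
  rewrite c_def; field; rewrite !gt_eqF//; lra.
have cb : `|c - b0| < d0 / 2 by rewrite cE; apply: hd1; rewrite // gtr0_norm.
have c0 : 0 <= c by rewrite c_def divr_ge0 ?subr_ge0 ?(ltW p1)// addr_ge0// subr_ge0.
have cC : c <= C by rewrite /C; move: cb; rewrite ltr_norml => /andP[_]; lra.
have NpK : K' <= N - p%:R + 2 by rewrite ler_wpDr.
have gc : g <= laplace_gap c (d0 / 2) by exact: gC.
have bound2 : 2 / (a1 * e1 ^+ 2) <= r / 4.
  have : 8 / (r * e1 ^+ 2) <= a1 by exact: le_trans a1K.
  rewrite ler_pdivrMr ?mulr_gt0 ?exprn_gt0// => h.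
  rewrite ler_pdivrMr ?mulr_gt0 ?exprn_gt0//; lra.
have bound3 k : K' <= k -> 2 / (k * e2 ^+ 2) <= r * g ^+ 2 / 8.
  move=> Kk; have k0 : 0 < k by exact: lt_le_trans Kk.
  have : 16 / (r * g ^+ 2 * e2 ^+ 2) <= k by exact: le_trans Kk.
  rewrite ler_pdivrMr ?mulr_gt0 ?exprn_gt0// => h.
  rewrite ler_pdivrMr ?mulr_gt0 ?exprn_gt0//; lra.
have bound4 : (4 * e2 * c) ^+ 2 <= r * g ^+ 2 / 4.
  apply: le_trans e21.
  have -> : (4 * e2 * c) ^+ 2 = 16 * e2 * (e2 * c ^+ 2) by ring.
  rewrite ler_pM2l ?mulr_gt0//.
  have h1 : c ^+ 2 <= C ^+ 2 by rewrite lerXn2r// nnegrE// ltW.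
  apply: le_trans h1; rewrite -[leRHS]mul1r ler_wpM2r ?sqr_ge0//; lra.
have {}B3 := le_trans B3 (_ : _ <= (r / 2)%:E)%E.
set S2 := [set w | _] in B2; set S3 := [set w | _] in B3.
pose S1 := [set w | gram M (z w) 1%:M \notin unitmx].
have S10 : P S1 = 0%E := gram1_singular gz pM pN'.
have mu := measurable_gram_unit M mz 1%:M.
have mG := mfmx_gram_inv_mul M mz u.
have mS1 : measurable S1 by exact: measurable_gram_singular.
have mS2 : measurable S2.
  apply: measurableI => //; apply: measurable_dist_ge.
  by apply: measurableT_comp; [exact: measurable_inv|exact: measurable_inner].
have mS3 : measurable S3.
  apply: measurableI => //; apply: measurable_dist_ge; apply: measurable_funB => //.
  apply: measurable_funM; first exact: measurable_inner_fun.
  apply: measurableT_comp; first exact: measurable_inv.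
  by apply: measurable_funX; exact: measurable_inner.
apply: (@le_trans _ _ (P (S1 `|` (S2 `|` S3)))); last first.
  apply: le_trans (measureU2 _ mS1 (measurableU _ _ mS2 mS3)) _.
  rewrite [X in (X + _ <= _)%E]S10 add0e; apply: le_trans (measureU2 _ mS2 mS3) _.
  apply: (@le_trans _ _ ((r / 4)%:E + (r / 2)%:E)%E).
    apply: leeD; first by apply: le_trans B2 _; rewrite lee_fin.
    apply: B3; rewrite lee_fin.
    have g'0 : 0 < laplace_gap c (d0 / 2) by exact: lt_le_trans gc.
    rewrite ler_pdivrMr ?exprn_gt0//.
    have q0K : K' <= p%:R - 1 by lra.
    have h1 := bound3 _ q0K; have h2 := bound3 _ NpK.
    apply: (@le_trans _ _ (r / 2 * g ^+ 2)); first lra.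
    by rewrite ler_pM2l ?divr_gt0// lerXn2r// nnegrE ltW.
  by rewrite -EFinD lee_fin; lra.
apply: le_measure; rewrite ?inE; first exact: measurable_inverse_moments_bad.
  by apply: measurableU => //; exact: measurableU.
move=> w bad; apply: contrapT => /not_orP[/negP]; rewrite negbK => Wu /not_orP[n2 n3].
set G := invmx (gram M (z w) 1%:M) *m u in bad n2 n3 *.
have {}n2 : `|(inner u G)^-1 - a1| < e1 * a1.
  by rewrite ltNge; apply/negP => h; apply: n2.
have {}n3 : `|inner G G / inner u G ^+ 2 - 1 - c| < d0 / 2.
  by rewrite ltNge; apply/negP => h; apply: n3.
have ui : 0 < (inner u G)^-1 by exact: dist_gt0 n2.
have u0 : inner u G != 0 by rewrite gt_eqF// -invr_gt0.
pose v := (inner u G)^-1 / N; pose b := inner G G / inner u G ^+ 2 - 1.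
have vN : `|v - (1 - y)| < d0.
  have h1 : `|v - a1 / N| < d0 / 4.
    rewrite /v -mulrBl normrM (gtr0_norm t0) ltr_pdivrMr//.
    apply: (lt_le_trans n2); apply: (@le_trans _ _ (d0 / 8 * a1)); first by rewrite ler_pM2r.
    have -> : d0 / 4 * N = d0 / 8 * (2 * N) by field.
    by rewrite ler_pM2l ?divr_gt0// a1N; lra.
  have h2 : a1 / N = 1 - p%:R / N + N^-1 by rewrite a1N; field; rewrite gt_eqF.
  by apply: dist_shift hy2 _ t2 => //; rewrite -h2.
have bN : `|b - b0| < d0.
  by rewrite (splitr d0) (le_lt_trans (ler_distD c _ _))// ltrD.
have [g1 g2] := hd0 v b vN bN.
have E1 : N * inner u G = v^-1 by rewrite /v; field; rewrite u0 gt_eqF.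
have E2 : N ^+ 2 * inner G G = (1 + b) * v^-1 ^+ 2 by rewrite /v /b; field; rewrite u0 gt_eqF.
have E3 : (1 + b0) * (1 - y)^-1 ^+ 2 = (1 - y)^-1 ^+ 3 by rewrite /b0; field; rewrite gt_eqF.
case: bad => [/negP//|[]] /=; rewrite -/G -NE.
- by rewrite E1 leNgt g1.
- by rewrite E2 -E3 leNgt g2.
Qed.
End inverse_moments.

(** * Whitening the samples *)

Section decorrelation.
Context (R : realType) d (T : measurableType d) (P : probability T R).

(** Shifted by [C + 1] and divided by its mean, [g] becomes a probability density [g']. The
    hypothesis says that reweighting [P] by [g'] does not change the law of [Y], hence it does not
    change the integral of any bounded function of [Y]. *)
Lemma Rintegral_decorrelated d' (S : measurableType d') (Y : T -> S) (g : T -> R) (C k : R) (h : S -> R) :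
  measurable_fun setT Y -> measurable_fun setT g -> (forall w, `|g w| <= C) ->
  (forall A, measurable A -> \int[P]_(w in Y @^-1` A) g w = k * fine (P (Y @^-1` A))) ->
  measurable_fun setT h -> (forall y, `|h y| <= 1) ->
  \int[P]_w (h (Y w) * g w) = k * \int[P]_w h (Y w).
Proof.
move=> mY mg gC gk mh h1.
have mpre A : measurable A -> measurable (Y @^-1` A).
  by move=> mA; rewrite -[X in measurable X]setTI; exact: mY.
have C0 : 0 <= C by apply: le_trans (gC point).
have ig : P.-integrable setT (EFin \o g) by exact: bounded_integrable gC.
have ih : P.-integrable setT (EFin \o (h \o Y)).
  by apply: (@bounded_integrable _ _ _ _ _ 1) => [|w]; [exact: measurableT_comp|exact: h1].
have kE : \int[P]_w g w = k.
  have := gk setT measurableT; rewrite preimage_setT => ->.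
  by rewrite [X in fine X]probability_setT mulr1.
have Pcst r : \int[P]_w (cst r w) = r by rewrite /Rintegral prob_integral_cst.
have icst r : P.-integrable setT (EFin \o (cst r : T -> R)) by apply: (@bounded_integrable _ _ _ _ _ `|r|).
have kC : 0 < k + C + 1.
  rewrite -kE -addrA -[X in _ < _ + X]Pcst -RintegralD//.
  apply: (@lt_le_trans _ _ (\int[P]_w (cst 1 w))); first by rewrite Pcst.
  apply: le_Rintegral => //; first exact: (integrableD measurableT ig (icst (C + 1))).
  by move=> w _ /=; have := gC w; rewrite ler_norml => /andP[? _]; lra.
pose g' w := (g w + (C + 1)) / (k + C + 1).
have g'0 w : 0 <= g' w.
  by rewrite divr_ge0 ?ltW//; have := gC w; rewrite ler_norml => /andP[? _]; lra.
have mg' : measurable_fun setT g' by apply: measurable_funM => //; exact: measurable_funD.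
have lawE A : measurable A -> pushforward P Y A = (\int[P]_(w in Y @^-1` A) (g' w)%:E)%E.
  move=> mA; have mYA := mpre _ mA.
  have igA := integrableS measurableT mYA (@subsetT _ _) ig.
  have icA r := integrableS measurableT mYA (@subsetT _ _) (icst r).
  have ig'A : P.-integrable (Y @^-1` A) (EFin \o g').
    apply: (integrableS measurableT) => //.
    apply: (@bounded_integrable _ _ _ _ _ ((C + C + 1) / (k + C + 1))) => // w.
    rewrite normrM [`|_^-1|]gtr0_norm ?invr_gt0// ler_pM2r ?invr_gt0//.
    by rewrite (le_trans (ler_normD _ _))// -addrA lerD// ger0_norm// addr_ge0.
  have PA : P (Y @^-1` A) \is a fin_num by apply: fin_num_measure.
  rewrite -[RHS]fineK; last exact: integrable_fin_num.
  rewrite -[LHS]fineK//; congr EFin; rewrite -[RHS]/(\int[P]_(w in Y @^-1` A) g' w).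
  have -> : \int[P]_(w in Y @^-1` A) g' w = (\int[P]_(w in Y @^-1` A) (g w + cst (C + 1) w)) / (k + C + 1).
    rewrite -RintegralZr//; exact: (integrableD mYA igA (icA (C + 1))).
  rewrite RintegralD// gk// Rintegral_cst//; rewrite /pushforward.
  by field; rewrite gt_eqF.
have := @ge0_integral_density _ _ T S R P (pushforward P Y) Y g' mY g'0 mg' lawE (fun y => (h y + 1)%:E).
have hy0 y : 0 <= h y + 1 by have := h1 y; rewrite ler_norml => /andP[? _]; lra.
have mh1 : measurable_fun setT (fun y => (h y + 1)%:E).
  by apply/measurable_EFinP; exact: measurable_funD.
move=> /(_ mY mh1 hy0); rewrite ge0_integral_pushforward//; last by move=> y _; rewrite lee_fin.
rewrite preimage_setT => H.
have {H} : \int[P]_w (h (Y w) + cst 1 w) = \int[P]_w ((h (Y w) + 1) * g' w).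
  by rewrite /Rintegral; congr fine; rewrite [LHS]H; apply: eq_integral => w _; rewrite EFinM.
rewrite RintegralD// Pcst.
have ihg : P.-integrable setT (EFin \o (fun w => h (Y w) * g w)).
  apply: (@bounded_integrable _ _ _ _ _ C) => [|w]; last by rewrite normrM -[leRHS]mul1r ler_pM.
  by apply: measurable_funM => //; exact: measurableT_comp.
have ihc r : P.-integrable setT (EFin \o (fun w => r * h (Y w))).
  apply: (@bounded_integrable _ _ _ _ _ (`|r| * 1)) => [|w]; last by rewrite normrM ler_wpM2l.
  by apply: measurable_funM => //; exact: measurableT_comp.
have -> : \int[P]_w ((h (Y w) + 1) * g' w) =
    \int[P]_w (((h (Y w) * g w + (C + 1) * h (Y w)) + (g w + cst (C + 1) w)) * (k + C + 1)^-1).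
  by apply: eq_Rintegral => w _; rewrite /g' /=; ring.
have i1 := integrableD measurableT ihg (ihc (C + 1)).
have i2 := integrableD measurableT ig (icst (C + 1)).
rewrite (RintegralZr _ measurableT (integrableD measurableT i1 i2)).
rewrite (RintegralD measurableT i1 i2) (RintegralD measurableT ihg (ihc _)) (RintegralD measurableT ig (icst _)).
rewrite RintegralZl// Pcst kE.
move: (\int[P]_w (h (Y w) * g w)) (\int[P]_w h (Y w)) => I J H.
have : (J + 1) * (k + C + 1) = I + (C + 1) * J + (k + (C + 1)) by rewrite H mulfVK// gt_eqF.
by clear -R; lra.
Qed.

Section independent_sum.
Variables (I : finType) (Y : I -> T -> R) (psi : I -> R).
Hypothesis mY : forall i, measurable_fun setT (Y i).
Hypothesis indY : forall B : I -> set R, (forall i, measurable (B i)) ->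
  P (\bigcap_(i in [set: I]) (Y i @^-1` B i)) = (\prod_i P (Y i @^-1` B i))%E.
Hypothesis cosY : forall i c, \int[P]_w cos (Y i w + c) = cos c * psi i.

Let mcos : measurable_fun setT (@cos R).
Proof. by apply: continuous_measurable_fun; exact: continuous_cos. Qed.
Let msin : measurable_fun setT (@sin R).
Proof. by apply: continuous_measurable_fun; exact: continuous_sin. Qed.

Let mpre i B : measurable B -> measurable (Y i @^-1` B).
Proof. by move=> mB; rewrite -[X in measurable X]setTI; exact: mY. Qed.

Let mE (B : I -> set R) : (forall i, measurable (B i)) ->
  measurable (\bigcap_(i in [set: I]) (Y i @^-1` B i)).
Proof. by move=> mB; apply: fin_bigcap_measurable => [|i _]; [exact: finite_finset|exact: mpre]. Qed.

Let mS (s : seq I) c : measurable_fun setT (fun w => cos (\sum_(i <- s) Y i w + c)).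
Proof.
apply: (measurableT_comp (f := cos)); first exact: mcos.
by apply: measurable_funD => //; exact: measurable_sum.
Qed.

Let E_ (B : I -> set R) := \bigcap_(i in [set: I]) (Y i @^-1` B i).

(** Independence is given by the product rule for events, so the induction carries an event that
    constrains the summands outside [s]. To split off [Y j], the induction hypothesis for the event
    with [A] imposed on [Y j] shows that the remaining cosine is decorrelated from [Y j]. *)
Lemma indep_cos_event (s : seq I) (B : I -> set R) c : uniq s ->
  (forall i, measurable (B i)) -> (forall i, i \in s -> B i = setT) ->
  \int[P]_(w in E_ B) cos (\sum_(i <- s) Y i w + c) =
  cos c * (\prod_(i <- s) psi i) * fine (P (E_ B)).
Proof.
elim: s B c => [|j s IH] B c /= => [_ mB _|/andP[js us] mB Bs].
  under eq_Rintegral do rewrite big_nil add0r.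
  by rewrite Rintegral_cst ?big_nil ?mulr1//; exact: mE.
have mEB : measurable (E_ B) by exact: mE.
pose k := cos c * \prod_(i <- s) psi i.
have Bj : B j = setT by apply: Bs; rewrite mem_head.
pose g c' w := (\1_(E_ B) w : R) * cos (\sum_(i <- s) Y i w + c').
have mg c' : measurable_fun setT (g c') by apply: measurable_funM; [exact: measurable_indic|exact: mS].
have g1 c' w : `|g c' w| <= 1.
  rewrite normrM indicE; case: (_ \in _); rewrite ?normr1 ?mul1r ?normr0 ?mul0r//; exact: cos_abs_le1.
have gE c' D f : measurable D -> \int[P]_(w in D) (f w * g c' w) =
    \int[P]_(w in D `&` E_ B) (f w * cos (\sum_(i <- s) Y i w + c')).
  move=> mD; rewrite [RHS]Rintegral_mkcondr; apply: eq_Rintegral => w _.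
  rewrite patchE /g indicE; case: (_ \in _); rewrite ?mul1r//.
  by rewrite mul0r mulr0.
have key c' : forall A, measurable A ->
    \int[P]_(w in Y j @^-1` A) g c' w = (cos c' * (\prod_(i <- s) psi i) * fine (P (E_ B))) * fine (P (Y j @^-1` A)).
  move=> A mA; pose B' i := if i == j then A else B i.
  have mB' i : measurable (B' i) by rewrite /B'; case: ifP.
  have EB' : Y j @^-1` A `&` E_ B = E_ B'.
    apply/seteqP; split => [w [Aw Ew] i _|w Ew].
      by rewrite /B' /preimage/=; case: eqP => [->//|_]; exact: (Ew i).
    have := Ew j Logic.I; rewrite /B' /preimage/= eqxx => Aw; split => // i _.
    by have := Ew i Logic.I; rewrite /B' /preimage/=; case: eqP => [->|//]; rewrite Bj.
  have -> : \int[P]_(w in Y j @^-1` A) g c' w = \int[P]_(w in Y j @^-1` A) (cst 1 w * g c' w).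
    by apply: eq_Rintegral => w _; rewrite mul1r.
  rewrite gE; last exact: mpre.
  under eq_Rintegral do rewrite mul1r.
  rewrite EB' IH//; last first.
    move=> i si; rewrite /B'; case: eqP => [ij|_]; first by move: js; rewrite -ij si.
    by apply: Bs; rewrite in_cons si orbT.
  rewrite -[RHS]mulrA; congr (_ * _).
  rewrite -fineM ?fin_num_measure//; [|exact: mpre]; congr fine.
  rewrite /E_ !indY// (bigD1 j)//= [in RHS](bigD1 j)//= Bj preimage_setT.
  rewrite [P setT]probability_setT mul1e muleC /B' eqxx; congr (_ * _)%E.
  by apply: eq_bigr => i /negbTE ->.
have step (c' : R) (h : R -> R) : measurable_fun setT h -> (forall y, `|h y| <= 1) ->
    \int[P]_(w in E_ B) (h (Y j w) * cos (\sum_(i <- s) Y i w + c')) =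
    (cos c' * (\prod_(i <- s) psi i) * fine (P (E_ B))) * \int[P]_w h (Y j w).
  move=> mh h1; rewrite -(Rintegral_decorrelated (mY j) (mg c') (g1 c') (key c') mh h1).
  by rewrite gE// setTI.
have mcosY (f : R -> R) : measurable_fun setT f -> (forall y, `|f y| <= 1) -> forall c',
    P.-integrable (E_ B) (EFin \o (fun w => f (Y j w) * cos (\sum_(i <- s) Y i w + c'))).
  move=> mf f1 c'; apply: (integrableS measurableT) => //.
  apply: (@bounded_integrable _ _ _ _ _ 1) => [|w].
    by apply: measurable_funM; [exact: measurableT_comp|exact: mS].
  by rewrite normrM -[leRHS]mulr1 ler_pM// cos_abs_le1.
transitivity (\int[P]_(w in E_ B) (cos (Y j w) * cos (\sum_(i <- s) Y i w + c) +
    sin (Y j w) * cos (\sum_(i <- s) Y i w + (c + pi / 2)))).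
  apply: eq_Rintegral => w _; rewrite big_cons -addrA cosD addrA cosDpihalf; ring.
rewrite RintegralD//; [|exact: (mcosY _ mcos (@cos_abs_le1 R))
  |exact: (mcosY _ msin (@sin_abs_le1 R))].
rewrite (step _ _ mcos (@cos_abs_le1 R)) (step _ _ msin (@sin_abs_le1 R)).
have -> : \int[P]_w cos (Y j w) = psi j.
  by rewrite -[RHS]mul1r -[in RHS]cos0 -cosY; apply: eq_Rintegral => w _; rewrite addr0.
(* The hypothesis with phase [- (pi / 2)] makes the odd part vanish. *)
have -> : \int[P]_w sin (Y j w) = 0.
  transitivity (\int[P]_w cos (Y j w + - (pi / 2))).
    by apply: eq_Rintegral => w _; rewrite cosBpihalf.
  by rewrite cosY cosN cos_pihalf mul0r.
rewrite mulr0 addr0 big_cons; ring.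
Qed.

Lemma indep_cos c : \int[P]_w cos (\sum_i Y i w + c) = cos c * \prod_i psi i.
Proof.
have := @indep_cos_event (index_enum I) (fun=> setT) c (index_enum_uniq I) (fun=> measurableT) (fun _ _ => erefl).
have -> : E_ (fun=> setT) = setT by apply/seteqP; split.
by rewrite [X in fine X]probability_setT mulr1.
Qed.
End independent_sum.

End decorrelation.

Lemma dotE (R : realType) p (u v : 'cV[R]_p) : dot u v = inner u v.
Proof. by rewrite innerE /dot /mxtrace big_ord1. Qed.

Section cholesky.
Variable R : realType.

Lemma inner_col_mx m n k (x y : 'M[R]_(m, k)) (u v : 'M[R]_(n, k)) :
  inner (col_mx x u) (col_mx y v) = inner x y + inner u v.
Proof. by rewrite !innerE tr_col_mx mul_row_col linearD. Qed.

Lemma inner_scalar11 (s t : R) : inner s%:M (t%:M : 'M[R]_1) = s * t.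
Proof. by rewrite innerE tr_scalar_mx -scalar_mxM mxtrace_scalar. Qed.

Lemma inner_rank1 p (b u : 'cV[R]_p) : inner u (b *m b^T *m u) = inner b u ^+ 2.
Proof.
have -> : b *m b^T *m u = inner b u *: b.
  by rewrite -mulmxA tr_mul_inner mul_mx_scalar.
by rewrite innerZr innerC expr2.
Qed.

(** Cholesky factorization, by induction on the size. For a positive pivot [a] the Schur complement
    is again positive: its form at [u] is that of [S] with first coordinate [t = - (b . u) / a]. A
    zero pivot forces [b = 0]. *)
Lemma psd_factor p (S : 'M[R]_p) : S^T = S -> (forall u : 'cV[R]_p, 0 <= inner u (S *m u)) ->
  exists L : 'M[R]_p, S = L *m L^T.
Proof.
elim: p S => [S _ _|p IH S Ss Sp]; first by exists 0; apply/matrixP => -[].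
have {Ss}Ss : (S : 'M[R]_(1 + p))^T = S by [].
have {Sp}Sp : forall u : 'cV[R]_(1 + p), 0 <= inner u ((S : 'M[R]_(1 + p)) *m u) by [].
change (exists L : 'M[R]_(1 + p), (S : 'M[R]_(1 + p)) = L *m L^T).
move: (S : 'M[R]_(1 + p)) Ss Sp => {}S Ss Sp.
have [a aE] : exists a, ulsubmx S = a%:M by exists (ulsubmx S 0 0); exact: mx11_scalar.
have [b bE] : exists b, dlsubmx S = b by exists (dlsubmx S).
have [C CE] : exists C, drsubmx S = C by exists (drsubmx S).
have bTE : ursubmx S = b^T by rewrite -bE trmx_dlsub Ss.
have Cs : C^T = C by rewrite -CE trmx_drsub Ss.
have SE : S = block_mx a%:M b^T b C by rewrite -[LHS]submxK aE bE CE bTE.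
have quad (t : R) (u : 'cV[R]_p) : 0 <= a * t ^+ 2 + 2 * t * inner b u + inner u (C *m u).
  have := Sp (col_mx t%:M u); rewrite SE mul_block_col inner_col_mx.
  rewrite -scalar_mxM mul_mx_scalar innerDr inner_scalar11 innerDr innerZr (innerC u b).
  have -> : inner t%:M (b^T *m u) = t * inner b u.
    by rewrite tr_mul_inner inner_scalar11.
  by congr (0 <= _); ring.
have a0 : 0 <= a by have := quad 1 0; rewrite mulmx0 innerC inner0l innerC inner0l; lra.
have [az|ap] := eqVneq a 0.
  have b0 : b = 0.
    apply/eqP; rewrite -inner_eq0; apply/eqP/le_anti; rewrite inner_ge0 andbT leNgt; apply/negP => bp.
    (* With [a = 0] the form is affine in [t]; this [t] would give it the value -1. *)
    have := quad (- (inner b (C *m b) + 1) / (2 * inner b b)) b; rewrite az.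
    have -> : 0 * (- (inner b (C *m b) + 1) / (2 * inner b b)) ^+ 2
      + 2 * (- (inner b (C *m b) + 1) / (2 * inner b b)) * inner b b + inner b (C *m b) = -1.
      by field; rewrite gt_eqF.
    by rewrite oppr_ge0 ler10.
  have [L LE] : exists L : 'M[R]_p, C = L *m L^T.
    by apply: IH => // u; have := quad 0 u; rewrite az; lra.
  exists (block_mx 0 0 0 L); rewrite SE az b0 LE tr_block_mx mulmx_block !trmx0 !mulmx0 !mul0mx !addr0 add0r.
  by congr block_mx; apply/matrixP => i j; rewrite !mxE mul0rn.
have {}ap : 0 < a by rewrite lt_def ap.
have [L LE] : exists L : 'M[R]_p, C - a^-1 *: (b *m b^T) = L *m L^T.
  apply: IH => [|u]; first by rewrite linearB/= linearZ/= trmx_mul trmxK Cs.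
  rewrite mulmxBl innerDr innerNr -scalemxAl innerZr inner_rank1.
  have := quad (- inner b u / a) u; congr (0 <= _); field; by rewrite gt_eqF.
have sa : Num.sqrt a != 0 by rewrite sqrtr_eq0 -ltNge.
have sa2 : Num.sqrt a * Num.sqrt a = a by rewrite -expr2 sqr_sqrtr.
exists (block_mx (Num.sqrt a)%:M 0 ((Num.sqrt a)^-1 *: b) L).
rewrite SE tr_block_mx mulmx_block !trmx0 !mulmx0 !mul0mx !addr0 tr_scalar_mx -scalar_mxM sa2.
have -> : ((Num.sqrt a)^-1 *: b)^T = (Num.sqrt a)^-1 *: b^T by rewrite linearZ.
rewrite mul_scalar_mx scalerA mulfV// scale1r mul_mx_scalar scalerA mulfV// scale1r -scalemxAr.
rewrite -LE -scalemxAl scalerA -invfM sa2; congr block_mx.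
by rewrite addrC subrK.
Qed.

Lemma covariance_factor p (S : 'M[R]_p) : covariance_matrix S -> S \in unitmx ->
  exists2 L : 'M[R]_p, L \in unitmx & S = L *m L^T.
Proof.
move=> [Ss Sp] Su; have [|L LE] := psd_factor Ss.
  by move=> u; rewrite -dotE.
by exists L => //; move: Su; rewrite LE unitmx_mul => /andP[].
Qed.
End cholesky.

Section normal_linear_forms.
Variable R : realType.

Lemma measurable_coord p (i : 'I_p) : measurable_fun setT (fun v : borel_cV R p => (v : 'cV[R]_p) i 0).
Proof.
apply: (measurability _ (RGenOpens.measurableE R)).
move=> _ [_ [a [b ->]] <-]; rewrite setTI; apply: sub_sigma_algebra.
have /continuousP := @coord_continuous R p 1 i 0; apply.
exact: interval_open.
Qed.

Context d (T : measurableType d) (P : probability T R).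
Variables (p : nat) (mu : 'cV[R]_p) (Sigma : 'M[R]_p) (X : {RV P >-> borel_cV R p}).

Lemma mfmx_RV : mfmx (fun w => X w : 'cV[R]_p).
Proof.
move=> i j; rewrite (ord1 j).
exact: (measurableT_comp (measurable_coord i) (measurable_funPT X)).
Qed.

Lemma measurable_dot s : measurable_fun setT (fun w => dot s (X w)).
Proof.
rewrite (_ : (fun w => _) = (fun w => inner s (X w))); last by apply/funext => w; rewrite dotE.
by apply: measurable_inner; exact: mfmx_RV.
Qed.

Hypotheses (cS : covariance_matrix Sigma) (nX : multivariate_normal mu Sigma X).

Lemma measurable_cosB (m c : R) : measurable_fun setT (fun x : R => cos (x - m + c)).
Proof.
apply: (measurableT_comp (f := cos)); first by apply: continuous_measurable_fun; exact: continuous_cos.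
by apply: measurable_funD => //; exact: measurable_funB.
Qed.

Lemma mvn_standardize s : 0 < dot s (Sigma *m s) -> forall A : set R, measurable A ->
  normal_prob (0 : R) 1 A =
  P [set w | A ((dot s (X w) - dot s mu) / Num.sqrt (dot s (Sigma *m s)))].
Proof.
move=> v0 A mA; set v := dot s _ in v0 *.
have sv : Num.sqrt v != 0 by rewrite sqrtr_eq0 -ltNge.
pose s' := (Num.sqrt v)^-1 *: s.
have ds x : dot s' x = dot s x / Num.sqrt v by rewrite !dotE /s' innerZl mulrC.
have v1 : dot s' (Sigma *m s') = 1.
  rewrite ds /s' -scalemxAr dotE innerZr -dotE -/v mulrC mulrA -invfM -expr2 sqr_sqrtr ?ltW// mulVf// gt_eqF//.
pose A' := [set x | A (x - dot s' mu)].
have mA' : measurable A'.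
  rewrite -[X in measurable X]setTI.
  by apply: (measurable_funB (@measurable_id _ _ setT) (measurable_cst _)).
have := nX s' mA'; rewrite /normal_law v1 oner_eq0 sqrtr1 (normal_prob_unit_shift _ mA').
rewrite (_ : _ @^-1` A' = A); last by apply/seteqP; split => x; rewrite /A' /preimage/= addrK.
move=> <-; congr (P _); apply/seteqP; split => w; by rewrite /A' /= !ds mulrBl.
Qed.

Lemma mvn_cos s c : \int[P]_w cos (dot s (X w) - dot s mu + c) =
  cos c * expR (- dot s (Sigma *m s) / 2).
Proof.
have mY := measurable_dot s.
have v0 : 0 <= dot s (Sigma *m s) by exact: cS.2.
set v := dot s (Sigma *m s) in v0 *.
(* Zero variance does occur: in [gauss_whitened] the form [s] vanishes whenever a row of [t]
   does. *)
have [vz|vp] := eqVneq v 0.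
  rewrite vz oppr0 mul0r expR0 mulr1.
  have nuE (A : set R) : measurable A -> (\d_(dot s mu) : set (measurableTypeR R) -> \bar R) A = P ((fun w => dot s (X w)) @^-1` A).
    by move=> mA; have := nX s mA; rewrite /normal_law -/v vz eqxx => <-.
  have mf := measurable_cosB (dot s mu) c.
  rewrite /Rintegral -(integral_image mY nuE (f := fun x => (cos (x - dot s mu + c))%:E)).
    rewrite integral_dirac//; last exact/measurable_EFinP.
    by rewrite diracT mul1e /= subrr add0r.
  by apply: (@bounded_integrable _ _ _ (\d_(dot s mu)) _ 1) => // x; exact: cos_abs_le1.
have {}vp : 0 < v by rewrite lt_def vp.
have sv : Num.sqrt v != 0 by rewrite sqrtr_eq0 -ltNge.
pose phi w := (dot s (X w) - dot s mu) / Num.sqrt v.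
have mphi : measurable_fun setT phi by apply: measurable_funM => //; exact: measurable_funB.
have nuE (A : set R) : measurable A -> normal_prob (0 : R) 1 A = P (phi @^-1` A).
  by move=> mA; exact: (mvn_standardize vp mA).
have := normal_prob_cos c (Num.sqrt v); rewrite sqr_sqrtr// => <-.
rewrite /Rintegral (@integral_image _ _ T (measurableTypeR R) R P (normal_prob (0 : R) 1) phi mphi nuE (fun x => (cos (Num.sqrt v * x + c))%:E)); last first.
  apply: (@bounded_integrable _ _ _ (normal_prob 0 1) _ 1) => [|x]; last exact: cos_abs_le1.
  apply: (measurableT_comp (f := cos)); first by apply: continuous_measurable_fun; exact: continuous_cos.
  by apply: measurable_funD => //; exact: measurable_funM.
congr fine; apply: eq_integral => w _; rewrite /phi; congr ((cos (_ + c))%:E).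
by rewrite mulrC mulfVK.
Qed.
End normal_linear_forms.

Section whitening.
Variables (R : realType) (p : nat) (n : 'I_2 -> nat).
Variables (mu : 'I_2 -> 'cV[R]_p) (Sigma L : 'M[R]_p).
Hypotheses (Lu : L \in unitmx) (SL : Sigma = L *m L^T).

Definition sample_index : finType := {k : 'I_2 & 'I_(n k)}.
Definition sample_size := #|sample_index|.

Definition whiten (k : 'I_2) (v : 'cV[R]_p) : 'cV[R]_p := invmx L *m (v - mu k).

Definition whitened (x : forall k : 'I_2, 'I_(n k) -> 'cV[R]_p) : 'M[R]_(sample_size, p) :=
  \matrix_(i, j) whiten (tag (enum_val i)) (x (tag (enum_val i)) (tagged (enum_val i))) j 0.

Lemma sum_enum_val (V : zmodType) (F : sample_index -> V) :
  \sum_(i < sample_size) F (enum_val i) = \sum_i F i.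
Proof. exact/esym/(big_enum_val (A := [pred i : sample_index | true])). Qed.

Lemma sum_sample (V : zmodType) (F : sample_index -> V) :
  \sum_(i < sample_size) F (enum_val i) = \sum_(k < 2) \sum_(j < n k) F (Tagged (fun k => 'I_(n k)) j).
Proof.
rewrite sum_enum_val (sig_big_dep xpredT (fun _ => xpredT) (fun k (j : 'I_(n k)) => F (Tagged (fun k => 'I_(n k)) j))).
by apply: eq_bigr => -[].
Qed.

Section law.
Context d (T : measurableType d) (P : probability T R).
Variable X : forall k : 'I_2, 'I_(n k) -> {RV P >-> borel_cV R p}.
Arguments X : clear implicits.
Hypothesis cS : covariance_matrix Sigma.
Hypothesis nX : forall k j, multivariate_normal (mu k) Sigma (X k j).
Hypothesis iX : mutually_independent (fun i : {k : 'I_2 & 'I_(n k)} => X (tag i) (tagged i)).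

Lemma mfmx_whitened : mfmx (fun w => whitened (fun k j => X k j w)).
Proof.
move=> i j; rewrite (_ : (fun w => _) = (fun w => (invmx L *m (X (tag (enum_val i)) (tagged (enum_val i)) w - mu (tag (enum_val i)))) j 0)).
  apply: mfmxM; first exact: mfmx_cst.
  by apply: mfmxB; [exact: mfmx_RV|exact: mfmx_cst].
by apply/funext => w; rewrite mxE.
Qed.

(** The form [inner t z] is a sum of independent centered terms, one per observation, with
    coefficient vectors [s i = L^-T t_i] for the rows [t_i] of [t]. Their variances
    [s_i^T Sigma s_i] equal [|t_i|^2] and add up to [inner t t]. *)
Lemma gauss_whitened : gaussmx P (fun w => whitened (fun k j => X k j w)).
Proof.
split; first exact: mfmx_whitened.
move=> t c.
pose s (i : sample_index) : 'cV[R]_p := (invmx L)^T *m (row (enum_rank i) t)^T.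
pose Y (i : sample_index) w := dot (s i) (X (tag i) (tagged i) w) - dot (s i) (mu (tag i)).
pose psi (i : sample_index) := expR (- dot (s i) (Sigma *m s i) / 2).
have mY i : measurable_fun setT (Y i) by apply: measurable_funB => //; exact: measurable_dot.
have innerY w : inner t (whitened (fun k j => X k j w)) = \sum_i Y i w.
  rewrite /inner -(sum_enum_val (Y^~ w)).
  apply: eq_bigr => i _; rewrite /Y !dotE -innerNr -innerDr /s -inner_mull enum_valK.
  by rewrite /inner; apply: eq_bigr => j _; rewrite big_ord1 [_^T j 0]mxE [row _ _ 0 j]mxE [whitened _ _ _]mxE.
have cosY i c' : \int[P]_w cos (Y i w + c') = cos c' * psi i by exact: mvn_cos.
have indY (B : sample_index -> set R) : (forall i, measurable (B i)) ->
    P (\bigcap_(i in [set: sample_index]) (Y i @^-1` B i)) = (\prod_i P (Y i @^-1` B i))%E.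
  move=> mB.
  pose A i := [set v : borel_cV R p | B i (dot (s i) v - dot (s i) (mu (tag i)))].
  have mA i : measurable (A i).
    rewrite -[X in measurable X]setTI.
    have mf : measurable_fun setT (fun v : borel_cV R p => dot (s i) v - dot (s i) (mu (tag i))).
      apply: measurable_funB => //.
      rewrite (_ : dot (s i) = inner (s i)); last by apply/funext => v; exact: dotE.
      by apply: measurable_inner => k l; rewrite (ord1 l); exact: measurable_coord.
    exact: mf.
  exact: (iX mA).
have := indep_cos mY indY cosY c.
under eq_Rintegral do rewrite -innerY.
move=> ->; congr (_ * _); rewrite /psi -expR_sum; congr expR.
rewrite -mulr_suml; congr (_ / 2); rewrite sumrN; congr (- _).
have sE i : dot (s i) (Sigma *m s i) = \sum_j t (enum_rank i) j * t (enum_rank i) j.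
  rewrite dotE SL -mulmxA inner_mull.
  have -> : L^T *m s i = (row (enum_rank i) t)^T by rewrite /s mulmxA -trmx_mul mulVmx// trmx1 mul1mx.
  by rewrite /inner; apply: eq_bigr => j _; rewrite big_ord1 !mxE.
rewrite -(sum_enum_val (fun i => dot (s i) (Sigma *m s i))).
by apply: eq_bigr => i _; rewrite sE enum_valK.
Qed.
End law.

Section representation.
Hypothesis n0 : forall k, (0 < n k)%N.

Definition class_vector (k : 'I_2) : 'cV[R]_sample_size :=
  \col_i ((tag (enum_val i) == k)%:R / Num.sqrt (n k)%:R).

Let sn0 k : Num.sqrt (n k)%:R != 0 :> R.
Proof. by rewrite sqrtr_eq0 -ltNge ltr0n. Qed.

Let ssV k : (Num.sqrt (n k)%:R)^-1 * (Num.sqrt (n k)%:R)^-1 = (n k)%:R^-1 :> R.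
Proof. by rewrite -invfM -expr2 sqr_sqrtr// ler0n. Qed.

Lemma class_vector_inner k l : inner (class_vector k) (class_vector l) = (k == l)%:R.
Proof.
rewrite /inner; under eq_bigr do rewrite big_ord1 !mxE.
rewrite (sum_sample (fun i : sample_index => ((tag i == k)%:R / Num.sqrt (n k)%:R) * ((tag i == l)%:R / Num.sqrt (n l)%:R) : R)) /=.
rewrite (bigD1 k)//= [X in _ + X]big1 ?addr0 => [|i /negbTE ik]; last first.
  by rewrite big1// => j _; rewrite ik !mul0r.
rewrite sumr_const card_ord eqxx; have [<-|kl] := eqVneq k l; last by rewrite mul0r mulr0 mul0rn.
have -> : (true%:R : R) = 1 by [].
by rewrite !div1r ssV -[_ *+ n k]mulr_natr mulVf// pnatr_eq0 -lt0n.
Qed.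

Definition within : 'M[R]_sample_size :=
  1%:M - class_vector class1 *m (class_vector class1)^T - class_vector class2 *m (class_vector class2)^T.

Lemma proj_within : proj within.
Proof.
have p1 : proj (1%:M : 'M[R]_sample_size) := proj_mx1 _ _.
have i1 : inner (class_vector class1) (class_vector class1) = 1 by rewrite class_vector_inner eqxx.
have i2 : inner (class_vector class2) (class_vector class2) = 1 by rewrite class_vector_inner eqxx.
have i12 : inner (class_vector class1) (class_vector class2) = 0 by rewrite class_vector_inner.
have pD := proj_step p1 (mul1mx _) i1 erefl.
apply: (proj_step pD _ i2 erefl).
by rewrite mulmxBl mul1mx -mulmxA tr_mul_inner i12 mul_mx_scalar scale0r subr0.
Qed.

Lemma within_class k : within *m class_vector k = 0.
Proof.
have e l : (class_vector l)^T *m class_vector k = (l == k)%:R%:M.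
  by rewrite tr_mul_inner class_vector_inner.
rewrite /within !mulmxBl mul1mx -!mulmxA !e !mul_mx_scalar.
have : k = class1 \/ k = class2.
  by case: k {e} => -[|[|//]] i; [left|right]; apply/val_inj.
by case=> ->; rewrite !eqxx /= ?scale1r ?scale0r ?subr0 subrr.
Qed.

Lemma tr_within : \tr within = (n class1 + n class2)%:R - 2.
Proof.
rewrite /within !linearB/= mxtrace1 !(mxtrace_mulC (class_vector _)) -!innerE !class_vector_inner !eqxx.
have -> : (sample_size%:R : R) = (n class1 + n class2)%:R.
  rewrite -[in LHS](card_ord sample_size) -sum1_card natr_sum.
  rewrite (sum_sample (fun=> 1 : R)) big_ord_recl big_ord1 !sumr_const !card_ord natrD.
  by congr (_%:R + (n _)%:R); exact/val_inj.
by rewrite /=; ring.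
Qed.

Variable x : forall k : 'I_2, 'I_(n k) -> 'cV[R]_p.
Arguments x : clear implicits.

Definition class_mean (z : 'M[R]_(sample_size, p)) k : 'cV[R]_p :=
  (Num.sqrt (n k)%:R)^-1 *: (z^T *m class_vector k).

Let z := whitened x.
Let h := class_mean z.
Let r (i : sample_index) := whiten (tag i) (x (tag i) (tagged i)).

Let xE i : x (tag i) (tagged i) = mu (tag i) + L *m r i.
Proof. by rewrite /r /whiten mulmxA mulmxV// mul1mx addrC subrK. Qed.

Let hE k : h k = (n k)%:R^-1 *: \sum_(j < n k) r (Tagged (fun k => 'I_(n k)) j).
Proof.
have zE : z^T *m class_vector k = (Num.sqrt (n k)%:R)^-1 *: \sum_(j < n k) r (Tagged (fun k => 'I_(n k)) j).
  apply/matrixP => a b; rewrite (ord1 b) [LHS]mxE [RHS]mxE summxE.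
  pose F (i : sample_index) := r i a 0 * ((tag i == k)%:R / Num.sqrt (n k)%:R).
  have FE i : z^T a i * class_vector k i 0 = F (enum_val i).
    by rewrite /F /z mxE [X in X * _]mxE [X in _ * X]mxE.
  under eq_bigr do rewrite FE.
  rewrite sum_sample (bigD1 k)//= [X in _ + X]big1 ?addr0 => [|i /negbTE ik]; last first.
    by rewrite big1// => j _; rewrite /F /= ik mul0r mulr0.
  by rewrite mulrC mulr_suml; apply: eq_bigr => j _; rewrite /F /= eqxx mul1r.
by rewrite /h /class_mean zE scalerA -invfM -expr2 sqr_sqrtr.
Qed.

Lemma sample_meanE k : sample_mean x k = mu k + L *m h k.
Proof.
rewrite /sample_mean hE.
under eq_bigr => j _ do rewrite (xE (Tagged (fun k => 'I_(n k)) j)).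
rewrite big_split/= sumr_const card_ord -mulmx_sumr scalerDr -scalemxAr; congr (_ + _).
by rewrite -[mu k *+ _]scaler_nat scalerA mulVf ?scale1r// pnatr_eq0 -lt0n.
Qed.

(** The scatter within classes is the total scatter [z^T z] minus the terms [n_k h_k h_k^T] of the
    means, which is what the projection [within] removes. *)
Lemma pooled_covE : pooled_cov x = (\tr within)^-1 *: (L *m gram within z 1%:M *m L^T).
Proof.
rewrite /pooled_cov tr_within; congr (_ *: _).
have zz : z^T *m z = \sum_(k < 2) \sum_(j < n k) r (Tagged (fun k => 'I_(n k)) j) *m (r (Tagged (fun k => 'I_(n k)) j))^T.
  rewrite -(sum_sample (fun i => r i *m (r i)^T)); apply/matrixP => a b; rewrite mxE summxE.
  by apply: eq_bigr => i _; rewrite !mxE big_ord1 !mxE.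
have ze k : z^T *m class_vector k *m ((class_vector k)^T *m z) = (n k)%:R *: (h k *m (h k)^T).
  have -> : h k *m (h k)^T = (n k)%:R^-1 *: (z^T *m class_vector k *m (z^T *m class_vector k)^T).
    by rewrite /h /class_mean [(_ *: _)^T]linearZ/= -scalemxAl -scalemxAr scalerA ssV.
  by rewrite scalerA mulfV ?scale1r ?trmx_mul ?trmxK// pnatr_eq0 -lt0n.
have gE : gram within z 1%:M = \sum_(k < 2) ((\sum_(j < n k) r (Tagged (fun k => 'I_(n k)) j) *m (r (Tagged (fun k => 'I_(n k)) j))^T) - (n k)%:R *: (h k *m (h k)^T)).
  rewrite /gram !mulmx1 subrr addr0 /within !mulmxBr mulmx1 !mulmxBl zz.
  rewrite sumrB; rewrite -addrA -opprD; congr (_ - _).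
  rewrite big_ord_recl big_ord1 -!ze !mulmxA.
  by congr (_ + _); rewrite (_ : lift ord0 ord0 = class2)//; exact/val_inj.
rewrite gE mulmx_sumr mulmx_suml; apply: eq_bigr => k _.
have xr j : x k j - sample_mean x k = L *m (r (Tagged (fun k => 'I_(n k)) j) - h k).
  by rewrite (xE (Tagged (fun k => 'I_(n k)) j)) sample_meanE opprD addrACA subrr add0r mulmxBr.
under eq_bigr => j _ do rewrite xr trmx_mul mulmxA -(mulmxA L).
rewrite -mulmx_suml -mulmx_sumr; congr (L *m _ *m L^T).
under eq_bigr do rewrite linearB/= mulmxBl !mulmxBr.
have hs : \sum_(j < n k) r (Tagged (fun k => 'I_(n k)) j) = (n k)%:R *: h k.
  by rewrite hE scalerA mulfV ?scale1r// pnatr_eq0 -lt0n.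
have e1 : \sum_(j < n k) r (Tagged (fun k => 'I_(n k)) j) *m (h k)^T = (n k)%:R *: (h k *m (h k)^T).
  by rewrite -mulmx_suml hs -scalemxAl.
have e2 : \sum_(j < n k) h k *m (r (Tagged (fun k => 'I_(n k)) j))^T = (n k)%:R *: (h k *m (h k)^T).
  by rewrite -mulmx_sumr -linear_sum/= hs [(_ *: _)^T]linearZ/= -scalemxAr.
have e3 : \sum_(j < n k) h k *m (h k)^T = (n k)%:R *: (h k *m (h k)^T).
  by rewrite sumr_const card_ord scaler_nat.
by rewrite !sumrB e1 e2 e3 subrr subr0.
Qed.

Hypothesis Wu : gram within z 1%:M \in unitmx.
Hypothesis N0 : \tr within != 0.
Let G := invmx (gram within z 1%:M).
Let N := \tr within.
Let delta := invmx L *m (mu class1 - mu class2).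
Let d := delta + h class1 - h class2.

Let Gs : G^T = G.
Proof.
have p1 : proj (1%:M : 'M[R]_p) := proj_mx1 _ _.
by rewrite /G trmx_inv gram_sym//; case: proj_within.
Qed.

Let mean_diffE : mean_diff x = L *m d.
Proof.
rewrite /mean_diff !sample_meanE /d !mulmxDr mulmxN /delta mulmxA mulmxV// mul1mx.
by rewrite opprD addrACA addrA.
Qed.

Let inv_covE : invmx (pooled_cov x) = N *: ((invmx L)^T *m G *m invmx L).
Proof.
have LTu : L^T \in unitmx by rewrite unitmx_tr.
have Su : pooled_cov x \in unitmx.
  rewrite pooled_covE unitmxZ ?unitfE ?invr_eq0//; first by rewrite !unitmx_mul Lu Wu LTu.
suff E : pooled_cov x *m (N *: ((invmx L)^T *m G *m invmx L)) = 1%:M.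
  by rewrite -[LHS]mulmx1 -E mulKmx.
rewrite pooled_covE -scalemxAl -scalemxAr scalerA mulVf// scale1r.
rewrite -!mulmxA (mulmxA L^T) -trmx_mul mulVmx// trmx1 mul1mx (mulmxA (gram _ _ _)) mulmxV// mul1mx mulmxV//.
Qed.

Let inv_cov_diff : invmx (pooled_cov x) *m mean_diff x = N *: ((invmx L)^T *m (G *m d)).
Proof.
by rewrite inv_covE mean_diffE -scalemxAl -!mulmxA (mulmxA (invmx L)) mulVmx// mul1mx.
Qed.

Let margin v : dot (L *m v) (invmx (pooled_cov x) *m mean_diff x) = N * inner v (G *m d).
Proof.
by rewrite inv_cov_diff dotE innerZr inner_mull trmxK mulKmx.
Qed.

Let spread : dot (mean_diff x) (invmx (pooled_cov x) *m Sigma *m invmx (pooled_cov x) *m mean_diff x) =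
  N ^+ 2 * inner (G *m d) (G *m d).
Proof.
have -> : invmx (pooled_cov x) *m Sigma *m invmx (pooled_cov x) *m mean_diff x =
    N ^+ 2 *: ((invmx L)^T *m (G *m (G *m d))).
  rewrite -!mulmxA inv_cov_diff SL -!scalemxAr -!mulmxA (mulmxA L^T) -trmx_mul mulVmx// trmx1 mul1mx.
  by rewrite inv_covE -scalemxAl -!mulmxA mulKmx// scalerA expr2.
by rewrite mean_diffE dotE innerZr inner_mull trmxK mulKmx// [inner d _]inner_mull Gs.
Qed.

Let midpointE : midpoint x = 2^-1 *: (mu class1 + L *m h class1 + (mu class2 + L *m h class2)).
Proof. by rewrite /midpoint !sample_meanE. Qed.

Let Ld : L *m d = mu class1 - mu class2 + L *m h class1 - L *m h class2.
Proof. by rewrite /d !mulmxDr mulmxN /delta mulmxA mulmxV// mul1mx. Qed.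

Let center1 : mu class1 - midpoint x = L *m (2^-1 *: d - h class1).
Proof.
rewrite midpointE mulmxBr -[L *m (2^-1 *: d)]scalemxAr Ld.
by move: (L *m h class1) (L *m h class2) => A B; apply/matrixP => i j; rewrite !mxE; field.
Qed.

Let center2 : mu class2 - midpoint x = L *m (- (2^-1 *: d) - h class2).
Proof.
rewrite midpointE mulmxBr mulmxN -[L *m (2^-1 *: d)]scalemxAr Ld.
by move: (L *m h class1) (L *m h class2) => A B; apply/matrixP => i j; rewrite !mxE; field.
Qed.

(** The whitening factor cancels: the inverse of the pooled covariance is [N L^-T G L^-1], the mean
    difference is [L d], and the centered class means are [L (d / 2 - h_1)] and
    [L (- d / 2 - h_2)]. *)
Lemma lda_rate_formula_whitened :
  lda_rate_formula x mu Sigma =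
  2^-1 * (Phi ((N * inner (h class1) (G *m d) - N * inner d (G *m d) / 2) /
             Num.sqrt (N ^+ 2 * inner (G *m d) (G *m d))) +
          Phi ((- (N * inner (h class2) (G *m d)) - N * inner d (G *m d) / 2) /
             Num.sqrt (N ^+ 2 * inner (G *m d) (G *m d)))).
Proof.
have sum2 (F : 'I_2 -> R) : \sum_k F k = F class1 + F class2.
  by rewrite big_ord_recl big_ord1; congr (F _ + F _); exact/val_inj.
have e1 : (-1) ^+ class1.+1 * dot (mu class1 - midpoint x) (invmx (pooled_cov x) *m mean_diff x) =
    N * inner (h class1) (G *m d) - N * inner d (G *m d) / 2.
  rewrite center1 margin innerDl innerZl innerNl /= expr1.
  by move: (inner _ _) (inner _ _) => A B; ring.
have e2 : (-1) ^+ class2.+1 * dot (mu class2 - midpoint x) (invmx (pooled_cov x) *m mean_diff x) =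
    - (N * inner (h class2) (G *m d)) - N * inner d (G *m d) / 2.
  rewrite center2 margin innerDl !innerNl innerZl /= sqrrN expr1n.
  by move: (inner _ _) (inner _ _) => A B; ring.
by rewrite /lda_rate_formula sum2 e1 e2 spread.
Qed.
End representation.
End whitening.

(** * Asymptotics of the rate *)

Section normal_cdf.
Variable R : realType.

Lemma Phi_lipschitz_le (a b : R) : a <= b -> `|Phi b - Phi a| <= normal_peak 1 * (b - a).
Proof.
move=> ab.
have m1 : measurable (`]-oo, a] : set (measurableTypeR R)) by exact: measurable_itv.
have m2 : measurable (`]a, b] : set (measurableTypeR R)) by exact: measurable_itv.
have fin A : measurable A -> normal_prob (0 : R) 1 A \is a fin_num by move=> mA; exact: fin_num_measure.
have U : (`]-oo, b]%classic : set R) = `]-oo, a]%classic `|` `]a, b]%classic.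
  apply/seteqP; split => x /=; rewrite !in_itv/=.
    by move=> xb; case: (leP x a) => [xa|ax]; [by left|by right; rewrite ?ax].
  by case=> [xa|/andP[]//]; exact: le_trans xa ab.
have -> : Phi b = Phi a + fine (normal_prob (0 : R) 1 `]a, b]).
  rewrite /Phi U measureU//; last first.
    by apply/seteqP; split => // x [] /=; rewrite !in_itv/= => xa /andP[]; rewrite ltNge xa.
  by rewrite fineD// fin.
rewrite addrC addKr ger0_norm ?fine_ge0// -lee_fin fineK ?fin//.
apply: (@le_trans _ _ (\int[lebesgue_measure]_(x in `]a, b]) (cst (normal_peak 1)%:E x))%E).
  apply: ge0_le_integral => //.
  - by move=> x _; rewrite lee_fin normal_pdf_ge0.
  - by apply/measurable_EFinP; apply: measurable_funTS; exact: measurable_normal_pdf.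
  - by move=> x _; rewrite lee_fin normal_pdf_ub// oner_neq0.
rewrite integral_cst//= lebesgue_measure_itv/= lte_fin; case: ltP => [_|ba].
  by rewrite -EFinD EFinM.
by rewrite mule0 lee_fin mulr_ge0 ?normal_peak_ge0// subr_ge0.
Qed.

Lemma Phi_continuous : continuous (@Phi R).
Proof.
have c0 : 0 < normal_peak 1 :> R by exact/normal_peak_gt0/oner_neq0.
have lip (a b : R) : `|Phi b - Phi a| <= normal_peak 1 * `|b - a|.
  have [ab|/ltW ba] := leP a b; first by rewrite [`|b - a|]ger0_norm ?subr_ge0//; exact: Phi_lipschitz_le.
  by rewrite distrC [`|b - a|]distrC [`|a - b|]ger0_norm ?subr_ge0//; exact: Phi_lipschitz_le.
move=> x; apply/cvgrPdist_lt => e e0.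
have d0 : 0 < (normal_peak 1)^-1 * e by rewrite mulr_gt0// invr_gt0.
apply/nbhs_ballP; exists ((normal_peak 1)^-1 * e) => // y xy.
by apply: le_lt_trans (lip _ _) _; rewrite -ltr_pdivlMl.
Qed.

Lemma measurable_Phi : measurable_fun setT (@Phi R).
Proof. by apply: continuous_measurable_fun; exact: Phi_continuous. Qed.

(** The root of [k^3 D] is [k sqrt k sqrt D]: one factor [k] cancels against the numerator,
    [1 / sqrt k] is [sqrt (1 - y)], and [D - 2 y1 = Delta^2 - (y1 - y2)]. *)
Lemma sqrt_moment (k D y1 y2 Delta y : R) : 0 < 1 - y -> k = (1 - y)^-1 -> D = Delta ^+ 2 + y1 + y2 -> 0 < D ->
  (k * y1 - k * D / 2) / Num.sqrt (k ^+ 3 * D) =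
  - ((Delta ^+ 2 - (y1 - y2)) / (2 * Num.sqrt D)) * Num.sqrt (1 - y).
Proof.
move=> y0 kE DE D0.
have k0 : 0 < k by rewrite kE invr_gt0.
have -> : Num.sqrt (k ^+ 3 * D) = k * Num.sqrt k * Num.sqrt D.
  have -> : k ^+ 3 * D = (k ^+ 2 * k) * D by ring.
  rewrite sqrtrM; last by rewrite mulr_ge0 ?sqr_ge0// ltW.
  by rewrite sqrtrM ?sqr_ge0// sqrtr_sqr gtr0_norm.
have -> : Num.sqrt (1 - y) = (Num.sqrt k)^-1 by rewrite kE sqrtrV ?ltW// invrK.
have sk : Num.sqrt k != 0 by rewrite sqrtr_eq0 -ltNge.
have sD : Num.sqrt D != 0 by rewrite sqrtr_eq0 -ltNge.
rewrite [in k * D / 2]DE; field; by rewrite sk sD gt_eqF.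
Qed.

(** [A], [B1], [B2], [C] stand for [N d^T W^-1 d], [N h_1^T W^-1 d], [N h_2^T W^-1 d] and
    [N^2 d^T W^-2 d]. The limit of [B2] is negative because [h_2] enters [d] with a minus sign. *)
Lemma rate_limit (y1 y2 y Delta e : R) : 0 < 1 - y -> 0 < Delta ^+ 2 + y1 + y2 -> 0 < e ->
  let k := (1 - y)^-1 in let D := Delta ^+ 2 + y1 + y2 in
  exists2 t : R, 0 < t & forall A B1 B2 C, `|A - k * D| < t -> `|B1 - k * y1| < t ->
    `|B2 - - (k * y2)| < t -> `|C - k ^+ 3 * D| < t ->
  `|2^-1 * (Phi ((B1 - A / 2) / Num.sqrt C) + Phi ((- B2 - A / 2) / Num.sqrt C)) -
    2^-1 * (Phi (- ((Delta ^+ 2 - (y1 - y2)) / (2 * Num.sqrt D)) * Num.sqrt (1 - y)) +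
            Phi (- ((Delta ^+ 2 + (y1 - y2)) / (2 * Num.sqrt D)) * Num.sqrt (1 - y)))| < e.
Proof.
move=> y0 D0 e0 k D.
have k0 : 0 < k by rewrite invr_gt0.
pose F (t : (R * R) * (R * R)) := 2^-1 * (Phi ((t.2.1 - t.1.1 / 2) / Num.sqrt t.1.2) +
  Phi ((- t.2.2 - t.1.1 / 2) / Num.sqrt t.1.2)).
pose t0 := ((k * D, k ^+ 3 * D), (k * y1, - (k * y2))).
have sC : Num.sqrt (k ^+ 3 * D) != 0 by rewrite sqrtr_eq0 -ltNge mulr_gt0 ?exprn_gt0.
have pfst : (fst : (R * R) * (R * R) -> R * R) @ t0 --> t0.1 by exact: cvg_fst.
have psnd : (snd : (R * R) * (R * R) -> R * R) @ t0 --> t0.2 by exact: cvg_snd.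
have cPhi (f : (R * R) * (R * R) -> R) l : f @ t0 --> l -> Phi (f t) @[t --> t0] --> Phi l.
  by move=> h; exact: (cvg_comp _ _ h (@Phi_continuous l)).
have c11 : (fun t : (R * R) * (R * R) => t.1.1) @ t0 --> k * D.
  exact: (cvg_comp _ _ pfst cvg_fst).
have c12 : (fun t : (R * R) * (R * R) => t.1.2) @ t0 --> k ^+ 3 * D.
  exact: (cvg_comp _ _ pfst cvg_snd).
have c21 : (fun t : (R * R) * (R * R) => t.2.1) @ t0 --> k * y1.
  exact: (cvg_comp _ _ psnd cvg_fst).
have c22 : (fun t : (R * R) * (R * R) => t.2.2) @ t0 --> - (k * y2).
  exact: (cvg_comp _ _ psnd cvg_snd).
have cS : (fun t : (R * R) * (R * R) => (Num.sqrt t.1.2)^-1) @ t0 --> (Num.sqrt (k ^+ 3 * D))^-1.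
  apply: cvgV => //; apply: (cvg_comp _ _ c12); exact: sqrt_continuous.
have cF : F @ t0 --> F t0.
  apply: cvgM; first exact: cvg_cst.
  apply: cvgD.
    apply: cPhi; apply: cvgM => //.
    by apply: cvgB => //; apply: cvgM => //; exact: cvg_cst.
  apply: cPhi; apply: cvgM => //.
  apply: cvgB; first exact: cvgN.
  by apply: cvgM => //; exact: cvg_cst.
have FE : F t0 = 2^-1 * (Phi (- ((Delta ^+ 2 - (y1 - y2)) / (2 * Num.sqrt D)) * Num.sqrt (1 - y)) +
            Phi (- ((Delta ^+ 2 + (y1 - y2)) / (2 * Num.sqrt D)) * Num.sqrt (1 - y))).
  rewrite /F /= (sqrt_moment y0 (erefl k) (erefl D) D0) opprK.
  have DE : D = Delta ^+ 2 + y2 + y1 by rewrite /D addrAC.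
  by rewrite (sqrt_moment y0 (erefl k) DE D0) -[y1 - y2]opprB opprK.
have /cvgrPdist_lt/(_ _ e0)/nbhs_ballP[t tp h] := cF.
exists t => // A B1 B2 C h1 h2 h3 h4; rewrite distrC -FE.
have := h ((A, C), (B1, B2)); rewrite /F /=; apply.
by split; split; rewrite /ball/= distrC.
Qed.
End normal_cdf.

Section second_moment_bounds.
Variable R : realType.
Context d (T : measurableType d) (P : probability T R).

Lemma prob_setU_le (A B : set T) (a b : R) : measurable A -> measurable B ->
  (P A <= a%:E)%E -> (P B <= b%:E)%E -> (P (A `|` B) <= (a + b)%:E)%E.
Proof.
by move=> mA mB Aa Bb; apply: le_trans (measureU2 _ mA mB) _; rewrite EFinD leeD.
Qed.

Variables (n p : nat) (z : T -> 'M[R]_(n, p)).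
Hypothesis gz : gaussmx P z.
Let mz : mfmx z. Proof. by case: gz. Qed.

Lemma gauss_inner_conc (t : 'M[R]_(n, p)) (eta : R) : 0 < eta ->
  (P [set w | (eta <= `|inner t (z w)|)%R] <= (inner t t / eta ^+ 2)%:E)%E.
Proof.
by move=> eta0; apply: chebyshev_sqr => //; [exact: measurable_inner|exact: gauss_sqr].
Qed.

Lemma gauss_norm_conc (e : 'cV[R]_n) (eta : R) : inner e e = 1 -> 0 < eta ->
  (P [set w | (eta <= `|inner ((z w)^T *m e) ((z w)^T *m e) - p%:R|)%R] <= (2 * p%:R / eta ^+ 2)%:E)%E.
Proof.
move=> e1 eta0.
have := gauss_proj_chebyshev (gauss_tr_mul gz e1) (trmx1 _ _) (mulmx1 _) eta0.
rewrite mxtrace1 => h; apply: le_trans h; rewrite le_eqVlt; apply/orP; left; apply/eqP.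
by congr (P _); apply/seteqP; split => w /=; rewrite mul1mx.
Qed.

(** Polarization: with the unit vectors [(e + f) / sqrt 2] and [(e - f) / sqrt 2] the cross product
    is half a difference of two squared norms, whose common center [p] cancels. *)
Lemma gauss_cross_conc (e f : 'cV[R]_n) (eta : R) : inner e e = 1 -> inner f f = 1 -> inner e f = 0 ->
  0 < eta ->
  (P [set w | (eta <= `|inner ((z w)^T *m e) ((z w)^T *m f)|)%R] <= (4 * p%:R / eta ^+ 2)%:E)%E.
Proof.
move=> e1 f1 ef eta0.
have s20 : Num.sqrt 2 != 0 :> R by rewrite sqrtr_eq0 -ltNge ltr0n.
have s2 : (Num.sqrt 2)^-1 * (Num.sqrt 2)^-1 = 2^-1 :> R by rewrite -invfM -expr2 sqr_sqrtr// ler0n.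
pose a : 'cV[R]_n := (Num.sqrt 2)^-1 *: (e + f); pose b : 'cV[R]_n := (Num.sqrt 2)^-1 *: (e - f).
have a1 : inner a a = 1.
  by rewrite innerZl innerZr mulrA s2 innerDl !innerDr (innerC f e) e1 f1 ef; field.
have b1 : inner b b = 1.
  by rewrite innerZl innerZr mulrA s2 innerDl !innerDr !innerNl !innerNr (innerC f e) e1 f1 ef; field.
have mS (c : 'cV[R]_n) : measurable [set w | eta <= `|inner ((z w)^T *m c) ((z w)^T *m c) - p%:R|].
  apply: measurable_dist_ge; apply: measurable_inner_fun; apply: mfmxM; try exact: mfmx_tr; exact: mfmx_cst.
have -> : 4 * p%:R / eta ^+ 2 = 2 * p%:R / eta ^+ 2 + 2 * p%:R / eta ^+ 2 by field; rewrite gt_eqF.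
apply: le_trans (prob_setU_le (mS a) (mS b) (gauss_norm_conc a1 eta0) (gauss_norm_conc b1 eta0)).
apply: le_measure; rewrite ?inE.
- rewrite (_ : [set w | _] = [set w | eta <= `|inner ((z w)^T *m e) ((z w)^T *m f) - 0|]); last first.
    by apply/seteqP; split => w /=; rewrite subr0.
  apply: measurable_dist_ge; apply: measurable_inner_fun; apply: mfmxM; try exact: mfmx_tr; exact: mfmx_cst.
- by apply: measurableU; exact: mS.
- move=> w /= h; apply: contrapT => /not_orP[/negP + /negP]; rewrite -!ltNge => ha hb.
  move: h; apply/negP; rewrite -ltNge.
  have E : inner ((z w)^T *m e) ((z w)^T *m f) =
      ((inner ((z w)^T *m a) ((z w)^T *m a) - p%:R) - (inner ((z w)^T *m b) ((z w)^T *m b) - p%:R)) / 2.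
    rewrite /a /b -!scalemxAr !innerZl !innerZr !mulrA s2 !mulmxDr mulmxN.
    rewrite !innerDl !innerDr !innerNl !innerNr (innerC ((z w)^T *m f) ((z w)^T *m e)).
    by move: (inner _ _) (inner _ _) (inner _ _) => x1 x2 x3; field.
  rewrite E normrM (@ger0_norm _ 2^-1)// ltr_pdivrMr//.
  apply: le_lt_trans (ler_normB _ _) _; rewrite mulr_natr mulr2n; exact: ltrD.
Qed.
End second_moment_bounds.

Section quadratic_forms.
Variable R : realType.

(** Homogeneous form of [inverse_moments_bad] for vectors of any length. The inequalities are strict
    so that [v = 0] contributes no bad sample beyond the singular ones. *)
Definition quad_bad (n p : nat) (M : 'M[R]_n) (y e : R) (v : 'cV[R]_p) : set 'M[R]_(n, p) :=
  [set z | gram M z 1%:M \notin unitmx] `|`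
  ([set z | e * inner v v < `|\tr M * inner v (invmx (gram M z 1%:M) *m v) - (1 - y)^-1 * inner v v|] `|`
   [set z | e * inner v v < `|\tr M ^+ 2 * inner (invmx (gram M z 1%:M) *m v) (invmx (gram M z 1%:M) *m v)
      - (1 - y)^-1 ^+ 3 * inner v v|]).

Lemma measurable_quad_bad d (T : measurableType d) (n p : nat) (M : 'M[R]_n) (y e : R)
  (v : T -> 'cV[R]_p) (z : T -> 'M[R]_(n, p)) : mfmx z -> mfmx v ->
  measurable [set w | quad_bad M y e (v w) (z w)].
Proof.
move=> mz mv; apply: measurableU; first exact: measurable_gram_singular.
have mvv : measurable_fun setT (fun w => inner (v w) (v w)) by exact: measurable_inner_fun.
have mG : mfmx (fun w => invmx (gram M (z w) 1%:M) *m v w).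
  by apply: mfmxM => //; apply: mfmx_inv; exact: mfmx_gram.
have lt_set (f g : T -> R) : measurable_fun setT f -> measurable_fun setT g -> measurable [set w | f w < g w].
  move=> mf mg; rewrite (_ : [set w | _] = ~` [set w | 0 <= f w - g w]).
    by apply: measurableC; apply: measurable_ge_set; exact: measurable_funB.
  by apply/seteqP; split => w /=; rewrite subr_ge0 leNgt; [move=> h /negP|move=> /negP; rewrite negbK].
by apply: measurableU; apply: lt_set; try (apply: measurable_funM => //);
  apply: measurableT_comp => //; apply: measurable_funB; apply: measurable_funM => //;
  exact: measurable_inner_fun.
Qed.

Lemma gram_mulM n p (M : 'M[R]_n) (z : 'M[R]_(n, p)) D : proj M -> gram M (M *m z) D = gram M z D.
Proof.
move=> [Ms MM]; rewrite /gram; congr (_ + _).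
by rewrite -[M *m z *m D]mulmxA trmx_mul Ms !mulmxA -(mulmxA _ M M) MM -(mulmxA _ M M) MM.
Qed.

Section law.
Context d (T : measurableType d) (P : probability T R).
Variables (n p : nat) (z : T -> 'M[R]_(n, p)) (M : 'M[R]_n) (y e r : R).
Hypotheses (gz : gaussmx P z) (pM : proj M) (p0 : (0 < p)%N).
Hypothesis Hu : forall u : 'cV[R]_p, inner u u = 1 ->
  (P [set w | inverse_moments_bad M y e u (z w)] <= r%:E)%E.
Let mz : mfmx z. Proof. by case: gz. Qed.

Lemma quad_bad_le (v : 'cV[R]_p) : (P [set w | quad_bad M y e v (z w)] <= r%:E)%E.
Proof.
have [u [u1 vu]] : exists u : 'cV[R]_p, inner u u = 1 /\ v = Num.sqrt (inner v v) *: u.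
  have [->|v0] := eqVneq v 0.
    exists (delta_mx (Ordinal p0) 0); split; first by rewrite inner_delta mxE !eqxx.
    by rewrite inner0l sqrtr0 scale0r.
  have q0 : 0 < inner v v by rewrite lt_def inner_eq0 v0 inner_ge0.
  have s0 : Num.sqrt (inner v v) != 0 by rewrite sqrtr_eq0 -ltNge.
  exists ((Num.sqrt (inner v v))^-1 *: v); split; last by rewrite scalerA mulfV// scale1r.
  by rewrite innerZl innerZr mulrA -invfM -expr2 sqr_sqrtr ?ltW// mulVf// gt_eqF.
apply: le_trans (Hu u1); apply: le_measure; rewrite ?inE.
- by apply: measurable_quad_bad => //; exact: mfmx_cst.
- exact: measurable_inverse_moments_bad.
move=> w; have [c [c0 cE]] : exists c, 0 <= c /\ v = c *: u by exists (Num.sqrt (inner v v)).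
have vv : inner v v = c ^+ 2 by rewrite cE innerZl innerZr u1 mulr1 expr2.
have key X Y : X = c ^+ 2 * Y -> e * c ^+ 2 < `|X| -> e <= `|Y|.
  move=> -> h; rewrite leNgt; apply/negP => Ye; move: h; apply/negP; rewrite -leNgt.
  by rewrite normrM ger0_norm ?sqr_ge0// mulrC ler_wpM2r ?sqr_ge0// ltW.
have vG : invmx (gram M (z w) 1%:M) *m v = c *: (invmx (gram M (z w) 1%:M) *m u) by rewrite cE -scalemxAr.
case=> [Wu|[h|h]]; [by left|right; left; move: h => /=|right; right; move: h => /=]; rewrite vv vG.
- by apply: key; rewrite [in inner v _]cE innerZl innerZr; ring.
- by apply: key; rewrite innerZl innerZr; ring.
Qed.

(** The vector depends on [(1 - M) z] alone and the Gram matrix on [M z] alone. After resampling the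
    [M] part, the vector is constant on each section, where [quad_bad_le] applies. *)
Lemma quad_bad_random_le (f : 'M[R]_(n, p) -> 'cV[R]_p) :
  mfmx (fun N : mxT R n p => f N) ->
  (forall A B, f ((1%:M - M) *m A + M *m B) = f A) ->
  (P [set w | quad_bad M y e (f (z w)) (z w)] <= r%:E)%E.
Proof.
move=> mf fM; have [Ms MM] := pM.
pose A := [set N : 'M[R]_(n, p) | quad_bad M y e (f N) N].
have mA : measurable (A : set (mxT R n p)) by apply: measurable_quad_bad => //; exact: mfmx_id.
have gz' := resample_left gz pM.
rewrite (gauss_law (A := A) gz gz' mA).
apply: prod_measure_le.
  by rewrite -[X in measurable X]setTI; apply: (measurable_mx gz'.1).
move=> w1; apply: le_trans (quad_bad_le (f (z w1))).
rewrite le_eqVlt; apply/orP; left; apply/eqP; congr (P _); apply/seteqP.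
have E w2 : A ((1%:M - M) *m z w1 + M *m z w2) = quad_bad M y e (f (z w1)) (z w2).
  rewrite /A /= fM /quad_bad /= -(gram_mulM ((1%:M - M) *m z w1 + M *m z w2) _ pM).
  have -> : M *m ((1%:M - M) *m z w1 + M *m z w2) = M *m z w2.
    by rewrite mulmxDr mulmxA mulmxBr mulmx1 MM subrr mul0mx add0r mulmxA MM.
  by rewrite gram_mulM.
by split => w2 /=; rewrite E.
Qed.
End law.
End quadratic_forms.

Section tolerances.
Variable R : realType.

(** [X1], [X2], [c], [a1], [a2] are [|h_1|^2], [|h_2|^2], [h_1 . h_2], [delta . h_1], [delta . h_2];
    the three expressions are [|d|^2], [h_1 . d] and [h_2 . d] expanded, and 8 and 3 are the sums of
    their coefficients. *)
Lemma moments_tolerance (D2 y1 y2 X1 X2 c a1 a2 s : R) :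
  `|X1 - y1| < s -> `|X2 - y2| < s -> `|c| < s -> `|a1| < s -> `|a2| < s ->
  [/\ `|D2 + X1 + X2 + 2 * a1 - 2 * a2 - 2 * c - (D2 + y1 + y2)| < 8 * s,
      `|a1 + X1 - c - y1| < 3 * s & `|a2 + c - X2 - - y2| < 3 * s].
Proof.
rewrite !ltr_norml => /andP[? ?] /andP[? ?] /andP[? ?] /andP[? ?] /andP[? ?].
by split; apply/andP; split; lra.
Qed.

Lemma quad_tolerance (k D A dd B e s t : R) : 0 < k -> 0 < e -> 0 < t -> e * B <= t / 4 -> 8 * k * s <= t / 4 ->
  dd <= B -> `|A - k * dd| <= e * dd -> `|dd - D| < 8 * s -> `|A - k * D| < t.
Proof.
move=> k0 e0 t0 eB ks dB hA hD.
have -> : A - k * D = (A - k * dd) + k * (dd - D) by ring.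
apply: le_lt_trans (ler_normD _ _) _; rewrite normrM (gtr0_norm k0).
have h1 : k * `|dd - D| < k * (8 * s) by rewrite ltr_pM2l.
have h2 : e * dd <= e * B by rewrite ler_pM2l.
lra.
Qed.

(** [Vp] and [Vm] are the squared norms of [h + d] and [h - d], [Qp] and [Qm] their inverse forms,
    and [m] is [h . d]. *)
Lemma polar_tolerance (k m y Qp Qm Vp Vm B e s t : R) : 0 < k -> 0 < e -> 0 < t -> e * B <= t / 4 ->
  8 * k * s <= t / 4 -> Vp + Vm <= 2 * B -> Vp - Vm = 4 * m ->
  `|Qp - k * Vp| <= e * Vp -> `|Qm - k * Vm| <= e * Vm -> `|m - y| < 3 * s ->
  `|(Qp - Qm) / 4 - k * y| < t.
Proof.
move=> k0 e0 t0 eB ks VB Vd hp hm my.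
have -> : (Qp - Qm) / 4 - k * y = ((Qp - k * Vp) - (Qm - k * Vm)) / 4 + k * (m - y).
  have -> : m = (Vp - Vm) / 4 by rewrite Vd; field.
  by field.
apply: le_lt_trans (ler_normD _ _) _; rewrite [`|k * _|]normrM (gtr0_norm k0).
rewrite normrM (@ger0_norm _ 4^-1)//.
have h0 := ler_normB (Qp - k * Vp) (Qm - k * Vm).
have h1 : k * `|m - y| < k * (3 * s) by rewrite ltr_pM2l.
have h2 : e * (Vp + Vm) <= e * (2 * B) by rewrite ler_pM2l.
have h3 : 0 <= k * (3 * s) by rewrite mulr_ge0 ?ltW// (le_lt_trans _ my).
lra.
Qed.
End tolerances.

Section whitened_rate.
Variables (R : realType) (n p : nat) (M : 'M[R]_n) (e1 e2 : 'cV[R]_n) (s1 s2 : R) (delta : 'cV[R]_p).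
Implicit Types z : 'M[R]_(n, p).

Definition group_mean (s : R) (e : 'cV[R]_n) z : 'cV[R]_p := s^-1 *: (z^T *m e).

Definition group_diff z := delta + group_mean s1 e1 z - group_mean s2 e2 z.

Definition whitened_rate z : R :=
  let G := invmx (gram M z 1%:M) in
  let N := \tr M in
  let d := group_diff z in
  2^-1 * (Phi ((N * inner (group_mean s1 e1 z) (G *m d) - N * inner d (G *m d) / 2) /
             Num.sqrt (N ^+ 2 * inner (G *m d) (G *m d))) +
          Phi ((- (N * inner (group_mean s2 e2 z) (G *m d)) - N * inner d (G *m d) / 2) /
             Num.sqrt (N ^+ 2 * inner (G *m d) (G *m d)))).

Section measurability.
Context d (T : measurableType d) (z : T -> 'M[R]_(n, p)).
Hypothesis mz : mfmx z.

Lemma mfmx_group_mean s e : mfmx (fun w => group_mean s e (z w)).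
Proof.
apply: mfmxZ; first exact: measurable_cst.
by apply: mfmxM; [exact: mfmx_tr|exact: mfmx_cst].
Qed.

Lemma mfmx_group_diff : mfmx (fun w => group_diff (z w)).
Proof.
apply: mfmxB; last exact: mfmx_group_mean.
by apply: mfmxD; [exact: mfmx_cst|exact: mfmx_group_mean].
Qed.

Lemma measurable_whitened_rate : measurable_fun setT (fun w => whitened_rate (z w)).
Proof.
have mG : mfmx (fun w => invmx (gram M (z w) 1%:M) *m group_diff (z w)).
  by apply: mfmxM; [apply: mfmx_inv; exact: mfmx_gram|exact: mfmx_group_diff].
have md := mfmx_group_diff.
have mi m' k (f g : T -> 'M[R]_(m', k)) c : mfmx f -> mfmx g -> measurable_fun setT (fun w => c * inner (f w) (g w)).
  by move=> mf mg; apply: measurable_funM => //; exact: measurable_inner_fun.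
have mS : measurable_fun setT (fun w => (Num.sqrt (\tr M ^+ 2 *
    inner (invmx (gram M (z w) 1%:M) *m group_diff (z w)) (invmx (gram M (z w) 1%:M) *m group_diff (z w))))^-1).
  apply: measurableT_comp; first exact: measurable_inv.
  apply: (measurableT_comp (f := @Num.sqrt R)); last exact: mi.
  by apply: continuous_measurable_fun; exact: sqrt_continuous.
apply: measurable_funM => //; apply: measurable_funD.
  apply: (measurableT_comp (@measurable_Phi R)); apply: measurable_funM => //.
  apply: measurable_funB; first by apply: mi => //; exact: mfmx_group_mean.
  by apply: measurable_funM => //; exact: mi.
apply: (measurableT_comp (@measurable_Phi R)); apply: measurable_funM => //.
apply: measurable_funB.
  by apply: measurableT_comp => //; apply: mi => //; exact: mfmx_group_mean.
by apply: measurable_funM => //; exact: mi.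
Qed.
End measurability.

Lemma group_mean_between s e A B : M^T = M -> M *m e = 0 ->
  group_mean s e ((1%:M - M) *m A + M *m B) = group_mean s e A.
Proof.
move=> Ms Me; rewrite /group_mean; congr (_ *: _).
rewrite linearD/= !trmx_mul linearB/= trmx1 Ms mulmxDl -!mulmxA Me mulmx0 addr0.
by rewrite mulmxBl Me mul1mx subr0.
Qed.

Definition basic_bad (eta : R) : set 'M[R]_(n, p) :=
  ([set z | eta * s1 ^+ 2 <= `|inner (z^T *m e1) (z^T *m e1) - p%:R|] `|`
   [set z | eta * s2 ^+ 2 <= `|inner (z^T *m e2) (z^T *m e2) - p%:R|]) `|`
  ([set z | eta * (s1 * s2) <= `|inner (z^T *m e1) (z^T *m e2)|] `|`
   ([set z | eta * s1 <= `|inner (e1 *m delta^T) z|] `|` [set z | eta * s2 <= `|inner (e2 *m delta^T) z|])).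

Section basic.
Context d (T : measurableType d) (P : probability T R) (z : T -> 'M[R]_(n, p)).
Hypotheses (gz : gaussmx P z) (e11 : inner e1 e1 = 1) (e22 : inner e2 e2 = 1) (e12 : inner e1 e2 = 0).
Hypotheses (s10 : 0 < s1) (s20 : 0 < s2).
Let mz : mfmx z. Proof. by case: gz. Qed.

Let inner_outer (e : 'cV[R]_n) : inner e e = 1 -> inner (e *m delta^T) (e *m delta^T) = inner delta delta.
Proof.
move=> ee; rewrite inner_mulr trmxK -mulmxA.
by rewrite tr_mul_inner mul_mx_scalar innerZl ee mulr1.
Qed.

Let mtr (e : 'cV[R]_n) : mfmx (fun w => (z w)^T *m e).
Proof. by apply: mfmxM; [exact: mfmx_tr|exact: mfmx_cst]. Qed.

Let mabs (f : T -> R) c : measurable_fun setT f -> measurable [set w | c <= `|f w|].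
Proof. by move=> mf; apply: measurable_ge_set; exact: measurableT_comp. Qed.

Lemma measurable_basic_bad eta : measurable [set w | basic_bad eta (z w)].
Proof.
apply: measurableU; first by apply: measurableU; apply: measurable_dist_ge; exact: measurable_inner_fun.
apply: measurableU; first by apply: mabs; exact: measurable_inner_fun.
by apply: measurableU; apply: mabs; exact: measurable_inner.
Qed.

Lemma basic_bad_le eta : 0 < eta ->
  (P [set w | basic_bad eta (z w)] <=
   ((2 * p%:R / (eta * s1 ^+ 2) ^+ 2 + 2 * p%:R / (eta * s2 ^+ 2) ^+ 2) +
    (4 * p%:R / (eta * (s1 * s2)) ^+ 2 + (inner delta delta / (eta * s1) ^+ 2 + inner delta delta / (eta * s2) ^+ 2)))%:E)%E.
Proof.
move=> eta0.
apply: prob_setU_le.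
- by apply: measurableU; apply: measurable_dist_ge; exact: measurable_inner_fun.
- apply: measurableU; first by apply: mabs; exact: measurable_inner_fun.
  by apply: measurableU; apply: mabs; exact: measurable_inner.
- apply: prob_setU_le; try (by apply: measurable_dist_ge; exact: measurable_inner_fun).
    by apply: gauss_norm_conc; rewrite // mulr_gt0// exprn_gt0.
  by apply: gauss_norm_conc; rewrite // mulr_gt0// exprn_gt0.
apply: prob_setU_le; first by apply: mabs; exact: measurable_inner_fun.
- by apply: measurableU; apply: mabs; exact: measurable_inner.
- by apply: gauss_cross_conc; rewrite // !mulr_gt0.
apply: prob_setU_le; try (by apply: mabs; exact: measurable_inner).
  by rewrite -(inner_outer e11); apply: gauss_inner_conc; rewrite // mulr_gt0.
by rewrite -(inner_outer e22); apply: gauss_inner_conc; rewrite // mulr_gt0.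
Qed.
End basic.
End whitened_rate.

(** In terms of the bounded ratios [p / s1 ^+ 2] and [p / s2 ^+ 2] every summand is a constant over
    [eta ^+ 2 * p]. *)
Lemma basic_bound (R : realType) (p s1 s2 eta D2 y1 y2 r : R) : 0 < p -> 0 < s1 -> 0 < s2 -> 0 < eta ->
  0 <= D2 -> 0 < y1 -> 0 < y2 -> 0 < r -> p / s1 ^+ 2 <= y1 + 1 -> p / s2 ^+ 2 <= y2 + 1 ->
  2 * ((2 * (y1 + 1) ^+ 2 + 2 * (y2 + 1) ^+ 2 + 4 * ((y1 + 1) * (y2 + 1)) +
     D2 * (y1 + 1) + D2 * (y2 + 1)) / eta ^+ 2) / r <= p ->
  (2 * p / (eta * s1 ^+ 2) ^+ 2 + 2 * p / (eta * s2 ^+ 2) ^+ 2) +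
  (4 * p / (eta * (s1 * s2)) ^+ 2 + (D2 / (eta * s1) ^+ 2 + D2 / (eta * s2) ^+ 2)) <= r / 2.
Proof.
move=> p0 s10 s20 eta0 D20 y10 y20 r0 q1y q2y Kp.
set C0 := _ / eta ^+ 2 in Kp.
have -> : (2 * p / (eta * s1 ^+ 2) ^+ 2 + 2 * p / (eta * s2 ^+ 2) ^+ 2) +
  (4 * p / (eta * (s1 * s2)) ^+ 2 + (D2 / (eta * s1) ^+ 2 + D2 / (eta * s2) ^+ 2)) =
  (2 * (p / s1 ^+ 2) ^+ 2 + 2 * (p / s2 ^+ 2) ^+ 2 + 4 * ((p / s1 ^+ 2) * (p / s2 ^+ 2)) +
     D2 * (p / s1 ^+ 2) + D2 * (p / s2 ^+ 2)) / eta ^+ 2 / p.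
  by field; rewrite !gt_eqF.
have q10 : 0 <= p / s1 ^+ 2 by rewrite divr_ge0 ?sqr_ge0// ltW.
have q20 : 0 <= p / s2 ^+ 2 by rewrite divr_ge0 ?sqr_ge0// ltW.
apply: (@le_trans _ _ (C0 / p)).
  rewrite ler_wpM2r ?invr_ge0 ?(ltW p0)// /C0 ler_wpM2r ?invr_ge0 ?sqr_ge0//.
  rewrite !lerD// ler_wpM2l//; try (by rewrite lerXn2r// nnegrE ?addr_ge0// ltW); by rewrite ler_pM.
by move: Kp; clearbody C0; rewrite !ler_pdivrMr// => h; lra.
Qed.

Section rate_concentration.
Variable R : realType.

Lemma scaled_dist_lt (g p s eta y : R) : 0 < s -> `|g - p| < eta * s ^+ 2 -> `|p / s ^+ 2 - y| < eta ->
  `|g / (s * s) - y| < eta + eta.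
Proof.
move=> s0 h1 h2; have -> : g / (s * s) - y = (g - p) / s ^+ 2 + (p / s ^+ 2 - y) by field; rewrite gt_eqF.
apply: le_lt_trans (ler_normD _ _) _; apply: ltrD => //.
by rewrite normrM normfV (@gtr0_norm _ (s ^+ 2)) ?exprn_gt0// ltr_pdivrMr ?exprn_gt0.
Qed.

Lemma scaled_norm_lt (g s eta : R) : 0 < s -> 0 < eta -> `|g| < eta * s -> `|g / s| < eta + eta.
Proof.
move=> s0 eta0 h; rewrite normrM normfV (gtr0_norm s0) ltr_pdivrMr//; apply: (lt_le_trans h).
by rewrite ler_pM2r// lerDl ltW.
Qed.

Lemma group_mean_inner (n p : nat) (s t : R) (e f : 'cV[R]_n) (z : 'M[R]_(n, p)) :
  inner (group_mean s e z) (group_mean t f z) = inner (z^T *m e) (z^T *m f) / (s * t).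
Proof. by rewrite innerZl innerZr invfM; ring. Qed.

Lemma inner_group_mean (n p : nat) (s : R) (e : 'cV[R]_n) (delta : 'cV[R]_p) (z : 'M[R]_(n, p)) :
  inner delta (group_mean s e z) = inner (e *m delta^T) z / s.
Proof.
rewrite innerZr mulrC; congr (_ * _).
by rewrite inner_mull trmxK [RHS]innerC inner_mulr trmxK.
Qed.

Lemma quad_good (n p : nat) (M : 'M[R]_n) (y e : R) (v : 'cV[R]_p) (z : 'M[R]_(n, p)) :
  ~ quad_bad M y e v z ->
  `|\tr M * inner v (invmx (gram M z 1%:M) *m v) - (1 - y)^-1 * inner v v| <= e * inner v v /\
  `|\tr M ^+ 2 * inner (invmx (gram M z 1%:M) *m v) (invmx (gram M z 1%:M) *m v)
      - (1 - y)^-1 ^+ 3 * inner v v| <= e * inner v v.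
Proof.
move=> h; split; rewrite leNgt; apply/negP => b; apply: h; right; by [left|right].
Qed.

Lemma inner_polarization (p : nat) (G : 'M[R]_p) (h d : 'cV[R]_p) : G^T = G ->
  inner h (G *m d) = (inner (h + d) (G *m (h + d)) - inner (h - d) (G *m (h - d))) / 4.
Proof.
move=> Gs; have E : inner d (G *m h) = inner h (G *m d) by rewrite inner_mull Gs innerC.
rewrite !mulmxDr mulmxN !innerDl !innerDr !innerNl !innerNr E.
by move: (inner _ _) (inner _ _) (inner _ _) => a b c; field.
Qed.

Lemma inner_parallelogram (p : nat) (h d : 'cV[R]_p) :
  inner (h + d) (h + d) + inner (h - d) (h - d) = 2 * inner h h + 2 * inner d d.
Proof.
rewrite !innerDl !innerDr !innerNl !innerNr.
by move: (inner _ _) (inner _ _) (inner _ _) (inner _ _) => x1 x2 x3 x4; ring.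
Qed.

Lemma inner_polar_identity (p : nat) (h d : 'cV[R]_p) :
  inner (h + d) (h + d) - inner (h - d) (h - d) = 4 * inner h d.
Proof.
rewrite !innerDl !innerDr !innerNl !innerNr (innerC d h).
by move: (inner _ _) (inner _ _) (inner _ _) => x1 x2 x3; ring.
Qed.

Lemma whitened_rate_conc (y1 y2 Delta eps r : R) (y := y1 * y2 / (y1 + y2)) :
  0 < y1 -> 0 < y2 -> y < 1 -> 0 < eps -> 0 < r ->
  exists2 del : R, 0 < del & exists K : R,
  forall d (T : measurableType d) (P : probability T R) (n p : nat) (z : T -> 'M[R]_(n, p))
    (M : 'M[R]_n) (e1 e2 : 'cV[R]_n) (s1 s2 : R) (delta : 'cV[R]_p),
  gaussmx P z -> proj M -> M *m e1 = 0 -> M *m e2 = 0 ->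
  inner e1 e1 = 1 -> inner e2 e2 = 1 -> inner e1 e2 = 0 -> 0 < s1 -> 0 < s2 ->
  inner delta delta = Delta ^+ 2 ->
  `|p%:R / s1 ^+ 2 - y1| < del -> `|p%:R / s2 ^+ 2 - y2| < del -> `|p%:R / \tr M - y| < del -> K <= p%:R ->
  (P [set w | gram M (z w) 1%:M \notin unitmx \/
    (eps <= `|whitened_rate M e1 e2 s1 s2 delta (z w) -
     2^-1 * (Phi (- ((Delta ^+ 2 - (y1 - y2)) / (2 * Num.sqrt (Delta ^+ 2 + y1 + y2))) * Num.sqrt (1 - y)) +
            Phi (- ((Delta ^+ 2 + (y1 - y2)) / (2 * Num.sqrt (Delta ^+ 2 + y1 + y2))) * Num.sqrt (1 - y)))|)%R]
    <= r%:E)%E.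
Proof.
move=> y10 y20 y1lt eps0 r0.
have y0 : 0 < y by rewrite divr_gt0 ?mulr_gt0// addr_gt0.
have y01 : 0 < 1 - y by rewrite subr_gt0.
clearbody y.
have [k kE] : exists k, k = (1 - y)^-1 by exists (1 - y)^-1.
have [D DE] : exists D, D = Delta ^+ 2 + y1 + y2 by exists (Delta ^+ 2 + y1 + y2).
have D0 : 0 < D by rewrite DE -addrA ltr_wpDl ?sqr_ge0// addr_gt0.
have D0' : 0 < Delta ^+ 2 + y1 + y2 by rewrite -DE.
have k0 : 0 < k by rewrite kE invr_gt0.
have k30 : 0 < k ^+ 3 by rewrite exprn_gt0.
have [t t0 ht] := rate_limit y01 D0' eps0.
rewrite -kE -DE in ht.
(* A bound for [|d|^2 < D + 8] and for the means of [|h + d|^2] and [|h - d|^2], which equal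
   [|h|^2 + |d|^2]; 20 leaves slack. *)
have [B BE] : exists B, B = D + y1 + y2 + 20 by exists (D + y1 + y2 + 20).
have B0 : 0 < B by rewrite BE !addr_gt0.
have [e [e0 eB]] : exists e, 0 < e /\ e * B <= t / 4.
  by exists (t / (4 * B)); split; [rewrite divr_gt0// mulr_gt0|rewrite le_eqVlt; apply/orP; left; apply/eqP; field; rewrite gt_eqF].
have [s [s0 s1lt ks ks3]] : exists s, [/\ 0 < s, s <= 1, 8 * k * s <= t / 4 & 8 * k ^+ 3 * s <= t / 4].
  have kk0 : 0 < 32 * (k + k ^+ 3) by rewrite mulr_gt0// addr_gt0.
  exists (Num.min 1 (t / (32 * (k + k ^+ 3)))).
  have st : Num.min 1 (t / (32 * (k + k ^+ 3))) * (32 * (k + k ^+ 3)) <= t by rewrite -ler_pdivlMr// ge_min lexx orbT.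
  have sp : 0 < Num.min 1 (t / (32 * (k + k ^+ 3))) by rewrite lt_min ltr01 divr_gt0.
  split => //; first by rewrite ge_min lexx.
    have : 0 < Num.min 1 (t / (32 * (k + k ^+ 3))) * k ^+ 3 by rewrite mulr_gt0.
    by move: (Num.min _ _) st => u st; lra.
  have : 0 < Num.min 1 (t / (32 * (k + k ^+ 3))) * k by rewrite mulr_gt0.
  by move: (Num.min _ _) st => u st; lra.
(* Half of [s] goes to the fluctuation of [|h_k|^2] around [p / s_k^2] and half to the distance of
   this ratio from [y_k]. *)
have [eta [eta0 etaE]] : exists eta, 0 < eta /\ s = eta + eta.
  by exists (s / 2); split; [rewrite divr_gt0|rewrite -splitr].
(* Five quadratic forms, at [d], [h_1 + d], [h_1 - d], [h_2 + d] and [h_2 - d], receive [r / 10]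
   each; the laws of large numbers receive [r / 2]. *)
have r10 : 0 < r / 10 by rewrite divr_gt0.
have [del1 del10 [K1 hK1]] := inverse_moments_conc y0 y1lt e0 r10.
pose C := (2 * (y1 + 1) ^+ 2 + 2 * (y2 + 1) ^+ 2 + 4 * ((y1 + 1) * (y2 + 1)) +
     Delta ^+ 2 * (y1 + 1) + Delta ^+ 2 * (y2 + 1)) / eta ^+ 2.
have C0 : 0 <= 2 * C / r.
  have y1p : 0 <= y1 + 1 by rewrite addr_ge0// ltW.
  have y2p : 0 <= y2 + 1 by rewrite addr_ge0// ltW.
  apply: divr_ge0; last exact: ltW.
  apply: mulr_ge0 => //; apply: divr_ge0; last exact: sqr_ge0.
  have h2 x : 0 <= x -> 0 <= 2 * x ^+ 2 :> R by move=> _; apply: mulr_ge0 => //; exact: sqr_ge0.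
  have hD x : 0 <= x -> 0 <= Delta ^+ 2 * x by move=> ?; apply: mulr_ge0 => //; exact: sqr_ge0.
  have h4 : 0 <= 4 * ((y1 + 1) * (y2 + 1)) by apply: mulr_ge0 => //; exact: mulr_ge0.
  exact: (addr_ge0 (addr_ge0 (addr_ge0 (addr_ge0 (h2 _ y1p) (h2 _ y2p)) h4) (hD _ y1p)) (hD _ y2p)).
exists (Num.min (Num.min del1 eta) 1); first by rewrite !lt_min del10 eta0 ltr01.
exists (`|K1| + 1 + 2 * C / r).
move=> d T P n p z M e1 e2 s1 s2 delta gz pM Me1 Me2 e11 e22 e12 s10 s20 dd.
rewrite !lt_min => /andP[/andP[_ q1e] q11] /andP[/andP[_ q2e] q21] /andP[/andP[qy _] _] Kp.
have mz : mfmx z by case: gz.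
have KK1 : K1 <= p%:R.
  apply: le_trans Kp; apply: (le_trans (ler_norm K1)).
  by rewrite -addrA lerDl addr_ge0.
have p0 : 0 < (p%:R : R).
  apply: lt_le_trans Kp; rewrite -addrA ltr_wpDl//; by rewrite ltr_pwDl.
have KC : 2 * C / r <= p%:R by apply: le_trans Kp; rewrite lerDr addr_ge0.
have pn0 : (0 < p)%N by rewrite -(ltr0n R).
have Hu u : inner u u = 1 -> (P [set w | inverse_moments_bad M y e u (z w)] <= (r / 10)%:E)%E.
  by move=> u1; exact: hK1.
have [Ms MM] := pM.
have mid : mfmx (fun N : mxT R n p => N) by exact: mfmx_id.
pose h1 (N : 'M[R]_(n, p)) := group_mean s1 e1 N; pose h2 (N : 'M[R]_(n, p)) := group_mean s2 e2 N.
pose df (N : 'M[R]_(n, p)) := group_diff e1 e2 s1 s2 delta N.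
have mh1 := mfmx_group_mean mid s1 e1; have mh2 := mfmx_group_mean mid s2 e2.
have mdf := mfmx_group_diff e1 e2 s1 s2 delta mid.
have h1M A Bx : h1 ((1%:M - M) *m A + M *m Bx) = h1 A by exact: group_mean_between.
have h2M A Bx : h2 ((1%:M - M) *m A + M *m Bx) = h2 A by exact: group_mean_between.
have dfM A Bx : df ((1%:M - M) *m A + M *m Bx) = df A.
  by rewrite /df /group_diff; congr (delta + _ - _); [exact: h1M|exact: h2M].
pose S (f : 'M[R]_(n, p) -> 'cV[R]_p) := [set w | quad_bad M y e (f (z w)) (z w)].
have mS f : mfmx (fun N : mxT R n p => f N) -> measurable (S f).
  move=> mf; apply: measurable_quad_bad => //.
  by move=> i j; exact: (measurableT_comp (mf i j) (measurable_mx mz)).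
have PS f : mfmx (fun N : mxT R n p => f N) -> (forall A Bx, f ((1%:M - M) *m A + M *m Bx) = f A) ->
    (P (S f) <= (r / 10)%:E)%E.
  by move=> mf fM; exact: (quad_bad_random_le gz pM pn0 Hu mf fM).
pose f1 N := h1 N + df N; pose f2 N := h1 N - df N; pose f3 N := h2 N + df N; pose f4 N := h2 N - df N.
have mf1 : mfmx (fun N : mxT R n p => f1 N) by exact: mfmxD.
have mf2 : mfmx (fun N : mxT R n p => f2 N) by exact: mfmxB.
have mf3 : mfmx (fun N : mxT R n p => f3 N) by exact: mfmxD.
have mf4 : mfmx (fun N : mxT R n p => f4 N) by exact: mfmxB.
have f1M A Bx : f1 ((1%:M - M) *m A + M *m Bx) = f1 A by rewrite /f1 h1M dfM.
have f2M A Bx : f2 ((1%:M - M) *m A + M *m Bx) = f2 A by rewrite /f2 h1M dfM.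
have f3M A Bx : f3 ((1%:M - M) *m A + M *m Bx) = f3 A by rewrite /f3 h2M dfM.
have f4M A Bx : f4 ((1%:M - M) *m A + M *m Bx) = f4 A by rewrite /f4 h2M dfM.
pose S0 := [set w | basic_bad e1 e2 s1 s2 delta eta (z w)].
have mS0 : measurable S0 by apply: measurable_basic_bad; exact: gz.
have PS0 : (P S0 <= (r / 2)%:E)%E.
  apply: le_trans (basic_bad_le delta gz e11 e22 e12 s10 s20 eta0) _.
  rewrite dd lee_fin; apply: basic_bound y10 y20 r0 _ _ KC => //; first exact: sqr_ge0.
    by move: q11; rewrite ltr_norml => /andP[_]; rewrite ltrBlDr addrC => /ltW.
  by move: q21; rewrite ltr_norml => /andP[_]; rewrite ltrBlDr addrC => /ltW.
have mdS : measurable (S df) by exact: mS.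
have m12 : measurable (S f1 `|` S f2) by apply: measurableU; exact: mS.
have m34 : measurable (S f3 `|` S f4) by apply: measurableU; exact: mS.
have mS4 : measurable ((S f1 `|` S f2) `|` (S f3 `|` S f4)) by exact: measurableU.
have mS5 : measurable (S df `|` ((S f1 `|` S f2) `|` (S f3 `|` S f4))) by exact: measurableU.
have {PS} PU : (P (S0 `|` (S df `|` ((S f1 `|` S f2) `|` (S f3 `|` S f4)))) <= r%:E)%E.
  have -> : r = r / 2 + (r / 10 + ((r / 10 + r / 10) + (r / 10 + r / 10))) by field.
  apply: prob_setU_le => //; apply: prob_setU_le => //; first exact: PS.
  by apply: prob_setU_le => //; apply: prob_setU_le; try exact: mS; exact: PS.
apply: le_trans PU; apply: le_measure; rewrite ?inE.
- apply: measurableU; first exact: measurable_gram_singular.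
  by apply: measurable_dist_ge; exact: measurable_whitened_rate.
- exact: measurableU.
move=> w bad; apply: contrapT => /not_orP[nb /not_orP[nd /not_orP[/not_orP[n1 n2] /not_orP[n3 n4]]]].
have Wu : gram M (z w) 1%:M \in unitmx.
  by apply/negP => h; apply: nd; left; exact/negP.
case: bad => [/negP//|]; apply/negP; rewrite -ltNge.
have [qd qd3] := quad_good nd.
have [q1 _] := quad_good n1; have [q2 _] := quad_good n2.
have [q3 _] := quad_good n3; have [q4 _] := quad_good n4.
have b1 : `|inner ((z w)^T *m e1) ((z w)^T *m e1) - p%:R| < eta * s1 ^+ 2.
  by rewrite ltNge; apply/negP => h; apply: nb; left; left.
have b2 : `|inner ((z w)^T *m e2) ((z w)^T *m e2) - p%:R| < eta * s2 ^+ 2.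
  by rewrite ltNge; apply/negP => h; apply: nb; left; right.
have b3 : `|inner ((z w)^T *m e1) ((z w)^T *m e2)| < eta * (s1 * s2).
  by rewrite ltNge; apply/negP => h; apply: nb; right; left.
have b4 : `|inner (e1 *m delta^T) (z w)| < eta * s1.
  by rewrite ltNge; apply/negP => h; apply: nb; right; right; left.
have b5 : `|inner (e2 *m delta^T) (z w)| < eta * s2.
  by rewrite ltNge; apply/negP => h; apply: nb; right; right; right.
have := scaled_dist_lt s10 b1 q1e; rewrite -group_mean_inner -etaE => {}b1.
have := scaled_dist_lt s20 b2 q2e; rewrite -group_mean_inner -etaE => {}b2.
have := scaled_norm_lt (mulr_gt0 s10 s20) eta0 b3; rewrite -group_mean_inner -etaE => {}b3.
have := scaled_norm_lt s10 eta0 b4; rewrite -inner_group_mean -etaE => {}b4.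
have := scaled_norm_lt s20 eta0 b5; rewrite -inner_group_mean -etaE => {}b5.
have [T1 T2 T3] := moments_tolerance (Delta ^+ 2) b1 b2 b3 b4 b5.
have Gs : (invmx (gram M (z w) 1%:M))^T = invmx (gram M (z w) 1%:M).
  have p1 : proj (1%:M : 'M[R]_p) := proj_mx1 _ _.
  by rewrite trmx_inv gram_sym.
have ddE : inner (df (z w)) (df (z w)) = Delta ^+ 2 + inner (h1 (z w)) (h1 (z w)) + inner (h2 (z w)) (h2 (z w)) +
    2 * inner delta (h1 (z w)) - 2 * inner delta (h2 (z w)) - 2 * inner (h1 (z w)) (h2 (z w)).
  rewrite /df /group_diff -/(h1 (z w)) -/(h2 (z w)) !(innerDl, innerDr, innerNl, innerNr) dd.
  rewrite (innerC (h1 (z w)) delta) (innerC (h2 (z w)) delta) (innerC (h2 (z w)) (h1 (z w))).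
  by ring.
have h1dE : inner (h1 (z w)) (df (z w)) = inner delta (h1 (z w)) + inner (h1 (z w)) (h1 (z w)) - inner (h1 (z w)) (h2 (z w)).
  by rewrite /df /group_diff -/(h1 (z w)) -/(h2 (z w)) !(innerDr, innerNr) (innerC (h1 (z w)) delta).
have h2dE : inner (h2 (z w)) (df (z w)) = inner delta (h2 (z w)) + inner (h1 (z w)) (h2 (z w)) - inner (h2 (z w)) (h2 (z w)).
  by rewrite /df /group_diff -/(h1 (z w)) -/(h2 (z w)) !(innerDr, innerNr) (innerC (h2 (z w)) delta) (innerC (h2 (z w)) (h1 (z w))).
rewrite -/(h1 (z w)) -/(h2 (z w)) -DE -ddE in T1.
rewrite -/(h1 (z w)) -/(h2 (z w)) -h1dE in T2.
rewrite -/(h1 (z w)) -/(h2 (z w)) -h2dE in T3.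
have X1B : inner (h1 (z w)) (h1 (z w)) < y1 + 1.
  by move: b1; rewrite ltr_norml => /andP[_]; rewrite -/(h1 (z w)) ltrBlDl => h; apply: (lt_le_trans h); rewrite lerD2l.
have X2B : inner (h2 (z w)) (h2 (z w)) < y2 + 1.
  by move: b2; rewrite ltr_norml => /andP[_]; rewrite -/(h2 (z w)) ltrBlDl => h; apply: (lt_le_trans h); rewrite lerD2l.
have ddB : inner (df (z w)) (df (z w)) < D + 8.
  move: T1; rewrite ltr_norml => /andP[_]; rewrite ltrBlDl => h; apply: (lt_le_trans h).
  by rewrite lerD2l -[leRHS]mulr1 ler_wpM2l.
have ddB' : inner (df (z w)) (df (z w)) <= B.
  by rewrite BE; clear -ddB y10 y20; move: (inner _ _) ddB => x; lra.
have VB1 : inner (h1 (z w) + df (z w)) (h1 (z w) + df (z w)) + inner (h1 (z w) - df (z w)) (h1 (z w) - df (z w)) <= 2 * B.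
  rewrite inner_parallelogram BE; clear -X1B ddB y10 y20 D0; move: (inner _ _) (inner _ _) X1B ddB => x1 x2; lra.
have VB2 : inner (h2 (z w) + df (z w)) (h2 (z w) + df (z w)) + inner (h2 (z w) - df (z w)) (h2 (z w) - df (z w)) <= 2 * B.
  rewrite inner_parallelogram BE; clear -X2B ddB y10 y20 D0; move: (inner _ _) (inner _ _) X2B ddB => x1 x2; lra.
have N3 : \tr M * inner (h1 (z w)) (invmx (gram M (z w) 1%:M) *m df (z w)) =
   (\tr M * inner (f1 (z w)) (invmx (gram M (z w) 1%:M) *m f1 (z w)) - \tr M * inner (f2 (z w)) (invmx (gram M (z w) 1%:M) *m f2 (z w))) / 4.
  by rewrite (inner_polarization _ _ Gs) mulrA mulrBr.
have N4 : \tr M * inner (h2 (z w)) (invmx (gram M (z w) 1%:M) *m df (z w)) =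
   (\tr M * inner (f3 (z w)) (invmx (gram M (z w) 1%:M) *m f3 (z w)) - \tr M * inner (f4 (z w)) (invmx (gram M (z w) 1%:M) *m f4 (z w))) / 4.
  by rewrite (inner_polarization _ _ Gs) mulrA mulrBr.
rewrite -kE in qd qd3 q1 q2 q3 q4.
rewrite -DE; apply: ht.
- exact: quad_tolerance k0 e0 t0 eB ks ddB' qd T1.
- rewrite -/(h1 (z w)) -/df N3; exact: polar_tolerance k0 e0 t0 eB ks VB1 (inner_polar_identity _ _) q1 q2 T2.
- rewrite -/(h2 (z w)) -/df N4 -[- (k * y2)]mulrN; exact: polar_tolerance k0 e0 t0 eB ks VB2 (inner_polar_identity _ _) q3 q4 T3.
- exact: quad_tolerance k30 e0 t0 eB ks3 ddB' qd3 T1.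
Qed.
End rate_concentration.

(** * The theorem *)

Section exact_rate.
Variable R : realType.

Lemma normal_prob_point (c : R) : normal_prob (0 : R) 1 [set c] = 0%E.
Proof.
have /null_content_dominatesP h := @normal_prob_dominates R 0 1.
by apply: h; [exact: measurable_set1|exact: lebesgue_measure_set1].
Qed.

(** Open and closed rays are covered together: ties go to class 2, so the error event is a closed
    half-space for class 1 and an open one for class 2. *)
Lemma normal_prob_ray (A : set R) (c : R) : measurable A ->
  [set x | x < c] `<=` A -> A `<=` [set x | x <= c] -> fine (normal_prob (0 : R) 1 A) = Phi c.
Proof.
move=> mA lA Au.
have mO : measurable (`]-oo, c[%classic : set R) by exact: measurable_itv.
have mC : measurable (`]-oo, c]%classic : set R) by exact: measurable_itv.
have AC : (normal_prob (0 : R) 1 A <= normal_prob (0 : R) 1 `]-oo, c])%E.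
  by apply: le_measure; rewrite ?inE// => x /Au; rewrite /= in_itv.
have CA : (normal_prob (0 : R) 1 `]-oo, c] <= normal_prob (0 : R) 1 A)%E.
  apply: (@le_trans _ _ (normal_prob (0 : R) 1 (`]-oo, c[ `|` [set c]))).
    apply: le_measure; rewrite ?inE//; first by apply: measurableU => //; exact: measurable_set1.
    by move=> x /=; rewrite !in_itv/= le_eqVlt => /orP[/eqP ->|xc]; [right|left].
  apply: (@le_trans _ _ (normal_prob (0 : R) 1 `]-oo, c[ + normal_prob (0 : R) 1 [set c])%E); first exact: measureU2.
  rewrite [X in (_ + X <= _)%E]normal_prob_point adde0; apply: le_measure; rewrite ?inE//.
by rewrite /Phi; congr fine; apply/eqP; rewrite eq_le AC CA.
Qed.

(** The law is invariant under the sign change. The value serves the degenerate classifier in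
    [lda_rateE]. *)
Lemma Phi0 : Phi (0 : R) = 2^-1.
Proof.
pose N := normal_prob (0 : R) 1.
have t1 : inner (const_mx (-1) : 'M[R]_1) (const_mx (-1) : 'M[R]_1) = 1.
  by rewrite /inner !big_ord1 !mxE mulrNN mulr1.
pose A := [set M : 'M[R]_1 | M 0 0 \in `]-oo, 0]].
have mA : measurable (A : set (mxT R 1 1)).
  rewrite (_ : A = (fun M : mxT R 1 1 => M 0 0) @^-1` `]-oo, 0]%classic)//.
  rewrite -[X in measurable X]setTI; exact: (measurable_entry 0 0 measurableT (measurable_itv `]-oo, (0 : R)])).
have := gauss_law (A := A) (gauss_normal R) (gauss_unit (gauss_normal R) t1) mA.
rewrite [X in _ X = _](_ : _ = `]-oo, 0]%classic); last first.
  by apply/seteqP; split => x; rewrite /A /= mxE.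
rewrite [X in _ = _ X](_ : _ = `[0, +oo[%classic); last first.
  by apply/seteqP; split => x; rewrite /A /= /inner !big_ord1 !mxE mulN1r !in_itv/= andbT oppr_le0.
move=> sym; have {}sym : N `]-oo, 0]%classic = N `[0, +oo[%classic by exact: sym.
have mC : measurable (`]-oo, (0 : R)]%classic : set R) by exact: measurable_itv.
have mO : measurable (`]-oo, (0 : R)[%classic : set R) by exact: measurable_itv.
have finC : N `]-oo, 0]%classic \is a fin_num by exact: fin_num_measure.
have finO : N `]-oo, 0[%classic \is a fin_num by exact: fin_num_measure.
have PO : fine (N `]-oo, 0[%classic) = Phi 0.
  by apply: normal_prob_ray => // x /=; rewrite in_itv//= => /ltW.
have : (N `[0%R, +oo[%classic = 1 - N `]-oo, 0%R[%classic)%E.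
  rewrite -(probability_setC N mO); congr (N _).
  by apply/seteqP; split => x /=; rewrite !in_itv/= andbT leNgt => /negP.
rewrite -sym -(fineK finC) -(fineK finO) PO -[fine _]/(Phi 0) -EFinB => -[h].
by move: h; move: (Phi 0) => x; lra.
Qed.

Lemma measurable_ray (l : bool) (c : R) : measurable [set x : R | if l then x <= c else x < c].
Proof.
by case: l; [have := measurable_itv `]-oo, c]|have := measurable_itv `]-oo, c[];
  congr (measurable _); apply/seteqP; split => x /=; rewrite in_itv.
Qed.

Section one_class.
Context d (T : measurableType d) (Q : probability T R) (p : nat).
Variables (mu : 'cV[R]_p) (Sigma : 'M[R]_p) (Z : {RV Q >-> borel_cV R p}).
Hypotheses (nZ : multivariate_normal mu Sigma Z).

Lemma mvn_halfspace (l : bool) (s : 'cV[R]_p) (m : R) : 0 < dot s (Sigma *m s) ->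
  fine (Q [set w | if l then dot s (Z w) <= m else dot s (Z w) < m]) =
  Phi ((m - dot s mu) / Num.sqrt (dot s (Sigma *m s))).
Proof.
move=> v0; have sv : 0 < Num.sqrt (dot s (Sigma *m s)) by rewrite sqrtr_gt0.
pose c := (m - dot s mu) / Num.sqrt (dot s (Sigma *m s)).
rewrite -/c -(normal_prob_ray (A := [set x : R | if l then x <= c else x < c])).
- rewrite (mvn_standardize nZ v0 (measurable_ray l c)); congr (fine (Q _)).
  apply/seteqP; split => w /=; by case: l; rewrite /c ?ler_pM2r ?ltr_pM2r ?invr_gt0// ?lerD2r ?ltrD2r.
- exact: measurable_ray.
- by move=> x /=; case: l => //; exact: ltW.
- by move=> x /=; case: l => //; exact: ltW.
Qed.
End one_class.

Lemma lda_rateE (p : nat) (n : 'I_2 -> nat) (x : forall k : 'I_2, 'I_(n k) -> 'cV[R]_p)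
  d (T : measurableType d) (Q : probability T R) (Z : 'I_2 -> {RV Q >-> borel_cV R p})
  (mu : 'I_2 -> 'cV[R]_p) (Sigma : 'M[R]_p) :
  covariance_matrix Sigma -> Sigma \in unitmx ->
  (forall k, multivariate_normal (mu k) Sigma (Z k)) ->
  lda_rate x Z = lda_rate_formula x mu Sigma.
Proof.
move=> cS Su nZ; have [L Lu SL] := covariance_factor cS Su.
pose a := invmx (pooled_cov x) *m mean_diff x.
have Ss : (invmx (pooled_cov x))^T = invmx (pooled_cov x).
  rewrite trmx_inv; congr invmx; rewrite /pooled_cov linearZ/=; congr (_ *: _).
  rewrite linear_sum/=; apply: eq_bigr => k _; rewrite linear_sum/=; apply: eq_bigr => j _.
  by rewrite trmx_mul trmxK.
have vE : dot (mean_diff x) (invmx (pooled_cov x) *m Sigma *m invmx (pooled_cov x) *m mean_diff x) =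
    dot a (Sigma *m a).
  by rewrite -!mulmxA dotE inner_mull Ss -dotE.
have sum2 (F : 'I_2 -> R) : \sum_k F k = F class1 + F class2.
  by rewrite big_ord_recl big_ord1; congr (F _ + F _); exact/val_inj.
rewrite /lda_rate /lda_rate_formula !sum2 vE -/a.
have dotNl u v : dot (- u) v = - dot u v :> R by rewrite !dotE innerNl.
have dotB u v w : dot (u - v) w = dot w u - dot w v :> R.
  by rewrite !dotE innerDl innerNl (innerC u) (innerC v).
have set1 : [set w | lda_classify x (Z class1 w) != class1] = [set w | dot a (Z class1 w) <= dot a (midpoint x)].
  apply/seteqP; split => w /=; rewrite /lda_classify -/a dotB subr_gt0; case: ltP => //.
have set2 : [set w | lda_classify x (Z class2 w) != class2] = [set w | dot (- a) (Z class2 w) < dot (- a) (midpoint x)].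
  by apply/seteqP; split => w /=; rewrite /lda_classify -/a dotB subr_gt0 !dotNl ltrN2; case: ltP.
rewrite set1 set2.
(* For [a = 0] the rule always answers class 2, so the errors are 1 and 0. In the formula the
   division by a zero root gives 0, and both terms become [Phi 0 = 1 / 2]; the averages agree. *)
have [a0|a0] := eqVneq a 0.
  have d0 u : dot (0 : 'cV[R]_p) u = 0 by rewrite dotE inner0l.
  have d0r u : dot u (0 : 'cV[R]_p) = 0 by rewrite dotE innerC inner0l.
  rewrite a0 !d0r !d0 sqrtr0 invr0 !mulr0 Phi0.
  rewrite (_ : [set w | dot 0 _ <= _] = setT); last by apply/seteqP; split => w //=; rewrite !d0.
  rewrite (_ : [set w | dot (- 0) _ < _] = set0); last by apply/seteqP; split => w //=; rewrite oppr0 !d0 ltxx.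
  by rewrite measure0 [X in fine X]probability_setT /=; field.
have v0 : 0 < dot a (Sigma *m a).
  rewrite dotE SL -mulmxA inner_mull lt_def inner_ge0 andbT inner_eq0.
  apply: contra_neq a0 => La0; have LTu : L^T \in unitmx by rewrite unitmx_tr.
  by rewrite -[LHS](mulKmx LTu) La0 mulmx0.
have v0' : 0 < dot (- a) (Sigma *m - a) by rewrite mulmxN dotNl !dotE innerNr opprK -dotE.
rewrite (mvn_halfspace (nZ class1) true _ v0) (mvn_halfspace (nZ class2) false _ v0').
have e1 : (-1) ^+ class1.+1 * dot (mu class1 - midpoint x) a = dot a (midpoint x) - dot a (mu class1).
  by rewrite expr1 mulN1r dotB opprB.
have e2 : (-1) ^+ class2.+1 * dot (mu class2 - midpoint x) a = dot (- a) (midpoint x) - dot (- a) (mu class2).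
  by rewrite sqrrN expr1n mul1r dotB !dotNl opprK addrC.
have e3 : dot (- a) (Sigma *m - a) = dot a (Sigma *m a) by rewrite mulmxN dotNl !dotE innerNr opprK.
by rewrite e1 e2 e3.
Qed.

Section measurability.
Context d (T : measurableType d) (P : probability T R) (p : nat) (n : 'I_2 -> nat).
Variables (X : forall k : 'I_2, 'I_(n k) -> {RV P >-> borel_cV R p}).
Variables (mu : 'I_2 -> 'cV[R]_p) (Sigma : 'M[R]_p).
Arguments X : clear implicits.

Lemma measurable_lda_rate_formula :
  measurable_fun setT (fun w => lda_rate_formula (fun k j => X k j w) mu Sigma).
Proof.
have mX k j : mfmx (fun w => X k j w : 'cV[R]_p) by exact: mfmx_RV.
have mM k : mfmx (fun w => sample_mean (fun k j => X k j w) k : 'cV[R]_p).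
  by apply: mfmxZ; [exact: measurable_cst|apply: mfmx_sum => j; exact: mX].
have mD : mfmx (fun w => mean_diff (fun k j => X k j w) : 'cV[R]_p) by exact: mfmxB.
have mC : mfmx (fun w => midpoint (fun k j => X k j w) : 'cV[R]_p).
  by apply: mfmxZ; [exact: measurable_cst|exact: mfmxD].
have mS : mfmx (fun w => pooled_cov (fun k j => X k j w) : 'M[R]_p).
  apply: mfmxZ; first exact: measurable_cst.
  apply: mfmx_sum => k; apply: mfmx_sum => j.
  by apply: mfmxM; [exact: mfmxB|apply: mfmx_tr; exact: mfmxB].
have mi := mfmx_inv mS.
have mdot (f g : T -> 'cV[R]_p) : mfmx f -> mfmx g -> measurable_fun setT (fun w => dot (f w) (g w)).
  move=> mf mg; rewrite (_ : (fun w => _) = (fun w => inner (f w) (g w))); last by apply/funext => w; rewrite dotE.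
  exact: measurable_inner_fun.
apply: measurable_funM => //; apply: measurable_sum => k.
apply: (measurableT_comp (@measurable_Phi R)); apply: measurable_funM.
  apply: measurable_funM => //; apply: mdot; last exact: mfmxM.
  by apply: mfmxB => //; exact: mfmx_cst.
apply: measurableT_comp; first exact: measurable_inv.
apply: (measurableT_comp (f := @Num.sqrt R)).
  by apply: continuous_measurable_fun; exact: sqrt_continuous.
apply: mdot => //; apply: mfmxM => //; apply: mfmxM => //; apply: mfmxM => //; exact: mfmx_cst.
Qed.
End measurability.
End exact_rate.

Section limits.
Variable R : realType.

(** Reciprocals are additive: [(n1 + n2 - 2) / p] is [n1 / p + n2 / p - 2 / p]. *)
Lemma pooled_ratio_cvg (p n1 n2 : nat -> nat) (y1 y2 : R) : 0 < y1 -> 0 < y2 ->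
  p m @[m --> \oo] --> \oo ->
  ((p m)%:R / (n1 m)%:R : R) @[m --> \oo] --> y1 -> ((p m)%:R / (n2 m)%:R : R) @[m --> \oo] --> y2 ->
  ((p m)%:R / ((n1 m + n2 m)%:R - 2) : R) @[m --> \oo] --> y1 * y2 / (y1 + y2).
Proof.
move=> y10 y20 hp h1 h2.
have p0 : (2 / (p m)%:R : R) @[m --> \oo] --> (0 : R).
  apply/cvgrPdist_lt => e e0; near=> m.
  have pm : (Num.trunc (2 / e)).+1%:R <= ((p m)%:R : R).
    by rewrite ler_nat; near: m; move: hp => /cvgnyPge; apply.
  have pe : 2 / e < (p m)%:R by apply: lt_le_trans pm; exact: truncnS_gt.
  have pp : 0 < ((p m)%:R : R) by apply: lt_trans pe; rewrite divr_gt0.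
  rewrite sub0r normrN ger0_norm ?divr_ge0// ?ltW// ltr_pdivrMr//.
  by move: pe; rewrite ltr_pdivrMr// mulrC.
have -> : y1 * y2 / (y1 + y2) = (y1^-1 + y2^-1 - 0)^-1 by field; rewrite !gt_eqF// addr_gt0.
rewrite (_ : (fun m => _) = (fun m => (((p m)%:R / (n1 m)%:R)^-1 + ((p m)%:R / (n2 m)%:R)^-1 - 2 / (p m)%:R)^-1 : R)); last first.
  by apply/funext => m; rewrite !invf_div -mulrDl -mulrBl invf_div natrD.
apply: cvgV; first by rewrite subr0 gt_eqF// addr_gt0// invr_gt0.
by apply: cvgB => //; apply: cvgD; apply: cvgV; rewrite ?gt_eqF.
Unshelve. all: by end_near. Qed.

Lemma cvge_to0 (u : nat -> \bar R) : (forall m, (0 <= u m)%E) ->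
  (forall r : R, 0 < r -> \forall m \near \oo, (u m <= r%:E)%E) -> u @ \oo --> 0%E.
Proof.
move=> u0 h; have ufin : \forall m \near \oo, u m \is a fin_num.
  near=> m; rewrite ge0_fin_numE//; apply: (@le_lt_trans _ _ (1 : R)%:E); last exact: ltry.
  by near: m; exact: h.
apply/fine_cvgP; split => //; apply/cvgrPdist_le => e e0; near=> m.
have uf : u m \is a fin_num by near: m; exact: ufin.
rewrite sub0r normrN ger0_norm ?fine_ge0// -lee_fin fineK//.
by near: m; exact: h.
Unshelve. all: by end_near. Qed.
End limits.

Theorem theorem2p3 (R : realType)
  (* dimensions and sample sizes of the m-th problem *)
  (p : nat -> nat) (n : nat -> 'I_2 -> nat)
  (* parameters of the m-th problem *)
  (mu : forall m : nat, 'I_2 -> 'cV[R]_(p m))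
  (Sigma : forall m : nat, 'M[R]_(p m))
  (* training samples *)
  (d : nat -> measure_display) (T : forall m : nat, measurableType (d m))
  (P : forall m : nat, probability (T m) R)
  (X : forall (m : nat) (k : 'I_2),
     'I_(n m k) -> {RV (P m) >-> borel_cV R (p m)})
  (* new observation from either class, on a probability space of its own *)
  (d' : nat -> measure_display) (T' : forall m : nat, measurableType (d' m))
  (Q : forall m : nat, probability (T' m) R)
  (Z : forall (m : nat), 'I_2 -> {RV (Q m) >-> borel_cV R (p m)})
  (Delta : R) (y : 'I_2 -> R)
  (hp : p m @[m --> \oo] --> \oo)
  (hn : forall k : 'I_2, n m k @[m --> \oo] --> \oo)
  (hmu : forall m : nat, mu m class1 <> mu m class2)
  (hSigma : forall m : nat, covariance_matrix (Sigma m))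
  (hSigma_inv : forall m : nat, Sigma m \in unitmx)
  (hX : forall (m : nat) (k : 'I_2) (j : 'I_(n m k)),
     multivariate_normal (mu m k) (Sigma m) (X m k j))
  (hX_indep : forall m : nat,
     mutually_independent
       (fun i : {k : 'I_2 & 'I_(n m k)} => X m (tag i) (tagged i)))
  (hZ : forall (m : nat) (k : 'I_2),
     multivariate_normal (mu m k) (Sigma m) (Z m k))
  (hy_gt0 : forall k : 'I_2, 0 < y k)
  (hy : forall k : 'I_2,
     ((p m)%:R / (n m k)%:R : R) @[m --> \oo] --> y k)
  (hy_lt1 : y class1 * y class2 / (y class1 + y class2) < 1)
  (hDelta : forall m : nat,
     Delta = Num.sqrt (dot (mu m class1 - mu m class2)
               (invmx (Sigma m) *m (mu m class1 - mu m class2)))) :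
  let R_LDA (m : nat) (w : T m) : R :=
    lda_rate (fun (k : 'I_2) (j : 'I_(n m k)) => X m k j w) (Z m) in
  let y12 : R := y class1 * y class2 / (y class1 + y class2) in
  (forall (m : nat) (w : T m),
     R_LDA m w = lda_rate_formula
       (fun (k : 'I_2) (j : 'I_(n m k)) => X m k j w) (mu m) (Sigma m)) /\
  cvg_in_probability P R_LDA
    (2^-1 * \sum_(k < 2)
       Phi (- ((Delta ^+ 2 + (-1) ^+ k.+1 * (y class1 - y class2))
               / (2 * Num.sqrt (Delta ^+ 2 + y class1 + y class2)))
            * Num.sqrt (1 - y12))).
Proof.
move=> R_LDA y12.
have exact_rate m w : R_LDA m w = lda_rate_formula (fun k j => X m k j w) (mu m) (Sigma m).
  exact: lda_rateE (hSigma m) (hSigma_inv m) (hZ m).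
split => // eps eps0.
have sum2 (F : 'I_2 -> R) : \sum_k F k = F class1 + F class2.
  by rewrite big_ord_recl big_ord1; congr (F _ + F _); exact/val_inj.
have [c cE] : exists c : R, c = 2^-1 * \sum_(k < 2)
       Phi (- ((Delta ^+ 2 + (-1) ^+ k.+1 * (y class1 - y class2))
               / (2 * Num.sqrt (Delta ^+ 2 + y class1 + y class2)))
            * Num.sqrt (1 - y12)) by eexists.
rewrite -cE.
apply: cvge_to0 => [m|r r0]; first exact: measure_ge0.
have [del del0 [K hK]] := whitened_rate_conc Delta (hy_gt0 class1) (hy_gt0 class2) hy_lt1 eps0 r0.
have hr := pooled_ratio_cvg (hy_gt0 class1) (hy_gt0 class2) hp (hy class1) (hy class2).
have ratio k : \forall m \near \oo, `|(p m)%:R / (n m k)%:R - y k| < del.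
  by have /cvgrPdist_lt/(_ _ del0) := hy k; apply: filterS => m'; rewrite distrC.
have c2E : c = 2^-1 * (Phi (- ((Delta ^+ 2 - (y class1 - y class2)) / (2 * Num.sqrt (Delta ^+ 2 + y class1 + y class2))) * Num.sqrt (1 - y12)) +
            Phi (- ((Delta ^+ 2 + (y class1 - y class2)) / (2 * Num.sqrt (Delta ^+ 2 + y class1 + y class2))) * Num.sqrt (1 - y12))).
  by rewrite cE sum2 /= expr1 mulN1r sqrrN expr1n mul1r.
rewrite -c2E in hK.
(* More than two observations in class 1 keep [N = n1 + n2 - 2] away from 0. *)
have hn1 : \forall m \near \oo, (2 < n m class1)%N by move: (hn class1) => /cvgnyPge; apply.
have hn2 : \forall m \near \oo, (0 < n m class2)%N by move: (hn class2) => /cvgnyPge; apply.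
near=> m.
have n0 k : (0 < n m k)%N.
  have [->|->] : k = class1 \/ k = class2.
    by case: k => -[|[|//]] i; [left|right]; exact/val_inj.
  - by apply: (@ltn_trans 2) => //; near: m.
  - by near: m.
have Kp : K <= (p m)%:R.
  have : (Num.trunc K).+1%:R <= ((p m)%:R : R).
    by rewrite ler_nat; near: m; move: hp => /cvgnyPge; apply.
  by apply: le_trans; exact/ltW/truncnS_gt.
have sq k : Num.sqrt ((n m k)%:R : R) ^+ 2 = (n m k)%:R by rewrite sqr_sqrtr ?ler0n.
have sq0 k : 0 < Num.sqrt ((n m k)%:R : R) by rewrite sqrtr_gt0 ltr0n.
have r1 : `|(p m)%:R / Num.sqrt (n m class1)%:R ^+ 2 - y class1| < del.
  by rewrite sq; near: m; exact: ratio.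
have r2 : `|(p m)%:R / Num.sqrt (n m class2)%:R ^+ 2 - y class2| < del.
  by rewrite sq; near: m; exact: ratio.
have r3 : `|(p m)%:R / \tr (within R (n m)) - y12| < del.
  rewrite tr_within//; near: m.
  by have /cvgrPdist_lt/(_ _ del0) := hr; apply: filterS => m'; rewrite distrC.
have [L Lu SL] := covariance_factor (hSigma m) (hSigma_inv m).
pose delta := invmx L *m (mu m class1 - mu m class2).
have SV : invmx (Sigma m) = (invmx L)^T *m invmx L.
  rewrite -[LHS]mulmx1 -(_ : Sigma m *m ((invmx L)^T *m invmx L) = 1%:M) ?mulKmx//.
  by rewrite SL -!mulmxA (mulmxA L^T) -trmx_mul mulVmx// trmx1 mul1mx mulmxV.
have dd : inner delta delta = Delta ^+ 2.
  have E : dot (mu m class1 - mu m class2) (invmx (Sigma m) *m (mu m class1 - mu m class2)) = inner delta delta.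
    by rewrite SV dotE -mulmxA inner_mull trmxK.
  by rewrite (hDelta m) E sqr_sqrtr// inner_ge0.
have gz := gauss_whitened Lu SL (hSigma m) (hX m) (hX_indep m).
have N0 : \tr (within R (n m)) != 0.
  rewrite tr_within// subr_eq0 eqr_nat; apply/eqP => h.
  have : (2 < n m class1)%N by near: m.
  by rewrite ltnNge -h leq_addr.
have mz : mfmx (fun w => whitened (mu m) L (fun k j => X m k j w)) by case: gz.
have mR : measurable_fun setT (R_LDA m).
  rewrite (_ : R_LDA m = fun w => lda_rate_formula (fun k j => X m k j w) (mu m) (Sigma m)).
    exact: measurable_lda_rate_formula.
  by apply/funext => w; exact: exact_rate.
have i11 : inner (class_vector R (n m) class1) (class_vector R (n m) class1) = 1 by rewrite class_vector_inner.
have i22 : inner (class_vector R (n m) class2) (class_vector R (n m) class2) = 1 by rewrite class_vector_inner.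
have i12 : inner (class_vector R (n m) class1) (class_vector R (n m) class2) = 0 by rewrite class_vector_inner.
have := hK _ _ _ _ _ _ _ _ _ _ _ _ gz (proj_within R n0) (within_class R n0 class1) (within_class R n0 class2)
  i11 i22 i12 (sq0 class1) (sq0 class2) dd r1 r2 r3 Kp.
apply: le_trans; apply: le_measure; rewrite ?inE.
- rewrite (_ : [set w | _] = [set w | `]eps, +oo[%classic `|R_LDA m w - c|]).
    apply: measurable_preim => //; apply: measurableT_comp => //; exact: measurable_funB.
  by apply/seteqP; split => w /=; rewrite in_itv/= andbT.
- apply: measurableU; first exact: measurable_gram_singular.
  by apply: measurable_dist_ge; exact: measurable_whitened_rate.
(* Samples with a singular Gram matrix belong to the exceptional event already; on the others the
   rate is the whitened one. *)
- move=> w /= h; have [Wu|Wu] := boolP (gram (within R (n m)) (whitened (mu m) L (fun k j => X m k j w)) 1%:M \in unitmx); last by left.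
  by right; move: h; rewrite exact_rate (lda_rate_formula_whitened Lu SL n0 Wu N0) => /ltW.
Unshelve. all: by end_near.
Qed.
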